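(* (1) Let $K$ be an algebraic extension of $\mathbb{R}$, $\mathbb{Q}_p$, or $\mathbb{F}_p((z))$ (with $p$ a prime number), and let $l$ be a prime number. Let $c$ be an element of $\mathrm{K}^{\mathrm{M}}_1(K)/l$. Then the ideal $(c)=c\,\mathrm{K}^{\mathrm{M}}(K)/l\subset\mathrm{K}^{\mathrm{M}}(K)/l$ is a Koszul module over $\mathrm{K}^{\mathrm{M}}(K)/l$. (2) Let $K$ be a Henselian discrete valuation field with residue field $k$, and let $l\ne\operatorname{char} k$ be a prime number. Assume that the graded algebra $\mathrm{K}^{\mathrm{M}}(k)/l$ is Koszul and that for any element $c\in\mathrm{K}^{\mathrm{M}}_1(k)/l$ the ideal $(c)\subset\mathrm{K}^{\mathrm{M}}(k)/l$ is a Koszul module over $\mathrm{K}^{\mathrm{M}}(k)/l$. Then the graded algebra $\mathrm{K}^{\mathrm{M}}(K)/l$ has the same properties: it is Koszul, and for any element $c\in\mathrm{K}^{\mathrm{M}}_1(K)/l$ the ideal $(c)\subset\mathrm{K}^{\mathrm{M}}(K)/l$ is a Koszul module over $\mathrm{K}^{\mathrm{M}}(K)/l$.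
   Context: $\mathrm{K}^{\mathrm{M}}(K)$ denotes the Milnor K-theory ring of a field $K$, and $\mathrm{K}^{\mathrm{M}}(K)/l$ its reduction modulo $l$, a graded $\mathbb{Z}/l$-algebra; thus $\mathrm{K}^{\mathrm{M}}_1(K)/l=K^*/K^{*l}$. Koszulity: a graded associative algebra $A=\bigoplus_{n\ge0}A_n$ over a field $k$ with $A_0=k$ is called Koszul if $\operatorname{Tor}^A_{i,j}(k,k)=0$ for all $i\ne j$, where $i$ is the homological grading and $j$ is the internal grading induced by the grading of $A$ (no finite-dimensionality of the components is assumed). A graded left module $M=\bigoplus_{n\ge1}M_n$ over a Koszul algebra $A$ is called Koszul if $\operatorname{Tor}^A_{i,j}(k,M)=0$ for all $i\ne j-1$. *)

(* Defs.v *)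
From HB Require Import structures.
From mathcomp Require Import all_boot all_order all_algebra.
From mathcomp Require Import finmap generic_quotient ring_quotient.
From mathcomp Require Import boolp reals.
From mathcomp.multinomials Require Import monalg.

Set Implicit Arguments.
Unset Strict Implicit.
Unset Printing Implicit Defensive.

Import GRing.Theory.
Local Open Scope ring_scope.
Local Open Scope quotient_scope.

(* A = \bigoplus_n A_n is encoded by its family of projections
   gpart n : A -> A_n; thus A_n = {x | gpart n x = x}.  The map gaug is the
   projection A -> A_0 read through the identification A_0 = k, i.e. the
   augmentation of A; its kernel is A_+ = \bigoplus_(n >= 1) A_n. *)
Record gradedAlgebra (k : fieldType) := GradedAlgebra {
  galg :> algType k;
  gpart : nat -> galg -> galg;
  gaug : galg -> k;
  gpartP : forall n, linear (gpart n);
  gpartK : forall m n x, gpart m (gpart n x) = if m == n then gpart n x else 0;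
  gpart_sum : forall x, exists N, x = \sum_(n < N) gpart n x;
  gpartM : forall m n x y,
    gpart (m + n) (gpart m x * gpart n y) = gpart m x * gpart n y;
  gpart1 : gpart 0 1 = 1;
  gpart0E : forall x, gpart 0 x = (gaug x)%:A
}.
Arguments gpart {k g} n x.
Arguments gaug {k g} x.

(* Left modules, with the same encoding of the grading. *)
Record gradedModule (k : fieldType) (A : gradedAlgebra k) := GradedModule {
  gmod :> lmodType A;
  mpart : nat -> gmod -> gmod;
  mpartB : forall n, zmod_morphism (mpart n);
  mpartK : forall m n x, mpart m (mpart n x) = if m == n then mpart n x else 0;
  mpart_sum : forall x, exists N, x = \sum_(n < N) mpart n x;
  mpartZ : forall m n (a : A) x,
    mpart (m + n) (gpart m a *: mpart n x) = gpart m a *: mpart n x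
}.
Arguments mpart {k A g} n x.
HB.instance Definition _ k A (M : @gradedModule k A) n :=
  GRing.isZmodMorphism.Build M M (@mpart k A M n) (@mpartB k A M n).

Definition homogeneous (k : fieldType) (A : gradedAlgebra k) (n : nat) (x : A) :=
  gpart n x = x.

Section Augmentation.
Variables (k : fieldType) (A : gradedAlgebra k).
Implicit Types x y : A.

HB.instance Definition _ n :=
  GRing.isLinear.Build k A A _ (@gpart k A n) (@gpartP k A n).

Lemma gpart0M x y : gpart 0 (x * y) = gpart 0 x * gpart 0 y.
Proof.
have [M ex] := gpart_sum x; have [N ey] := gpart_sum y.
rewrite [in LHS]ex [in LHS]ey mulr_suml raddf_sum /=.
rewrite [in RHS]ex [in RHS]ey !(raddf_sum (gpart 0)) /= mulr_suml; apply: eq_bigr => i _.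
rewrite !mulr_sumr (raddf_sum (gpart 0)) /=; apply: eq_bigr => j _.
rewrite -gpartM !gpartK !(eq_sym 0%N) addn_eq0.
have g0 : (0 : A) = 0 * 0 by rewrite mul0r.
by case: eqP => [->|_]; case: eqP => [->|_] //=; rewrite ?mul0r ?mulr0 ?gpartM.
Qed.

Fact scale1_inj : injective (fun c : k => c%:A : A).
Proof.
move=> c d /eqP; rewrite -subr_eq0 -scalerBl scaler_eq0 oner_eq0 orbF.
by rewrite subr_eq0 => /eqP.
Qed.

Lemma gaugM : {morph @gaug k A : x y / x * y}.
Proof.
move=> x y; apply: scale1_inj => /=.
by rewrite -gpart0E gpart0M !gpart0E -scalerAl mul1r scalerA.
Qed.

Lemma gaug1 : gaug (1 : A) = 1.
Proof. by apply: scale1_inj; rewrite /= -gpart0E gpart1 scale1r. Qed.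

Lemma gaugD : {morph @gaug k A : x y / x + y}.
Proof.
move=> x y; apply: scale1_inj => /=; rewrite scalerDl -!gpart0E.
exact: raddfD.
Qed.

Lemma gpart_mul1 (c : A) n y : homogeneous 1 c ->
  gpart n (c * y) = if n is m.+1 then c * gpart m y else 0.
Proof.
move=> hc; have [N ey] := gpart_sum y.
rewrite [in LHS]ey mulr_sumr raddf_sum /=.
have E m : c * gpart m y = gpart m.+1 (c * gpart m y).
  by rewrite -{2}hc -add1n gpartM hc.
under eq_bigr do rewrite E gpartK.
case: n => [|n]; first by rewrite big1.
rewrite [in RHS]ey raddf_sum mulr_sumr /=; apply: eq_bigr => i _.
by rewrite -E gpartK eqSS; case: (n == i); rewrite ?mulr0.
Qed.

End Augmentation.

(* The field k = A / A_+ as a left A-module, concentrated in degree 0. *)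
Definition trivmod (k : fieldType) (A : gradedAlgebra k) : Type := k.
HB.instance Definition _ k A := GRing.Zmodule.copy (@trivmod k A) k.

Section Trivmod.
Variables (k : fieldType) (A : gradedAlgebra k).
Definition trivmod_scale (a : A) (x : trivmod A) : trivmod A :=
  (gaug a * (x : k) : k).
Fact trivmod_scaleA a b x :
  trivmod_scale a (trivmod_scale b x) = trivmod_scale (a * b) x.
Proof. by rewrite /trivmod_scale gaugM mulrA. Qed.
Fact trivmod_scale1 : left_id 1 trivmod_scale.
Proof. by move=> x; rewrite /trivmod_scale gaug1 mul1r. Qed.
Fact trivmod_scaleDr : right_distributive trivmod_scale +%R.
Proof. by move=> a x y; rewrite /trivmod_scale mulrDr. Qed.
Fact trivmod_scaleDl x : {morph trivmod_scale^~ x : a b / a + b}.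
Proof. by move=> a b; rewrite /trivmod_scale gaugD mulrDl. Qed.
HB.instance Definition _ := GRing.Zmodule_isLmodule.Build A (trivmod A)
  trivmod_scaleA trivmod_scale1 trivmod_scaleDr trivmod_scaleDl.

Definition trivmod_part n (x : trivmod A) : trivmod A := if n is 0 then x else 0.
Fact trivmod_partB n : zmod_morphism (trivmod_part n).
Proof. by case: n => [|n] x y //=; rewrite subr0. Qed.
Fact trivmod_partK m n x :
  trivmod_part m (trivmod_part n x) = if m == n then trivmod_part n x else 0.
Proof. by case: m n => [|m] [|n] //=; case: ifP. Qed.
Fact trivmod_part_sum x : exists N, x = \sum_(n < N) trivmod_part n x.
Proof. by exists 1%N; rewrite big_ord1. Qed.
Fact trivmod_partZ m n (a : A) x :
  trivmod_part (m + n) (gpart m a *: trivmod_part n x) =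
  gpart m a *: trivmod_part n x.
Proof.
case: n => [|n]; last by rewrite /= scaler0 /trivmod_part; case: (m + n.+1)%N.
case: m => [|m] //=.
rewrite /GRing.scale /= /trivmod_scale.
suff -> : gaug (gpart m.+1 a) = 0 by rewrite mul0r.
by apply: (@scale1_inj _ A); rewrite /= -gpart0E gpartK scale0r.
Qed.
Definition trivial_module : gradedModule A :=
  GradedModule trivmod_partB trivmod_partK trivmod_part_sum trivmod_partZ.
End Trivmod.

Section Resolution.
Variables (k : fieldType) (A : gradedAlgebra k).

(* {malg A[I]} is the free left A-module on I, with the generator b placed in
   internal degree deg b; fhom deg j x says that x is homogeneous of degree j. *)
Definition fhom (I : choiceType) (deg : I -> nat) (j : nat) (x : {malg A[I]}) :=
  forall b, x@_b = if (deg b <= j)%N then gpart (j - deg b) x@_b else 0.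

Record freeResolution (M : gradedModule A) := FreeResolution {
  gen : nat -> choiceType;
  deg : forall i, gen i -> nat;
  diff : forall i, {linear {malg A[gen i.+1]} -> {malg A[gen i]}};
  eps : {linear {malg A[gen 0]} -> M};
  diff_deg : forall i b, fhom (@deg i) (deg b) (diff i << b >>);
  eps_deg : forall b, mpart (deg b) (eps << b >>) = eps << b >>;
  eps_surj : forall y, exists x, eps x = y;
  eps_exact : forall x, eps x = 0 <-> exists y, x = diff 0 y;
  diff_exact : forall i x, diff i x = 0 <-> exists y, x = diff i.+1 y
}.

(* The kernel of P -> k \otimes_A P = P / A_+ P for P = {malg A[I]}. *)
Definition aug_zero (I : choiceType) (x : {malg A[I]}) := forall b, gaug x@_b = 0.

(* x \in P_i becomes a cycle in k \otimes_A P. *)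
Definition tor_cycle (M : gradedModule A) (P : freeResolution M) (i : nat) :
    {malg A[gen P i]} -> Prop :=
  if i is i'.+1 then fun x => aug_zero (diff P i' x) else fun _ => True.

(* Tor^A_{i,j}(k, M) = 0: for a graded free resolution P of M, every cycle of
   internal degree j in k \otimes_A P_i is a boundary.  By the comparison theorem
   this does not depend on the choice of P. *)
Definition tor_vanishes (M : gradedModule A) (i j : nat) :=
  exists P : freeResolution M, forall x : {malg A[gen P i]},
    fhom (@deg M P i) j x -> tor_cycle x ->
    exists2 y, fhom (@deg M P i.+1) j y & aug_zero (x - diff P i y).
End Resolution.

Definition koszul_algebra (k : fieldType) (A : gradedAlgebra k) :=
  forall i j, i <> j -> tor_vanishes (trivial_module A) i j.

(* Koszul modules are defined only over Koszul algebras and for modules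
   concentrated in degrees >= 1, so both conditions are part of the notion. *)
Definition koszul_module (k : fieldType) (A : gradedAlgebra k)
    (M : gradedModule A) :=
  [/\ koszul_algebra A, forall x : M, mpart 0 x = 0
    & forall i j, j <> i.+1 -> tor_vanishes M i j].

Fact mul_diff (T : pzRingType) (x y x' y' : T) :
  x * y - x' * y' = (- x) * (y' - y) + (x' - x) * (- y').
Proof.
by rewrite mulNr mulrN mulrBr mulrBl !opprB addrA addrNK.
Qed.

Fact mul_commute (T : pzRingType) (c u v : T) :
  c * u = u * c -> c * (u * v) = u * (c * v).
Proof. by move=> cu; rewrite mulrA cu mulrA. Qed.

Fact mul_sum3 (T : pzRingType) M N (F : 'I_M -> T) (G : 'I_N -> T) r :
  (\sum_i F i) * r * (\sum_j G j) = \sum_i \sum_j F i * r * G j.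
Proof.
rewrite !mulr_suml; apply: eq_bigr => i _; exact: mulr_sumr.
Qed.

Section Milnor.
Variables (R K : fieldType).

(* K^M(K) is the ring with generators {a}, a \in K^*, and relations
   {ab} = {a} + {b} and {a}{b} = 0 for a + b = 1.  Over a coefficient field R
   the R-algebra with the same presentation is K^M(K) \otimes R, graded by word
   length; R = 'F_l with l prime gives K^M(K)/l. *)
Definition nonzero := {x : K | x != 0}.
Local Notation T := {malg R[{fmonom nonzero}]}.
Local Notation word := {fmonom nonzero}.

Definition fsym (a : nonzero) : T := << fmu a >>.

Fact scale_mulr a (u v : T) : a *: (u * v) = u * (a *: v).
Proof.
rewrite -(mul_malgC a (u * v)) -(mul_malgC a v); apply: mul_commute.
rewrite [u]monalgE mulr_suml mulr_sumr; apply: eq_bigr => w _.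
by rewrite malgM_def fgmulUU malgM_def fgmulUU mulm1 mul1m mulrC.
Qed.

Inductive milnor_relator : T -> Prop :=
| MilnorAdd a b c : val c = val a * val b ->
    milnor_relator (fsym c - fsym a - fsym b)
| MilnorSteinberg a b : val a + val b = 1 ->
    milnor_relator (fsym a * fsym b).

Inductive milnor_span : T -> Prop :=
| MilnorSpan0 : milnor_span 0
| MilnorSpanD u r v x : milnor_relator r -> milnor_span x ->
    milnor_span (u * r * v + x).

Lemma spanD x y : milnor_span x -> milnor_span y -> milnor_span (x + y).
Proof.
by elim=> [|u r v z rr _ IH] sy; rewrite ?add0r // -addrA; constructor; auto.
Qed.
Lemma spanMl a x : milnor_span x -> milnor_span (a * x).
Proof.
elim=> [|u r v z rr _ IH]; first by rewrite mulr0; constructor.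
by rewrite mulrDr !mulrA; constructor.
Qed.
Lemma spanMr a x : milnor_span x -> milnor_span (x * a).
Proof.
elim=> [|u r v z rr _ IH]; first by rewrite mul0r; constructor.
by rewrite mulrDl -mulrA; constructor.
Qed.
Lemma span_sum (I : Type) (s : seq I) (P : pred I) (F : I -> T) :
  (forall i, P i -> milnor_span (F i)) -> milnor_span (\sum_(i <- s | P i) F i).
Proof. by move=> sF; elim/big_ind: _ => //; [constructor|exact: spanD]. Qed.

Definition milnor_ideal : {pred T} := [pred x | `[< milnor_span x >]].

Fact milnor_ideal_zmod : zmod_closed milnor_ideal.
Proof.
split=> [|x y]; rewrite !inE; first by apply/asboolP; constructor.
move=> /asboolP sx /asboolP sy; apply/asboolP.
by rewrite -mulN1r; apply: spanD => //; apply: spanMl.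
Qed.
HB.instance Definition _ := GRing.isZmodClosed.Build T milnor_ideal
  milnor_ideal_zmod.

Definition milnor : Type := {ideal_quot milnor_ideal}.
HB.instance Definition _ := Choice.on milnor.
HB.instance Definition _ := GRing.Zmodule.on milnor.
HB.instance Definition _ := EqQuotient.on milnor.

Definition mpi (x : T) : milnor := \pi_({ideal_quot milnor_ideal}) x.

Lemma mpiP x y : mpi x = mpi y <-> milnor_span (x - y).
Proof.
rewrite /mpi; split=> [/eqmodP|sxy].
  by rewrite /= Quotient.equivE => /asboolP.
by apply/eqmodP; rewrite /= Quotient.equivE; apply/asboolP.
Qed.
Lemma mpi_surj (x : milnor) : exists t, x = mpi t.
Proof. by exists (repr x); rewrite /mpi reprK. Qed.
Lemma mpiB : {morph mpi : x y / x - y}.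
Proof. by move=> x y; rewrite /mpi !piE. Qed.
Lemma mpi0 : mpi 0 = 0.
Proof. by rewrite -(subrr 0) mpiB subrr. Qed.
Lemma mpiN : {morph mpi : x / - x}.
Proof. by move=> x; rewrite -[- x]add0r mpiB mpi0 add0r. Qed.
Lemma mpiD : {morph mpi : x y / x + y}.
Proof. by move=> x y; rewrite -{1}[y]opprK mpiB mpiN opprK. Qed.
HB.instance Definition _ := GRing.isZmodMorphism.Build T milnor mpi mpiB.
Lemma mpi_repr (x : milnor) : mpi (repr x) = x.
Proof. by rewrite /mpi reprK. Qed.
Lemma mpi_span x : milnor_span x <-> mpi x = 0.
Proof. by rewrite -mpi0; split=> [?|/mpiP]; [apply/mpiP|]; rewrite subr0. Qed.

(* The operations are locked to keep conversion from unfolding representatives. *)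
Definition milnor_mul : milnor -> milnor -> milnor :=
  locked (fun x y => mpi (repr x * repr y)).
Lemma mpiM x y : mpi (x * y) = milnor_mul (mpi x) (mpi y).
Proof.
rewrite /milnor_mul -lock.
apply/mpiP; have := mpi_repr (mpi x); have := mpi_repr (mpi y).
move: (repr _) (repr _) => x' y' /mpiP sy /mpiP sx.
rewrite (mul_diff x y x' y').
by apply: spanD; [exact: spanMl|exact: spanMr].
Qed.
Definition milnor_scale : R -> milnor -> milnor :=
  locked (fun a x => mpi (a *: repr x)).
Lemma mpiZ a x : mpi (a *: x) = milnor_scale a (mpi x).
Proof.
rewrite /milnor_scale -lock.
apply/mpiP; have := mpi_repr (mpi x).
move: (repr _) => x' /mpiP sx.
by rewrite -scalerBr -mul_malgC -opprB mulrN -mulNr; apply: spanMl.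
Qed.

Lemma fsym_hom1 a : (fsym a)@_mone = 0.
Proof.
rewrite mcoeffU; case: eqP => // /(congr1 (@fdeg _)).
by rewrite fdegU fdeg1.
Qed.
Lemma coeff1M (x y : T) : (x * y)@_mone = x@_mone * y@_mone.
Proof. exact: (mcoeff1g_is_multiplicative _ _).1. Qed.
Lemma span_coeff1 x : milnor_span x -> x@_mone = 0.
Proof.
elim=> [|u r v z rr _ IH]; first exact: mcoeff0.
rewrite mcoeffD IH addr0 !coeff1M.
suff -> : r@_mone = 0 by rewrite mulr0 mul0r.
by case: rr => [a b c _|a b _]; rewrite ?mcoeffB ?coeff1M !fsym_hom1 ?mul0r ?subr0.
Qed.

Fact milnor_mulA : associative milnor_mul.
Proof.
by move=> x y z; case: (mpi_surj x) (mpi_surj y) (mpi_surj z) => [? ->] [? ->] [? ->];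
  rewrite -!mpiM mulrA.
Qed.
Fact milnor_mul1 : left_id (mpi 1) milnor_mul.
Proof. by move=> x; case: (mpi_surj x) => ? ->; rewrite -mpiM mul1r. Qed.
Fact milnor_mulr1 : right_id (mpi 1) milnor_mul.
Proof. by move=> x; case: (mpi_surj x) => ? ->; rewrite -mpiM mulr1. Qed.
Fact milnor_mulDl : left_distributive milnor_mul +%R.
Proof.
by move=> x y z; case: (mpi_surj x) (mpi_surj y) (mpi_surj z) => [? ->] [? ->] [? ->];
  rewrite -!(mpiM, mpiD) mulrDl.
Qed.
Fact milnor_mulDr : right_distributive milnor_mul +%R.
Proof.
by move=> x y z; case: (mpi_surj x) (mpi_surj y) (mpi_surj z) => [? ->] [? ->] [? ->];
  rewrite -!(mpiM, mpiD) mulrDr.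
Qed.
Fact milnor_1neq0 : mpi 1 != 0.
Proof.
apply/eqP=> /mpi_span /span_coeff1 /eqP.
by rewrite mcoeff1 eqxx oner_eq0.
Qed.
HB.instance Definition _ := GRing.Zmodule_isNzRing.Build milnor
  milnor_mulA milnor_mul1 milnor_mulr1 milnor_mulDl milnor_mulDr milnor_1neq0.

Fact milnor_scaleA a b x : milnor_scale a (milnor_scale b x) = milnor_scale (a * b) x.
Proof. by case: (mpi_surj x) => ? ->; rewrite -!mpiZ scalerA. Qed.
Fact milnor_scale1 : left_id 1 milnor_scale.
Proof. by move=> x; case: (mpi_surj x) => ? ->; rewrite -!mpiZ scale1r. Qed.
Fact milnor_scaleDr : right_distributive milnor_scale +%R.
Proof.
by move=> a x y; case: (mpi_surj x) (mpi_surj y) => [? ->] [? ->];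
  rewrite -!(mpiZ, mpiD) scalerDr.
Qed.
Fact milnor_scaleDl x : {morph milnor_scale^~ x : a b / a + b}.
Proof.
by move=> a b; case: (mpi_surj x) => ? ->; rewrite -!(mpiZ, mpiD) scalerDl.
Qed.
HB.instance Definition _ := GRing.Zmodule_isLmodule.Build R milnor
  milnor_scaleA milnor_scale1 milnor_scaleDr milnor_scaleDl.
Lemma mpi_mul x y : mpi (x * y) = mpi x * mpi y. Proof. exact: mpiM. Qed.
Lemma mpi_scale a x : mpi (a *: x) = a *: mpi x. Proof. exact: mpiZ. Qed.
Fact milnor_scaleAl (a : R) (x y : milnor) : a *: (x * y) = a *: x * y.
Proof.
by case: (mpi_surj x) (mpi_surj y) => [? ->] [? ->];
  rewrite -!(mpi_mul, mpi_scale) scalerAl.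
Qed.
HB.instance Definition _ := GRing.Lmodule_isLalgebra.Build R milnor milnor_scaleAl.
Fact milnor_scaleAr (a : R) (x y : milnor) : a *: (x * y) = x * (a *: y).
Proof.
case: (mpi_surj x) (mpi_surj y) => [u ->] [v ->].
by rewrite -(mpi_scale a v) -!mpi_mul -mpi_scale scale_mulr.
Qed.
HB.instance Definition _ := GRing.Lalgebra_isAlgebra.Build R milnor milnor_scaleAr.

Lemma mpi_sum (I : Type) (r : seq I) (P : pred I) (F : I -> T) :
  mpi (\sum_(i <- r | P i) F i) = \sum_(i <- r | P i) mpi (F i).
Proof. exact: raddf_sum. Qed.

Definition tpart : nat -> T -> T :=
  locked (fun n x => \sum_(w <- msupp x | fdeg w == n) << x@_w *g w >>).

Lemma tpartE n x w : (tpart n x)@_w = if fdeg w == n then x@_w else 0.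
Proof.
rewrite /tpart -lock raddf_sum /=; have [wx|wNx] := boolP (w \in msupp x); last first.
  rewrite (mcoeff_outdom wNx) if_same big_seq_cond big1 // => v /andP[vx _].
  by rewrite mcoeffU; case: eqP wNx vx => // -> /negP.
rewrite big_mkcond (big_fsetD1 w) //= mcoeffUU.
rewrite big_seq big1 ?addr0 // => v; rewrite in_fsetD1 => /andP[vw _].
by rewrite mcoeffU (negPf vw) if_same.
Qed.

Lemma tpart_linear n : linear (tpart n).
Proof.
move=> a x y; apply/malgP => w.
rewrite tpartE (mcoeffD w (a *: x) y) (mcoeffD w (a *: tpart n x) (tpart n y)).
rewrite (mcoeffZ a x w) (mcoeffZ a (tpart n x) w) !tpartE.
by case: ifP => // _; rewrite mulr0 addr0.
Qed.
Lemma tpartB n : zmod_morphism (tpart n).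
Proof.
move=> x y; apply/malgP => w.
rewrite tpartE (mcoeffB w x y) (mcoeffB w (tpart n x) (tpart n y)) !tpartE.
by case: ifP => // _; rewrite subr0.
Qed.
HB.instance Definition _ n := GRing.isZmodMorphism.Build T T (tpart n) (@tpartB n).
Lemma tpartD n (x y : T) : tpart n (x + y) = tpart n x + tpart n y.
Proof. exact: raddfD. Qed.

Lemma tpartK m n x : tpart m (tpart n x) = if m == n then tpart n x else 0.
Proof.
apply/malgP => w; rewrite !tpartE; case: (m =P n) => [->|mn].
  by rewrite tpartE; case: (fdeg w == n).
by rewrite mcoeff0; case: eqP => // ->; case: eqP.
Qed.

Lemma tpart_sum x : exists N, x = \sum_(n < N) tpart n x.
Proof.
exists (\max_(w <- msupp x) (fdeg w)).+1; apply/malgP => w.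
rewrite raddf_sum /=; under eq_bigr do rewrite tpartE.
have [wx|wNx] := boolP (w \in msupp x); last first.
  by rewrite (mcoeff_outdom wNx) big1 // => i _; rewrite if_same.
have lw : (fdeg w < (\max_(w <- msupp x) fdeg w).+1)%N.
  by rewrite ltnS; apply: (@leq_bigmax_seq _ _ xpredT (fun w => fdeg w)).
rewrite (bigD1 (Ordinal lw)) //= eqxx big1 ?addr0 // => i.
by rewrite -val_eqE /= eq_sym => /negPf ->.
Qed.

Lemma tpartM m n x y :
  tpart (m + n) (tpart m x * tpart n y) = tpart m x * tpart n y.
Proof.
apply/malgP => w; rewrite tpartE; case: eqP => // Ew.
apply/esym/eqP; apply/negPn/negP.
rewrite mcoeff_neq0 => /msuppM_le [u [v [ux vy wE]]].
move: ux vy; rewrite -!mcoeff_neq0 !tpartE.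
case: (fdeg u =P m) => [um _|_]; last by rewrite eqxx.
case: (fdeg v =P n) => [vn _|_]; last by rewrite eqxx.
by case: Ew; rewrite wE fdegM um vn.
Qed.

Lemma tpart_word w n : tpart n << w >> = if fdeg w == n then << w >> else 0.
Proof.
apply/malgP => v; rewrite tpartE mcoeffU; case: (w =P v) => [->|wv].
  by case: ifP => _; rewrite ?mcoeffUU ?mcoeff0.
rewrite if_same; case: (fdeg w == n); last by rewrite mcoeff0.
by rewrite mcoeffU; case: (w =P v).
Qed.

Lemma tpart1 : tpart 0 1 = 1.
Proof. by rewrite tpart_word fdeg1. Qed.

Lemma tpart_fsym a n : tpart n (fsym a) = if n == 1%N then fsym a else 0.
Proof. by rewrite tpart_word fdegU eq_sym. Qed.

Lemma relator_hom r : milnor_relator r -> exists d, tpart d r = r.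
Proof.
case=> [a b c _|a b _]; first by exists 1%N; rewrite !raddfB /= !tpart_fsym.
have E c : fsym c = tpart 1 (fsym c) by rewrite tpart_fsym.
by exists 2%N; rewrite (E a) (E b); apply: (tpartM 1 1).
Qed.

Lemma tpart_span n x : milnor_span x -> milnor_span (tpart n x).
Proof.
elim=> [|u r v z rr _ IH]; first by rewrite raddf0; constructor.
rewrite tpartD; apply: spanD; last exact: IH.
have [d rd] := relator_hom rr.
have [M uM] := tpart_sum u; have [N vN] := tpart_sum v.
rewrite uM vN mul_sum3 raddf_sum; apply: span_sum => i _.
rewrite raddf_sum; apply: span_sum => j _ /=.
have h1 : tpart (i + d)%N (tpart i u * r) = tpart i u * r.
  by have := tpartM i d u r; rewrite rd.
have h2 := tpartM (i + d)%N j (tpart i u * r) v; rewrite h1 in h2.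
rewrite -h2 tpartK; case: (n == _); last by constructor.
rewrite h2 -[X in milnor_span X]addr0.
by apply: MilnorSpanD => //; constructor.
Qed.

Definition milnor_part : nat -> milnor -> milnor :=
  locked (fun n x => mpi (tpart n (repr x))).
Lemma mpi_part n x : milnor_part n (mpi x) = mpi (tpart n x).
Proof.
rewrite /milnor_part -lock; apply/mpiP; rewrite -raddfB; apply: tpart_span.
by apply/mpiP; rewrite mpi_repr.
Qed.
Definition milnor_aug : milnor -> R := locked (fun x => (repr x)@_mone).

Fact milnor_part_linear n : linear (milnor_part n).
Proof.
move=> a x y; case: (mpi_surj x) (mpi_surj y) => [? ->] [? ->].
by rewrite -(mpi_scale a) -mpiD !mpi_part tpart_linear mpiD mpi_scale.
Qed.
Fact milnor_partK m n x :
  milnor_part m (milnor_part n x) = if m == n then milnor_part n x else 0.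
Proof.
by case: (mpi_surj x) => ? ->; rewrite !mpi_part tpartK; case: ifP; rewrite ?mpi0.
Qed.
Fact milnor_part_sum x : exists N, x = \sum_(n < N) milnor_part n x.
Proof.
case: (mpi_surj x) => t ->; have [N tN] := tpart_sum t; exists N.
by rewrite {1}tN mpi_sum; apply: eq_bigr => n _; rewrite mpi_part.
Qed.
Fact milnor_partM m n x y :
  milnor_part (m + n) (milnor_part m x * milnor_part n y) =
  milnor_part m x * milnor_part n y.
Proof.
case: (mpi_surj x) (mpi_surj y) => [? ->] [? ->].
by rewrite !mpi_part -mpi_mul mpi_part tpartM.
Qed.
Fact milnor_part1 : milnor_part 0 1 = 1.
Proof. by rewrite -[1]/(mpi 1) mpi_part tpart1. Qed.
Fact milnor_part0E x : milnor_part 0 x = (milnor_aug x)%:A.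
Proof.
rewrite /milnor_part /milnor_aug -!lock -[1]/(mpi 1) -mpi_scale; congr mpi; apply/malgP => w.
rewrite tpartE mcoeffZ mcoeff1; case: eqP => [/fdeg_eq0I ->|wN0].
  by rewrite eqxx mulr1.
by case: eqP wN0 => [->|]; rewrite ?fdeg1 // mulr0.
Qed.
Definition milnorK : gradedAlgebra R := GradedAlgebra milnor_part_linear
  milnor_partK milnor_part_sum milnor_partM milnor_part1 milnor_part0E.
End Milnor.

Fact anticommute (T : pzRingType) (a b a' b' s : T) :
  s = a' + b -> s = a + b' -> a * a' = 0 -> b * b' = 0 -> (a + b) * s = 0 ->
  a * b = - (b * a).
Proof.
move=> s1 s2 aa' bb'; rewrite mulrDl {1}s1 s2 !mulrDr aa' bb' add0r addr0.
by move/eqP; rewrite addr_eq0 => /eqP.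
Qed.

Fact anticommuteD (T : pzRingType) (a c d : T) :
  a * c = - (c * a) -> a * d = - (d * a) -> a * (c + d) = - ((c + d) * a).
Proof. by move=> hc hd; rewrite mulrDr hc hd mulrDl opprD. Qed.

Section SymbolIdeal.
Variables (R K : fieldType).
Local Notation A := (milnorK R K).
Implicit Types x y : A.

Definition symbol (a : nonzero K) : A := mpi (fsym R a).

Lemma symbolM a b c : val c = val a * val b -> symbol c = symbol a + symbol b.
Proof.
move=> cab; have /mpi_span : milnor_span (fsym R c - fsym R a - fsym R b).
  rewrite -[X in milnor_span X]addr0 -[X in X + 0]mul1r -[X in X + 0]mulr1.
  by apply: MilnorSpanD; [exact: MilnorAdd|exact: MilnorSpan0].
by rewrite !mpiB -addrA -opprD => /eqP; rewrite subr_eq0 => /eqP.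
Qed.

Lemma symbol_steinberg a b : val a + val b = 1 -> symbol a * symbol b = 0.
Proof.
move=> ab; rewrite -mpi_mul; apply/mpi_span.
rewrite -[X in milnor_span X]addr0 -[X in X + 0]mul1r -[X in X + 0]mulr1.
by apply: MilnorSpanD; [exact: MilnorSteinberg|exact: MilnorSpan0].
Qed.

Definition nz (x : K) (hx : x != 0) : nonzero K := exist _ x hx.

Lemma symbol1 a : val a = 1 -> symbol a = 0.
Proof.
move=> a1; apply: (addrI (symbol a)); rewrite addr0 -(@symbolM a a a) //.
by rewrite a1 mulr1.
Qed.

Lemma symbolV a b : val a * val b = 1 -> symbol b = - symbol a.
Proof.
move=> ab; apply/eqP; rewrite -addr_eq0 addrC; apply/eqP.
by rewrite -(@symbolM a b (nz (oner_neq0 K))) ?symbol1 ?ab.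
Qed.

Lemma symbolN a b : val b = - val a -> symbol a * symbol b = 0.
Proof.
move=> ba; have [a1|a1] := eqVneq (val a) 1.
  by rewrite symbol1 ?mul0r.
have a0 := valP a; have u0 : 1 - val a != 0 by rewrite subr_eq0 eq_sym.
have ai0 : (val a)^-1 != 0 by rewrite invr_eq0.
have v0 : 1 - (val a)^-1 != 0.
  by rewrite subr_eq0 eq_sym invr_eq1.
have vi0 : (1 - (val a)^-1)^-1 != 0 by rewrite invr_eq0.
have -> : symbol b = symbol (nz u0) + symbol (nz vi0).
  apply: symbolM; rewrite ba /=; apply: (canRL (mulfK v0)).
  by rewrite mulrBr mulr1 mulNr divff // opprK addrC.
rewrite mulrDr symbol_steinberg ?add0r; last by rewrite /= addrC subrK.
rewrite (@symbolV (nz v0) (nz vi0)) ?mulrN; last by rewrite /= divff.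
rewrite -mulNr -(@symbolV a (nz ai0)) ?symbol_steinberg //; first by rewrite /= addrC subrK.
by rewrite /= divff.
Qed.

Lemma symbolC a b : symbol a * symbol b = - (symbol b * symbol a).
Proof.
have a0 : val a != 0 := valP a; have b0 : val b != 0 := valP b.
have na0 : - val a != 0 by rewrite oppr_eq0.
have nb0 : - val b != 0 by rewrite oppr_eq0.
have ab0 : val a * val b != 0 by rewrite mulf_neq0.
have nab0 : - (val a * val b) != 0 by rewrite oppr_eq0.
apply: (@anticommute A _ _ (symbol (nz na0)) (symbol (nz nb0)) (symbol (nz nab0))).
- by apply: symbolM; rewrite /= mulNr.
- by apply: symbolM; rewrite /= mulrN.
- exact: symbolN.
- exact: symbolN.
by rewrite -(@symbolM a b (nz ab0)) //; apply: symbolN.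
Qed.

Lemma mpi_word w : mpi (<< w >> : {malg R[{fmonom nonzero K}]}) = \prod_(a <- fmonom_val w) symbol a :> A.
Proof.
case: w => s; elim: s => [|a s IH]; first by rewrite big_nil -fmoneE.
rewrite big_cons /= -IH -mpi_mul /fsym malgM_def fgmulUU mulr1.
by congr (mpi << _ >>); rewrite /mmul /= fmmulE fmuE.
Qed.

Lemma milnor_ind (P : A -> Prop) :
  P 0 -> (forall x y, P x -> P y -> P (x + y)) ->
  (forall c x, P x -> P (c *: x)) ->
  (forall s, P (\prod_(a <- s) symbol a)) -> forall x, P x.
Proof.
move=> P0 PD PZ Ps x; have [t ->] := mpi_surj x.
rewrite [t]monalgE mpi_sum; elim/big_ind: _ => // w _.
have -> : << t@_w *g w >> = t@_w *: << w >>.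
  by apply/malgP => v; rewrite mcoeffZ !mcoeffU mulrnAr mulr1.
by rewrite mpi_scale mpi_word; apply: PZ; apply: Ps.
Qed.

Lemma gpart_symbols n (s : seq (nonzero K)) :
  gpart n (\prod_(a <- s) symbol a : A) = if n == size s then \prod_(a <- s) symbol a else 0.
Proof.
have <- := mpi_word (FMonom s); rewrite [LHS]mpi_part tpart_word /fdeg /= eq_sym.
by case: ifP => //; rewrite mpi0.
Qed.

Lemma symbol_deg1 c : homogeneous 1 c -> forall a, symbol a * c = - (c * symbol a).
Proof.
move=> <- a; elim/milnor_ind: c => [|x y hx hy|k x hx|s].
- by rewrite linear0 mulr0 mul0r oppr0.
- by rewrite (linearD (gpart 1)); exact: anticommuteD hx hy.
- by rewrite linearZ /= -scalerAr -scalerAl hx scalerN.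
rewrite gpart_symbols; case: s => [|b [|? ?]] /=; rewrite ?mulr0 ?mul0r ?oppr0 //.
by rewrite big_seq1 symbolC.
Qed.

Lemma mul_deg1 c : homogeneous 1 c -> forall x, exists y, x * c = c * y.
Proof.
move=> hc; elim/milnor_ind => [|x y [u hu] [v hv]|a x [u hu]|s].
- by exists 0; rewrite mul0r mulr0.
- by exists (u + v); rewrite mulrDl hu hv mulrDr.
- by exists (a *: u); rewrite -scalerAl hu scalerAr.
elim: s => [|b s [u hu]]; first by exists 1; rewrite big_nil mul1r mulr1.
exists (- (symbol b * u)).
by rewrite big_cons -mulrA hu mulrA symbol_deg1 // mulNr mulrN mulrA.
Qed.

Section Ideal.
Variables (c : A) (hc : homogeneous 1 c).

(* The right ideal c A; since A is graded-commutative and c has degree 1, it is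
   also a left ideal, hence a left A-module. *)
Definition deg1_ideal : {pred A^o} := [pred x : A^o | `[< exists y : A, x = c * y >]].
Fact deg1_ideal_submod : submod_closed deg1_ideal.
Proof.
split=> [|a x y]; rewrite !inE.
  by apply/asboolP; exists 0; rewrite mulr0.
move=> /asboolP[u ->] /asboolP[v ->]; apply/asboolP.
have [w aw] := mul_deg1 hc a; exists (w * u + v).
by rewrite mulrDr mulrA -aw -mulrA.
Qed.
HB.instance Definition _ := GRing.isSubmodClosed.Build A A^o deg1_ideal
  deg1_ideal_submod.

Definition ideal_of := {x : A^o | x \in deg1_ideal}.
HB.instance Definition _ := SubChoice.on ideal_of.
HB.instance Definition _ := [SubChoice_isSubLmodule of ideal_of by <:].

Fact ideal_part_subproof n (x : ideal_of) : gpart n (val x : A) \in deg1_ideal.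
Proof.
have := valP x; rewrite !inE => /asboolP[y ->]; apply/asboolP.
rewrite (gpart_mul1 n y hc); case: n => [|n]; last by exists (gpart n y).
by exists 0; rewrite mulr0.
Qed.
Definition ideal_part n (x : ideal_of) : ideal_of :=
  exist _ (gpart n (val x : A)) (ideal_part_subproof n x).

Fact ideal_partB n : zmod_morphism (ideal_part n).
Proof. move=> x y; apply: val_inj; exact: (linearB (@gpart R A n) (val x) (val y)). Qed.
Fact ideal_partK m n (x : ideal_of) :
  ideal_part m (ideal_part n x) = if m == n then ideal_part n x else 0.
Proof.
apply: val_inj; have := gpartK m n (val x : A).
by case: (m == n).
Qed.
Fact ideal_part_sum (x : ideal_of) : exists N, x = \sum_(n < N) ideal_part n x.
Proof.
have [N xN] := gpart_sum (val x : A); exists N.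
by apply: val_inj; rewrite raddf_sum.
Qed.
Fact ideal_partZ m n (a : A) (x : ideal_of) :
  ideal_part (m + n) (gpart m a *: ideal_part n x) = gpart m a *: ideal_part n x.
Proof. by apply: val_inj; exact: gpartM. Qed.
Definition principal_ideal : gradedModule A :=
  GradedModule ideal_partB ideal_partK ideal_part_sum ideal_partZ.
End Ideal.
End SymbolIdeal.

Section ClassicalUnits.
Variable D : comNzRingType.
Definition cl_unit : pred D := fun x => `[< exists y, y * x = 1 >].
Definition cl_inv (x : D) : D :=
  if pselect (exists y, y * x = 1) is left h then sval (cid h) else x.
Fact cl_mulVx : {in cl_unit, left_inverse 1 cl_inv *%R}.
Proof.
move=> x /asboolP ux; rewrite /cl_inv; case: pselect => // h.
exact: svalP (cid h).
Qed.
Fact cl_unitP (x y : D) : y * x = 1 -> cl_unit x.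
Proof. by move=> yx; apply/asboolP; exists y. Qed.
Fact cl_invx_out : {in [predC cl_unit], cl_inv =1 id}.
Proof.
by move=> x /asboolP ux; rewrite /cl_inv; case: pselect.
Qed.
End ClassicalUnits.

(* Z_p = lim Z/p^n: x is the sequence of its residues pmod x n in [0, p^n). *)
Definition padic_coherent (p : nat) (f : nat -> nat) :=
  forall n, f n = (f n.+1 %% p ^ n)%N.
Record padic_int (p : nat) (p_pr : prime p) := PadicInt {
  pmod :> nat -> nat;
  pmodP : `[< padic_coherent p pmod >] }.

Section Padic.
Local Open Scope nat_scope.
Variables (p : nat) (p_pr : prime p).
Local Notation padic_int := (padic_int p_pr).
HB.instance Definition _ := [isSub for @pmod p p_pr].

HB.instance Definition _ := [Choice of padic_int by <:].

Implicit Types x y z : padic_int.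
Lemma pmodE (x : padic_int) n m : n <= m -> pmod x n = pmod x m %% p ^ n.
Proof.
have /asboolP cx := pmodP x; move=> /subnKC <-.
elim: (m - n) => [|k IH]; first by rewrite addn0 cx modn_mod.
by rewrite addnS IH cx modn_dvdm // dvdn_exp2l // leq_addr.
Qed.
Lemma pmod_mod x n : pmod x n %% p ^ n = pmod x n.
Proof. by rewrite -pmodE. Qed.
Lemma padicP x y : (forall n, pmod x n = pmod y n) -> x = y.
Proof. by move=> xy; apply: val_inj; apply/funext => n; exact: xy. Qed.

Fact padic_of_subproof (f : nat -> nat) :
  (forall n, f n.+1 = f n %[mod p ^ n]) -> `[< padic_coherent p (fun n => f n %% p ^ n) >].
Proof.
move=> cf; apply/asboolP => n.
by rewrite modn_dvdm ?cf // dvdn_exp2l.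
Qed.
Definition padic_of f cf : padic_int := PadicInt p_pr (@padic_of_subproof f cf).

Fact padic_add_subproof (x y : padic_int) n :
  pmod x n.+1 + pmod y n.+1 = pmod x n + pmod y n %[mod p ^ n].
Proof. by rewrite (@pmodE x n n.+1) // (@pmodE y n n.+1) // modnDm. Qed.
Fact padic_mul_subproof (x y : padic_int) n :
  pmod x n.+1 * pmod y n.+1 = pmod x n * pmod y n %[mod p ^ n].
Proof. by rewrite (@pmodE x n n.+1) // (@pmodE y n n.+1) // modnMm. Qed.
Fact padic_opp_subproof (x : padic_int) n :
  p ^ n.+1 - pmod x n.+1 = p ^ n - pmod x n %[mod p ^ n].
Proof.
have lex m : pmod x m <= p ^ m.
  by rewrite -pmod_mod ltnW // ltn_mod expn_gt0 prime_gt0.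
apply/eqP; rewrite -(eqn_modDr (pmod x n.+1)) subnK //.
rewrite -modnDmr -(@pmodE x n n.+1) // subnK //.
by rewrite modnn (eqP (dvdn_exp2l _ (leqnSn n))).
Qed.
Definition padic_add x y := padic_of (padic_add_subproof x y).
Definition padic_mul x y := padic_of (padic_mul_subproof x y).
Definition padic_opp x := padic_of (padic_opp_subproof x).
Definition padic_nat (k : nat) : padic_int := @padic_of (fun=> k) (fun n => erefl).

Fact padic_addA : associative padic_add.
Proof. by move=> x y z; apply: padicP => n /=; rewrite modnDml modnDmr addnA. Qed.
Fact padic_addC : commutative padic_add.
Proof. by move=> x y; apply: padicP => n /=; rewrite addnC. Qed.
Fact padic_add0 : left_id (padic_nat 0) padic_add.
Proof. by move=> x; apply: padicP => n /=; rewrite mod0n add0n pmod_mod. Qed.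
Fact padic_addN : left_inverse (padic_nat 0) padic_opp padic_add.
Proof.
move=> x; apply: padicP => n /=; rewrite modnDml subnK ?modnn ?mod0n //.
by rewrite -pmod_mod ltnW // ltn_mod expn_gt0 prime_gt0.
Qed.
HB.instance Definition _ := GRing.isZmodule.Build padic_int
  padic_addA padic_addC padic_add0 padic_addN.

Fact padic_mulA : associative padic_mul.
Proof. by move=> x y z; apply: padicP => n /=; rewrite modnMml modnMmr mulnA. Qed.
Fact padic_mulC : commutative padic_mul.
Proof. by move=> x y; apply: padicP => n /=; rewrite mulnC. Qed.
Fact padic_mul1 : left_id (padic_nat 1) padic_mul.
Proof. by move=> x; apply: padicP => n /=; rewrite modnMml mul1n pmod_mod. Qed.
Fact padic_mulDl : left_distributive padic_mul padic_add.
Proof.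
by move=> x y z; apply: padicP => n /=; rewrite modnMml modnDml modnDmr mulnDl.
Qed.
Fact padic_1neq0 : padic_nat 1 != padic_nat 0.
Proof.
apply/eqP => /(congr1 (fun x => pmod x 1)) /=.
by rewrite expn1 mod0n modn_small ?prime_gt1.
Qed.
HB.instance Definition _ := GRing.Zmodule_isComNzRing.Build padic_int
  padic_mulA padic_mulC padic_mul1 padic_mulDl padic_1neq0.
HB.instance Definition _ := GRing.ComNzRing_hasMulInverse.Build padic_int
  (@cl_mulVx padic_int) (@cl_unitP padic_int) (@cl_invx_out padic_int).

Fact padic_domain (x y : padic_int) : (x * y = 0)%R -> (x == 0%R) || (y == 0%R).
Proof.
move=> xy0; case: (eqVneq x 0%R) => //= x0; case: (eqVneq y 0%R) => //= y0.
exfalso.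
have ex0 (z : padic_int) : z != 0%R -> exists n, pmod z n != 0.
  move=> /eqP z0; apply: contrapT => h; apply: z0; apply: padicP => n /=.
  by rewrite mod0n; apply/eqP/negPn/negP => zn; apply: h; exists n.
have [n xn] := ex0 _ x0; have [m ym] := ex0 _ y0.
have /eqP := congr1 (fun z => pmod z (n + m)) xy0; rewrite /= mod0n.
set a := pmod x _; set b := pmod y _; move=> dab.
have na : ~~ (p ^ n %| a) by rewrite /dvdn -pmodE // leq_addr.
have nb : ~~ (p ^ m %| b) by rewrite /dvdn -pmodE // leq_addl.
have a0 : 0 < a by case: (a) na => //; rewrite dvdn0.
have b0 : 0 < b by case: (b) nb => //; rewrite dvdn0.
move: na nb dab; rewrite -/(dvdn _ _) !pfactor_dvdn ?muln_gt0 ?a0 // lognM // -!ltnNge.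
by move=> na nb; rewrite leqNgt -addSn leq_add // ltnW.
Qed.
HB.instance Definition _ := GRing.ComUnitRing_isIntegral.Build padic_int padic_domain.
End Padic.
(* Q_p *)
Definition padic_field p (p_pr : prime p) := {fraction padic_int p_pr}.

Section PowerSeries.
Variable F : fieldType.
(* F[[z]] *)
Record powerSeries := PowerSeries { pscoef : nat -> F }.
HB.instance Definition _ := [isNew for pscoef].
HB.instance Definition _ := [Choice of powerSeries by <:].
Implicit Types f g h : powerSeries.

Lemma psP f g : (forall n, pscoef f n = pscoef g n) -> f = g.
Proof. by move=> fg; apply: val_inj; apply/funext => n; exact: fg. Qed.

Definition ps_zero := PowerSeries (fun=> 0).
Definition ps_one := PowerSeries (fun n => (n == 0%N)%:R).
Definition ps_opp f := PowerSeries (fun n => - pscoef f n).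
Definition ps_add f g := PowerSeries (fun n => pscoef f n + pscoef g n).
Definition ps_mul f g :=
  PowerSeries (fun n => \sum_(i < n.+1) pscoef f i * pscoef g (n - i)%N).

Fact ps_addA : associative ps_add.
Proof. by move=> f g h; apply: psP => n /=; rewrite addrA. Qed.
Fact ps_addC : commutative ps_add.
Proof. by move=> f g; apply: psP => n /=; rewrite addrC. Qed.
Fact ps_add0 : left_id ps_zero ps_add.
Proof. by move=> f; apply: psP => n /=; rewrite add0r. Qed.
Fact ps_addN : left_inverse ps_zero ps_opp ps_add.
Proof. by move=> f; apply: psP => n /=; rewrite addNr. Qed.
HB.instance Definition _ := GRing.isZmodule.Build powerSeries
  ps_addA ps_addC ps_add0 ps_addN.

Definition trunc N f : {poly F} := \poly_(i < N) pscoef f i.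
Lemma trunc_coef N f i : (i < N)%N -> (trunc N f)`_i = pscoef f i.
Proof. by move=> iN; rewrite coef_poly iN. Qed.
Lemma ps_mulE N f g n : (n < N)%N ->
  pscoef (ps_mul f g) n = (trunc N f * trunc N g)`_n.
Proof.
move=> nN; rewrite coefM; apply: eq_bigr => i _.
have iN : (i < N)%N by apply: leq_ltn_trans nN; rewrite -ltnS.
by rewrite !trunc_coef // (leq_ltn_trans (leq_subr _ _)).
Qed.

Fact ps_mulC : commutative ps_mul.
Proof. by move=> f g; apply: psP => n; rewrite !(@ps_mulE n.+1) // mulrC. Qed.
Fact ps_mulA : associative ps_mul.
Proof.
move=> f g h; apply: psP => n.
have E f' g' h' : pscoef (ps_mul f' (ps_mul g' h')) n =
    (trunc n.+1 f' * (trunc n.+1 g' * trunc n.+1 h'))`_n.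
  rewrite coefM; apply: eq_bigr => i _.
  by rewrite trunc_coef // -ps_mulE // ltnS leq_subr.
by rewrite E (ps_mulC _ h) E [in RHS]mulrC mulrA.
Qed.
Fact ps_mul1 : left_id ps_one ps_mul.
Proof.
move=> f; apply: psP => n /=; rewrite big_ord_recl /= mul1r subn0 big1 ?addr0 //.
by move=> i _; rewrite mul0r.
Qed.
Fact ps_mulDl : left_distributive ps_mul ps_add.
Proof.
move=> f g h; apply: psP => n /=; rewrite -big_split; apply: eq_bigr => i _.
by rewrite /= mulrDl.
Qed.
Fact ps_1neq0 : ps_one != ps_zero.
Proof.
by apply/eqP => /(congr1 (fun f => pscoef f 0)) /eqP; rewrite /= oner_eq0.
Qed.
HB.instance Definition _ := GRing.Zmodule_isComNzRing.Build powerSeries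
  ps_mulA ps_mulC ps_mul1 ps_mulDl ps_1neq0.
HB.instance Definition _ := GRing.ComNzRing_hasMulInverse.Build powerSeries
  (@cl_mulVx powerSeries) (@cl_unitP powerSeries) (@cl_invx_out powerSeries).

Fact ps_domain f g : f * g = 0 -> (f == 0) || (g == 0).
Proof.
move=> fg0; case: (eqVneq f 0) => //= f0; case: (eqVneq g 0) => //= g0.
exfalso.
have ex0 h : h != 0 -> exists n, pscoef h n != 0.
  move=> /eqP h0; apply: contrapT => hn; apply: h0; apply: psP => n /=.
  by apply/eqP/negPn/negP => hz; apply: hn; exists n.
case: (ex_minnP (ex0 _ f0)) => m fm mmin.
case: (ex_minnP (ex0 _ g0)) => n gn nmin.
have : pscoef (f * g) (m + n) = 0 by rewrite fg0.
have lm : (m < (m + n).+1)%N by rewrite ltnS leq_addr.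
rewrite /= (bigD1 (Ordinal lm)) //= addKn big1 ?addr0.
  by apply/eqP; rewrite mulf_neq0.
move=> i; rewrite -val_eqE /= => im.
have [lt_im|le_mi] := ltnP i m.
  have -> : pscoef f i = 0 by apply/eqP/negPn/negP => /mmin; rewrite leqNgt lt_im.
  by rewrite mul0r.
have lt_mi : (m < i)%N by rewrite ltn_neqAle eq_sym im.
have -> : pscoef g (m + n - i) = 0; last by rewrite mulr0.
apply/eqP/negPn/negP => /nmin; rewrite leqNgt ltn_subLR ?ltn_add2r ?lt_mi //.
by rewrite -ltnS.
Qed.
HB.instance Definition _ := GRing.ComUnitRing_isIntegral.Build powerSeries ps_domain.
End PowerSeries.
(* F((z)) *)
Definition laurentSeries (F : fieldType) := {fraction powerSeries F}.

Definition algebraic_extension (F K : fieldType) :=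
  exists iota : {rmorphism F -> K}, forall x, algebraicOver iota x.

Section Valuation.
Import Order.TTheory Num.Theory.

(* Normalized valuations K^* ->> Z; the value at 0 is irrelevant. *)
Record discreteValuation (K : fieldType) := DiscreteValuation {
  dval :> K -> int;
  dvalM : forall x y, x != 0 -> y != 0 -> dval (x * y) = dval x + dval y;
  dvalD : forall x y, x != 0 -> y != 0 -> x + y != 0 ->
    Num.min (dval x) (dval y) <= dval (x + y);
  dval_surj : exists2 x, x != 0 & dval x = 1
}.

Variables (K : fieldType) (v : discreteValuation K).
Definition val_ring : {pred K} := [pred x | (x == 0) || (0 <= v x)].
Lemma dval1 : v 1 = 0.
Proof.
by apply: (addrI (v 1)); rewrite -dvalM ?oner_neq0 // mulr1 addr0.
Qed.
Lemma dvalN1 : v (- 1) = 0.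
Proof.
have n0 : (- 1 : K) != 0 by rewrite oppr_eq0 oner_eq0.
by have := dvalM v n0 n0; rewrite mulrNN mulr1 dval1 => /eqP;
  rewrite eq_sym -mulr2n mulrn_eq0 /= => /eqP.
Qed.
Fact val_ring_subring : subring_closed val_ring.
Proof.
have mul x y : x \in val_ring -> y \in val_ring -> x * y \in val_ring.
  rewrite !inE; case: (eqVneq x 0) => [->|x0] /=; first by rewrite mul0r eqxx.
  case: (eqVneq y 0) => [->|y0] /=; first by rewrite mulr0 eqxx.
  by move=> vx vy; rewrite dvalM // addr_ge0 ?orbT.
have N1 : - 1 \in val_ring by rewrite inE dvalN1 lexx orbT.
split=> //; first by rewrite inE dval1 lexx orbT.
move=> x y vx vy.
have : - y \in val_ring by rewrite -mulN1r; apply: mul.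
move: (- y) vx => {vy}y; rewrite !inE.
case: (eqVneq x 0) => [->|x0] /=; first by rewrite add0r.
case: (eqVneq y 0) => [->|y0] /=; first by rewrite addr0 => -> _; rewrite orbT.
case: (eqVneq (x + y) 0) => //= xy0 vx vy.
by apply: (le_trans _ (dvalD v x0 y0 xy0)); rewrite le_min vx.
Qed.
HB.instance Definition _ := GRing.isSubringClosed.Build K val_ring val_ring_subring.
Definition valuationRing := {x : K | x \in val_ring}.
HB.instance Definition _ := SubChoice.on valuationRing.
HB.instance Definition _ := [SubChoice_isSubComNzRing of valuationRing by <:].
End Valuation.

(* k is the residue field of v, with reduction map res. *)
Definition is_residue_map (K : fieldType) (v : discreteValuation K)
    (k : fieldType) (res : {rmorphism valuationRing v -> k}) :=
  (forall a, exists x, res x = a) /\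
  (forall x : valuationRing v, res x = 0 <-> (val x = 0 \/ 0 < v (val x))).

(* Hensel's lemma: simple roots lift from the residue field. *)
Definition henselian (K : fieldType) (v : discreteValuation K)
    (k : fieldType) (res : {rmorphism valuationRing v -> k}) :=
  forall (f : {poly valuationRing v}) (a : k), f \is monic ->
    root (map_poly res f) a -> ~~ root (map_poly res f)^`() a ->
    exists2 x, root f x & res x = a.

(* Main.v *)
(** Write A for the Milnor ring of K modulo l.

    If K is Henselian with residue field k of characteristic prime to l, its 1-units are l-th powers, so the
    tame specialization of A onto B, the Milnor ring of k modulo l, has a section phi, and A is free over B on
    1 and the symbol of a uniformizer.  Inducing resolutions from B to A gives the Koszulity of A.  A symbol of
    A either comes from B, so that its ideal is induced, or is a multiple of the symbol {w} of a uniformizer;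
    in that case the annihilator of {w} is the ideal of {-w}, and the resolution is periodic.

    If K is algebraic over a nonarchimedean local field, finitely many elements of K lie in a finite extension,
    again a local field, whose second Milnor group modulo l is at most one-dimensional.  Hence any two symbols in
    A_2 are proportional.  Moreover, unless A_2 = 0, every x in A_1 is annihilated by some y in A_1 with
    y A_1 <> 0 (only {-1,-1} for l = 2 needs an argument specific to the base field).  It follows that A_3 = 0
    and that the annihilator of each symbol agrees with an ideal (y) in degrees at least 2, and the Koszul
    property follows by dimension shifting.

    If K is algebraic over the reals, then A is trivial in positive degrees or A = F_2[x]. *)
Require Import Defs.
From HB Require Import structures.
From mathcomp Require Import all_boot all_order all_algebra.
From mathcomp Require Import fingroup perm cyclic finmap.
From mathcomp Require Import boolp reals.
From mathcomp Require classical_sets.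
From mathcomp.multinomials Require Import monalg.
From mathcomp.real_closed Require Import complex.
From mathcomp Require Import zify ring.

Set Implicit Arguments.
Unset Strict Implicit.
Unset Printing Implicit Defensive.

Import GRing.Theory.
Local Open Scope ring_scope.

(** * Graded modules and free resolutions *)

Arguments mpart {k A g} n x : simpl never.
Arguments gpart {k g} n x : simpl never.
Arguments gaug {k g} x : simpl never.

(** No two resolutions are ever compared: each vanishing of Tor is obtained by building a resolution
    adapted to it. Long exact sequences are replaced by two constructions, the splicing of a
    resolution of a kernel onto a cover ([tor_shift]) and the horseshoe ([horseshoe_tor]). Both
    transfer vanishing in one direction only, which suffices. Freeness of A over B is delicate
    because A is given by generators and relations. One computes the 2x2 matrices by which symbols
    would have to act on the pairs (1, w), and checks the Milnor relations for these matrices. In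
    the local case the Hilbert symbol and its nondegeneracy are avoided. The bound on symbols comes
    from a descent along the unit filtration, where only the level l e / (l - 1), with e the
    valuation of l, can contribute. Nondegeneracy is replaced by a remark: a symbol that kills
    everything is killed by any entry of a nonzero symbol. The valuation of a finite extension is
    the valuation of the norm; its ultrametric inequality rests on a compactness argument that
    compares norm and coordinates. *)

Section Grading.
Variables (k : fieldType) (A : gradedAlgebra k).

Lemma gpart_bound (a : A) : exists N, forall m, (N <= m)%N -> gpart m a = 0.
Proof.
have [N ea] := gpart_sum a; exists N => m Nm.
rewrite ea linear_sum big1 //= => i _.
by rewrite gpartK; case: eqP => // mi; have := ltn_ord i; rewrite -mi ltnNge Nm.
Qed.

Variable M : gradedModule A.
Implicit Types (x y : M).

Lemma mpart_ind (P : M -> Prop) : P 0 -> (forall x y, P x -> P y -> P (x + y)) ->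
  forall x, (forall n, P (mpart n x)) -> P x.
Proof. by move=> P0 PD x Px; have [N ->] := mpart_sum x; elim/big_ind: _. Qed.

Lemma mpart_scale n (a : A) d y : mpart d y = y ->
  mpart n (a *: y) = if (d <= n)%N then gpart (n - d) a *: y else 0.
Proof.
move=> dy; have [N ea] := gpart_sum a.
have E i : mpart n (gpart i a *: y) = if (i + d == n)%N then gpart i a *: y else 0.
  have h : mpart (i + d) (gpart i a *: y) = gpart i a *: y by have := mpartZ i d a y; rewrite dy.
  by rewrite -h mpartK h eq_sym.
rewrite {1}ea scaler_suml raddf_sum /=; under eq_bigr do rewrite E.
case: leqP => dn; last first.
  by rewrite big1 // => i _; rewrite gtn_eqF // ltn_addl.
rewrite [in RHS]ea linear_sum scaler_suml /=; apply: eq_bigr => i _.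
by rewrite gpartK; case: eqP => E1; case: eqP => E2; rewrite ?scale0r ?E2 //; lia.
Qed.
End Grading.

(** * Graded free modules, submodules, kernels and images *)

Section FreeModules.
Variables (k : fieldType) (A : gradedAlgebra k).

Lemma malg_ind (I : choiceType) (P : {malg A[I]} -> Prop) : P 0 ->
  (forall x y, P x -> P y -> P (x + y)) -> (forall a b, P (a *: << b >>)) ->
  forall x, P x.
Proof.
move=> P0 PD PZ x; rewrite [x]monalgE; elim/big_ind: _ => // b _.
have -> // : << x@_b *g b >> = x@_b *: << b >>.
by apply/malgP => c; rewrite mcoeffZ !mcoeffU mulrnAr mulr1.
Qed.

Definition graded (M N : gradedModule A) (f : M -> N) :=
  forall n x, f (mpart n x) = mpart n (f x).

Section Ext.
Variables (M : lmodType A) (I : choiceType) (f : I -> M).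

Definition linext_fun (x : {malg A[I]}) : M := \sum_(b <- msupp x) x@_b *: f b.

Lemma linextEw (d : {fset I}) x : (msupp x `<=` d)%fset ->
  linext_fun x = \sum_(b <- d) x@_b *: f b.
Proof.
move=> xd; apply: big_fset_incl => // b _ bx.
by rewrite mcoeff_outdom // scale0r.
Qed.

Fact linext_linear : linear linext_fun.
Proof.
move=> a x y; pose d := (msupp x `|` msupp y)%fset.
have dx : (msupp x `<=` d)%fset by apply: fsubsetUl.
have dy : (msupp y `<=` d)%fset by apply: fsubsetUr.
have dz : (msupp (a *: x + y) `<=` d)%fset.
  apply: fsubset_trans (msuppD_le _ _) _; apply: fsetUSS => //.
  exact: msuppZ_le.
rewrite (linextEw dz) (linextEw dx) (linextEw dy) scaler_sumr -big_split /=.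
by apply: eq_bigr => b _; rewrite mcoeffD mcoeffZ scalerDl scalerA.
Qed.
HB.instance Definition _ := GRing.isLinear.Build A {malg A[I]} M _ linext_fun
  linext_linear.
(** Locked, so that unification does not unfold the sum over the support; [linextU] and linearity
    are the whole interface. *)
Definition linext : {linear {malg A[I]} -> M} := locked (linext_fun : {linear {malg A[I]} -> M}).

Lemma linextU b : linext << b >> = f b.
Proof.
by rewrite /linext -lock /= (linextEw (d := [fset b]%fset)) ?msuppU_le // big_seq_fset1 mcoeffUU scale1r.
Qed.
End Ext.

Lemma linear_malg_eq (M : lmodType A) (I : choiceType) (f g : {linear {malg A[I]} -> M}) :
  (forall b, f << b >> = g << b >>) -> f =1 g.
Proof.
move=> fg; apply: malg_ind => [|x y|a b]; rewrite ?linear0 ?linearD ?linearZ /= ?fg //.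
by move=> -> ->.
Qed.

Section FreeGrading.
Variables (I : choiceType) (deg : I -> nat).

(** This grading is chosen so that homogeneity for it is exactly [fhom] (see [fhomE]); resolutions
    can then be handled with the operations of graded modules. *)
Definition free_part n (x : {malg A[I]}) : {malg A[I]} :=
  \sum_(b <- msupp x) << (if (deg b <= n)%N then gpart (n - deg b) x@_b else 0) *g b >>.

Lemma free_partE n x b :
  (free_part n x)@_b = if (deg b <= n)%N then gpart (n - deg b) x@_b else 0.
Proof.
rewrite /free_part raddf_sum /=; have [bx|bNx] := boolP (b \in msupp x); last first.
  rewrite (mcoeff_outdom bNx) linear0 if_same big_seq big1 // => c cx.
  by rewrite mcoeffU; case: eqP bNx cx => // -> /negP.
rewrite (big_fsetD1 b) //= mcoeffUU big_seq big1 ?addr0 // => c.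
by rewrite in_fsetD1 mcoeffU => /andP[/negPf-> _].
Qed.

Fact free_partB n : zmod_morphism (free_part n).
Proof.
move=> x y; apply/malgP => b; rewrite mcoeffB !free_partE mcoeffB.
by case: ifP => _; rewrite ?linearB ?subr0.
Qed.
HB.instance Definition _ n := GRing.isZmodMorphism.Build _ _ (free_part n) (free_partB n).

Fact free_partK m n x :
  free_part m (free_part n x) = if m == n then free_part n x else 0.
Proof.
apply/malgP => b; rewrite free_partE !free_partE.
case: (m =P n) => [->|mn]; first by rewrite free_partE; case: (deg b <= n)%N => //=; rewrite gpartK eqxx.
rewrite mcoeff0; case: ifP => // bm; case: ifP => bn; rewrite ?linear0 // gpartK.
by case: eqP => //; lia.
Qed.

Fact free_partU n a b : free_part n (a *: << b >>) =
  if (deg b <= n)%N then gpart (n - deg b) a *: << b >> else 0.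
Proof.
apply/malgP => c; rewrite free_partE mcoeffZ mcoeffU; case: (b =P c) => [->|bc].
  by rewrite mulr1; case: ifP => _; rewrite ?mcoeff0 // mcoeffZ mcoeffUU mulr1.
rewrite mulr0 linear0 if_same; case: ifP => _; rewrite ?mcoeff0 // mcoeffZ mcoeffU.
by case: (b =P c) bc => //; rewrite mulr0.
Qed.

Fact free_part_sum x : exists N, x = \sum_(n < N) free_part n x.
Proof.
(* The bound has to work for every larger [m], so that two elements of a sum can share one. *)
suff [N xN] : exists N, forall m, (N <= m)%N -> x = \sum_(n < m) free_part n x.
  by exists N; exact: xN.
elim/malg_ind: x => [|x y [N xN] [L yL]|a b].
- by exists 0%N => m _; rewrite big1 // => i _; rewrite raddf0.
- exists (maxn N L) => m; rewrite geq_max => /andP[Nm Lm].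
  rewrite {1}(xN m) // {1}(yL m) // -big_split; apply: eq_bigr => i _.
  by rewrite raddfD.
have [N aN] := gpart_bound a; have [L eL] := gpart_sum a.
exists (N + L + deg b)%N => m lm; under eq_bigr do rewrite free_partU.
have -> : m = (deg b + (m - deg b))%N by lia.
rewrite big_split_ord /= big1 ?add0r => [|i _]; last by rewrite leqNgt ltn_ord.
under eq_bigr do rewrite leq_addr addKn.
rewrite -scaler_suml; congr (_ *: _).
(* The first [L] components of [a] already add up to [a]; the later ones vanish. *)
have -> : (m - deg b = L + (m - deg b - L))%N by lia.
rewrite big_split_ord /= -eL big1 ?addr0 // => i _.
have [L' aL] : exists L', L' = (L + i)%N by exists (L + i)%N.
rewrite -aL {1}eL linear_sum big1 //= => j _; rewrite gpartK.
by case: eqP => // E; have := ltn_ord j; lia.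
Qed.

Fact free_partZ m n (a : A) x :
  free_part (m + n) (gpart m a *: free_part n x) = gpart m a *: free_part n x.
Proof.
apply/malgP => b; rewrite free_partE !mcoeffZ free_partE; case: (leqP (deg b) n) => bn.
  have -> : (m + n - deg b = m + (n - deg b))%N by lia.
  by rewrite gpartM (leq_trans bn) ?leq_addl.
by rewrite mulr0 linear0 if_same.
Qed.
Definition freemod : gradedModule A :=
  @GradedModule k A {malg A[I]} free_part free_partB free_partK free_part_sum free_partZ.

Lemma fhomE j x : fhom deg j x <-> mpart (g := freemod) j x = x.
Proof.
split=> [hx|hx b]; last by rewrite -{1}hx free_partE.
by apply/malgP => b; rewrite free_partE -hx.
Qed.

Lemma freemodU b : mpart (g := freemod) (deg b) << b >> = << b >>.
Proof.
have := free_partU (deg b) 1 b.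
by rewrite scale1r leqnn subnn gpart1 scale1r.
Qed.

(** Needed besides [graded] because an ideal is embedded into a free module whose generator has
    degree [s], which raises all degrees by [s]. *)
Definition gshift (M N : gradedModule A) s (f : M -> N) :=
  forall n x, mpart (n + s) (f x) = f (mpart n x).

Lemma linear_graded (M : gradedModule A) (f : {linear freemod -> M}) :
  (forall b, mpart (deg b) (f << b >>) = f << b >>) -> graded f.
Proof.
move=> hf n x; elim/malg_ind: x => [|x y fx fy|a b].
- by rewrite !raddf0.
- by rewrite !raddfD /= fx fy.
rewrite linearZ (mpart_scale n a (hf b)) [mpart _ _]free_partU.
by case: ifP => _; rewrite ?raddf0 // linearZ.
Qed.
End FreeGrading.

Lemma gradedW (M N : gradedModule A) (f : M -> N) n x :
  graded f -> mpart n x = x -> mpart n (f x) = f x.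
Proof. by move=> gf nx; rewrite -gf nx. Qed.

Section Submodules.
Variables (M : gradedModule A) (S : {pred M}).
(** The closure proof is an argument of the predicate, so that the submodule structure can be
    attached to it as an instance. *)
Definition gsub_pred of submod_closed S : {pred M} := S.
Hypothesis S_submod : submod_closed S.
Hypothesis S_part : forall n x, x \in S -> mpart n x \in S.
HB.instance Definition _ := GRing.isSubmodClosed.Build A M (gsub_pred S_submod) S_submod.
Definition gsub_of := {x : M | x \in gsub_pred S_submod}.
HB.instance Definition _ := SubChoice.on gsub_of.
HB.instance Definition _ := [SubChoice_isSubLmodule of gsub_of by <:].
Definition gsub_part n (x : gsub_of) : gsub_of := exist _ (mpart n (val x)) (S_part n (valP x)).
Fact gsub_partB n : zmod_morphism (gsub_part n).
Proof. by move=> x y; apply: val_inj; rewrite /= !raddfB. Qed.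
Fact gsub_partK m n x : gsub_part m (gsub_part n x) = if m == n then gsub_part n x else 0.
Proof. by apply: val_inj; have := mpartK m n (val x); case: (m == n). Qed.
Fact gsub_part_sum x : exists N, x = \sum_(n < N) gsub_part n x.
Proof.
have [N xN] := mpart_sum (val x); exists N.
by apply: val_inj; rewrite raddf_sum.
Qed.
Fact gsub_partZ m n (a : A) x :
  gsub_part (m + n) (gpart m a *: gsub_part n x) = gpart m a *: gsub_part n x.
Proof. by apply: val_inj; exact: mpartZ. Qed.
Definition gsub : gradedModule A :=
  @GradedModule k A gsub_of gsub_part gsub_partB gsub_partK gsub_part_sum gsub_partZ.
Definition gsub_val : {linear gsub -> M} := (val : gsub_of -> M).
Definition in_gsub (x : M) (xS : x \in S) : gsub := exist _ x xS : gsub_of.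
Lemma gsub_valP (x : gsub) : gsub_val x \in S. Proof. exact: valP x. Qed.
End Submodules.

Section Kernel.
Variables (M N : gradedModule A) (f : {linear M -> N}) (gf : graded f).
Definition ker_pred : {pred M} := fun x => f x == 0.
Fact ker_submod : submod_closed ker_pred.
Proof.
split=> [|a x y]; rewrite !unfold_in ?raddf0 // => /eqP fx /eqP fy.
by rewrite linearP fx fy scaler0 addr0.
Qed.
Fact ker_part n x : x \in ker_pred -> mpart n x \in ker_pred.
Proof. by rewrite !unfold_in => /eqP fx; rewrite gf fx raddf0. Qed.
Definition kermod := gsub ker_submod ker_part.
Lemma kermodP (x : kermod) : f (gsub_val ker_submod ker_part x) = 0.
Proof. exact/eqP/(gsub_valP x). Qed.
End Kernel.

Section Image.
Variables (M N : gradedModule A) (f : {linear M -> N}) (gf : graded f).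
Definition im_pred : {pred N} := fun y => `[< exists x, y = f x >].
Fact im_submod : submod_closed im_pred.
Proof.
split=> [|a x y]; rewrite !unfold_in; first by apply/asboolP; exists 0; rewrite raddf0.
by move=> /asboolP[u ->] /asboolP[v ->]; apply/asboolP; exists (a *: u + v); rewrite linearP.
Qed.
Fact im_part n x : x \in im_pred -> mpart n x \in im_pred.
Proof.
by rewrite !unfold_in => /asboolP[u ->]; apply/asboolP; exists (mpart n u); rewrite gf.
Qed.
Definition immod := gsub im_submod im_part.
End Image.
End FreeModules.

(** * Standard resolutions and dimension shifting *)

Section StandardResolution.
Variables (k : fieldType) (A : gradedAlgebra k).

Lemma gaug_gpart n (a : A) : (0 < n)%N -> gaug (gpart n a) = 0.
Proof.
by move=> n0; apply: (@scale1_inj _ A); rewrite -gpart0E gpartK scale0r eq_sym gtn_eqF.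
Qed.

Lemma gaug0 : gaug (0 : A) = 0.
Proof. by apply: (@scale1_inj _ A); rewrite -!gpart0E scale0r raddf0. Qed.

Lemma gaugN (a : A) : gaug (- a) = - gaug a.
Proof. by apply/eqP; rewrite -addr_eq0 -gaugD addNr gaug0. Qed.

Lemma aug_zeroD (I : choiceType) (x y : {malg A[I]}) :
  aug_zero x -> aug_zero y -> aug_zero (x + y).
Proof. by move=> hx hy b; rewrite mcoeffD gaugD hx hy addr0. Qed.
Lemma aug_zeroN (I : choiceType) (x : {malg A[I]}) : aug_zero x -> aug_zero (- x).
Proof. by move=> hx b; rewrite mcoeffN gaugN hx oppr0. Qed.
Lemma aug_zero0 (I : choiceType) : aug_zero (0 : {malg A[I]}).
Proof. by move=> b; rewrite mcoeff0 gaug0. Qed.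

Lemma aug_zero_sum (I : choiceType) (T : Type) (s : seq T) (P : pred T) (F : T -> {malg A[I]}) :
  (forall t, P t -> aug_zero (F t)) -> aug_zero (\sum_(t <- s | P t) F t).
Proof. by move=> h; elim/big_ind: _ => //; [exact: aug_zero0|exact: aug_zeroD]. Qed.

(** The augmentation is multiplicative, so linear maps respect the multiples of [A_+]; in other
    words they descend to [k \otimes_A -]. *)
Lemma aug_zero_lin (I J : choiceType) (f : {linear {malg A[I]} -> {malg A[J]}}) x :
  aug_zero x -> aug_zero (f x).
Proof.
move=> hx; rewrite [x]monalgE linear_sum; apply: aug_zero_sum => b _ /=.
have -> : << x@_b *g b >> = x@_b *: << b >>.
  by apply/malgP => c; rewrite mcoeffZ !mcoeffU mulrnAr mulr1.
by move=> c; rewrite linearZ /= mcoeffZ gaugM hx mul0r.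
Qed.

(** At a generator of degree [d] the coefficient has degree [j - d], hence lies in [A_+] unless
    [j = d]. Every vanishing of Tor in homological degree 0 comes from this. *)
Lemma fhom_aug_zero (I : choiceType) (deg : I -> nat) j (x : {malg A[I]}) :
  (forall b, deg b <> j) -> fhom deg j x -> aug_zero x.
Proof.
move=> dj hx b; rewrite hx; case: ifP => bj; last by rewrite gaug0.
by apply: gaug_gpart; have := dj b; lia.
Qed.

Section Cover.
Variable M : gradedModule A.
(** A generator for every pair of a degree and an element, sent to the component of the element in
    that degree. The redundancy makes the cover canonical and is harmless, since resolutions need
    not be minimal. *)
Definition cover_gen : choiceType := (nat * M)%type.
Definition cover_deg (b : cover_gen) := b.1.
Definition cover : {linear freemod A cover_deg -> M} := linext (fun b : cover_gen => mpart b.1 b.2).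
Lemma coverU b : cover << b >> = mpart b.1 b.2. Proof. exact: linextU. Qed.
Lemma cover_graded : graded cover.
Proof. by apply: linear_graded => b; rewrite coverU mpartK eqxx. Qed.
Lemma cover_surj y : exists x, cover x = y.
Proof.
have [N ->] := mpart_sum y; exists (\sum_(n < N) << (n : nat, y) >>).
by rewrite linear_sum; apply: eq_bigr => n _; exact: coverU.
Qed.
End Cover.

Definition cover_ker (M : gradedModule A) := kermod (@cover_graded M).
Definition cover_ker_val (M : gradedModule A) :
  {linear cover_ker M -> freemod A (@cover_deg M)} := gsub_val _ _.

Section Resolve.
Variable M : gradedModule A.
Definition syzygy i := iter i cover_ker M.
Definition std_diff i : {linear {malg A[cover_gen (syzygy i.+1)]} -> {malg A[cover_gen (syzygy i)]}} :=
  cover_ker_val (syzygy i) \o cover (syzygy i.+1).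

Lemma std_diffP i x : cover (syzygy i) x = 0 <-> exists y, x = std_diff i y.
Proof.
split=> [x0|[y ->]]; last exact: kermodP.
have xk : x \in ker_pred (cover (syzygy i)) by rewrite unfold_in x0.
have [y yx] := cover_surj (in_gsub _ (ker_part (@cover_graded _)) xk : syzygy i.+1).
by exists y; rewrite /std_diff /= yx.
Qed.

Lemma std_diff_deg i b : fhom (@cover_deg (syzygy i)) (cover_deg b) (std_diff i << b >>).
Proof.
have h : mpart b.1 (cover (syzygy i.+1) << b >>) = cover (syzygy i.+1) << b >>.
  by rewrite coverU mpartK eqxx.
by apply/fhomE; exact: (congr1 val h).
Qed.

Lemma std_eps_deg b : mpart (cover_deg b) (cover M << b >>) = cover M << b >>.
Proof. by rewrite coverU mpartK eqxx. Qed.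

Lemma std_diff_exact i x : std_diff i x = 0 <-> exists y, x = std_diff i.+1 y.
Proof.
rewrite -std_diffP; split=> h; last by rewrite /std_diff /= h.
by apply/val_inj.
Qed.

Definition std_resolution : freeResolution M :=
  @FreeResolution k A M (fun i => cover_gen (syzygy i)) (fun i => @cover_deg (syzygy i))
    std_diff (cover M) std_diff_deg std_eps_deg (@cover_surj M) (@std_diffP 0) std_diff_exact.
End Resolve.

Section Prefix.
Variables (M : gradedModule A) (I : choiceType) (dg : I -> nat).
Variables (e : {linear freemod A dg -> M}) (ge : graded e).
Hypothesis e_surj : forall y, exists x, e x = y.
Variable Q : freeResolution (kermod ge).

Definition pre_gen i : choiceType := if i is i'.+1 then gen Q i' else I.
Definition pre_deg i : pre_gen i -> nat :=
  match i with 0 => dg | i'.+1 => @deg _ _ _ Q i' end.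
Definition pre_diff i : {linear {malg A[pre_gen i.+1]} -> {malg A[pre_gen i]}} :=
  match i return {linear {malg A[pre_gen i.+1]} -> {malg A[pre_gen i]}} with
  | 0 => (gsub_val (ker_submod e) (ker_part ge) : {linear kermod ge -> {malg A[I]}}) \o eps Q
  | i'.+1 => diff Q i'
  end.

Lemma pre_diff_deg i b : fhom (@pre_deg i) (pre_deg b) (pre_diff i << b >>).
Proof.
case: i b => [|i] b; last exact: diff_deg.
apply/fhomE; exact: (congr1 (gsub_val (ker_submod e) (ker_part ge)) (eps_deg (f := Q) b)).
Qed.

Lemma pre_eps_deg b : mpart (dg b) (e << b >>) = e << b >>.
Proof. by rewrite -ge freemodU. Qed.

Lemma pre_exact x : e x = 0 <-> exists y, x = pre_diff 0 y.
Proof.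
split=> [x0|[y ->]]; last exact: kermodP.
have xk : x \in ker_pred e by rewrite unfold_in x0.
have [y yx] := eps_surj Q (in_gsub _ (ker_part ge) xk : kermod ge).
by exists y; rewrite /= yx.
Qed.

Lemma pre_diff_exact i x : pre_diff i x = 0 <-> exists y, x = pre_diff i.+1 y.
Proof.
case: i x => [|i] x /=; last exact: diff_exact.
rewrite -(eps_exact (f := Q)); split=> h; last by rewrite h.
exact: val_inj.
Qed.

Definition prefix_resolution : freeResolution M :=
  @FreeResolution k A M pre_gen pre_deg pre_diff e pre_diff_deg pre_eps_deg e_surj pre_exact
    pre_diff_exact.
End Prefix.

(** Position [i.+1] of the spliced resolution is position [i] of the resolution of the kernel. At
    [i = 0] every element counts as a cycle for the kernel, while position 1 for [M] may have fewer
    cycles; hence an implication and not an equivalence. *)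
Lemma tor_shift (M : gradedModule A) (I : choiceType) (dg : I -> nat)
    (e : {linear freemod A dg -> M}) (ge : graded e) :
  (forall y, exists x, e x = y) ->
  forall i j, tor_vanishes (kermod ge) i j -> tor_vanishes M i.+1 j.
Proof.
move=> se i j [Q hQ]; exists (prefix_resolution se Q) => x hx cx.
by apply: hQ => //; case: i x {hx} cx.
Qed.

Lemma tor0_gen (M : gradedModule A) (I : choiceType) (dg : I -> nat)
    (e : {linear freemod A dg -> M}) (ge : graded e) :
  (forall y, exists x, e x = y) ->
  forall j, (forall b, dg b <> j) -> tor_vanishes M 0 j.
Proof.
move=> se j dj; exists (prefix_resolution se (std_resolution (kermod ge))) => x hx _.
exists 0; first by apply/fhomE; rewrite raddf0.
by rewrite linear0 subr0; apply: fhom_aug_zero hx.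
Qed.
End StandardResolution.

(** * The horseshoe construction *)

Section Horseshoe.
Variables (k : fieldType) (A : gradedAlgebra k).

(** Projectivity of graded free modules: replacing each chosen preimage by its component in the
    degree of the generator makes the lift graded. *)
Lemma graded_lift (I J : choiceType) (dI : I -> nat) (dJ : J -> nat) (N : gradedModule A)
    (f : {linear freemod A dJ -> N}) (g : {linear freemod A dI -> N}) :
  graded f -> graded g -> (forall b, exists z, f << b >> = g z) ->
  exists2 h : {linear freemod A dJ -> freemod A dI}, graded h & forall y, f y = g (h y).
Proof.
move=> gf gg /choice[z fz].
pose h : {linear freemod A dJ -> freemod A dI} :=
  linext (fun b => mpart (g := freemod A dI) (dJ b) (z b) : freemod A dI).
exists h; first by apply: linear_graded => b; rewrite linextU mpartK eqxx.
apply: (linear_malg_eq (g := g \o h)) => b /=.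
by rewrite [h _]linextU gg -fz -gf freemodU.
Qed.

Lemma comp_graded (M N L : gradedModule A) (f : M -> N) (g : N -> L) :
  graded f -> graded g -> graded (g \o f).
Proof. by move=> gf gg n x; rewrite /= gf gg. Qed.

Section SumGenerators.
Variables (I J : choiceType) (dI : I -> nat) (dJ : J -> nat).
Definition sum_gen : choiceType := (I + J)%type.
Definition sum_deg (b : sum_gen) := match b with inl b => dI b | inr b => dJ b end.
Local Notation S := (freemod A sum_deg).
Definition inL : {linear freemod A dI -> S} := linext (fun b => << inl b : sum_gen >> : S).
Definition inR : {linear freemod A dJ -> S} := linext (fun b => << inr b : sum_gen >> : S).
Definition prL : {linear S -> freemod A dI} :=
  linext (fun b : sum_gen => if b is inl b then << b >> else 0 : freemod A dI).
Definition prR : {linear S -> freemod A dJ} :=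
  linext (fun b : sum_gen => if b is inr b then << b >> else 0 : freemod A dJ).

Lemma inLK x : prL (inL x) = x.
Proof.
by move: x; apply: (linear_malg_eq (f := prL \o inL) (g := idfun)) => b; rewrite /= !linextU.
Qed.
Lemma inRK x : prR (inR x) = x.
Proof.
by move: x; apply: (linear_malg_eq (f := prR \o inR) (g := idfun)) => b; rewrite /= !linextU.
Qed.
Lemma inLR x : prR (inL x) = 0.
Proof.
by move: x; apply: (linear_malg_eq (f := prR \o inL) (g := \0)) => b; rewrite /= !linextU.
Qed.
Lemma inRL x : prL (inR x) = 0.
Proof.
by move: x; apply: (linear_malg_eq (f := prL \o inR) (g := \0)) => b; rewrite /= !linextU.
Qed.
Lemma sum_decomp x : x = inL (prL x) + inR (prR x).
Proof.
move: x; apply: (linear_malg_eq (f := idfun) (g := (inL \o prL) \+ (inR \o prR))) => b /=.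
by rewrite [prL _]linextU [prR _]linextU; case: b => b; rewrite linear0 ?addr0 ?add0r [RHS]linextU.
Qed.
Lemma inL_graded : graded inL.
Proof. by apply: linear_graded => b; rewrite [inL _]linextU; exact: (@freemodU k A sum_gen sum_deg (inl b)). Qed.
Lemma inR_graded : graded inR.
Proof. by apply: linear_graded => b; rewrite [inR _]linextU; exact: (@freemodU k A sum_gen sum_deg (inr b)). Qed.
Lemma prL_graded : graded prL.
Proof.
apply: linear_graded => b; rewrite [prL _]linextU; case: b => b; last exact: raddf0.
exact: freemodU.
Qed.
Lemma prR_graded : graded prR.
Proof.
apply: linear_graded => b; rewrite [prR _]linextU; case: b => b; first exact: raddf0.
exact: freemodU.
Qed.
End SumGenerators.

(** Exactness is demanded in positive positions only, and of the augmentation nothing but degree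
    preservation. So the same type holds a resolution of a submodule of [M] and a resolution of a
    quotient of [M] whose augmentation has been lifted to [M]. *)
Record complexOver (M : gradedModule A) := ComplexOver {
  cgen : nat -> choiceType;
  cdeg : forall i, cgen i -> nat;
  cdiff : forall i, {linear freemod A (@cdeg i.+1) -> freemod A (@cdeg i)};
  ceps : {linear freemod A (@cdeg 0) -> M};
  cdiff_graded : forall i, graded (cdiff i);
  ceps_graded : graded ceps;
  cdiff_exact : forall i x, cdiff i x = 0 <-> exists y, x = cdiff i.+1 y
}.

Definition complex_cycle (M : gradedModule A) (P : complexOver M) (i : nat) :
    freemod A (@cdeg M P i) -> Prop :=
  if i is i'.+1 then fun x => aug_zero (cdiff P i' x) else fun _ => True.

Definition complex_tor0 (M : gradedModule A) (P : complexOver M) (i j : nat) :=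
  forall x : freemod A (@cdeg M P i), mpart j x = x -> complex_cycle x ->
    exists2 y, mpart j y = y & aug_zero (x - cdiff P i y).

Lemma complex_tor (M : gradedModule A) (P : complexOver M) i j :
  (forall y, exists x, ceps P x = y) ->
  (forall x, ceps P x = 0 <-> exists y, x = cdiff P 0 y) ->
  complex_tor0 P i j -> tor_vanishes M i j.
Proof.
move=> es ee h.
have dd i' b : fhom (@cdeg M P i') (cdeg b) (cdiff P i' << b >>).
  by apply/fhomE; rewrite -cdiff_graded freemodU.
have ed b : mpart (cdeg b) (ceps P << b >>) = ceps P << b >>.
  by rewrite -ceps_graded freemodU.
exists (@FreeResolution k A M (@cgen M P) (@cdeg M P) (cdiff P) (ceps P) dd ed es ee
  (@cdiff_exact M P)) => x /fhomE hx cx.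
have [|y /fhomE hy hxy] := h x hx; first by case: i {h hx} x cx.
by exists y.
Qed.

Section Total.
Variables (M : gradedModule A) (P' P'' : complexOver M).
Hypothesis exact' : forall x, ceps P' x = 0 <-> exists y, x = cdiff P' 0 y.
Hypothesis exact'' :
  forall x, (exists z, ceps P'' x = ceps P' z) <-> exists y, x = cdiff P'' 0 y.
Hypothesis surj : forall m, exists x z, m = ceps P'' x + ceps P' z.
Local Notation F' i := (freemod A (@cdeg M P' i)).
Local Notation F'' i := (freemod A (@cdeg M P'' i)).

(** [h] is the off-diagonal component of the total differential. The second condition is what makes
    the next component exist. *)
Definition twistP i (h : {linear F'' i.+1 -> F' i}) :=
  graded h /\ forall y, exists z, h (cdiff P'' i.+1 y) = cdiff P' i z.

Lemma cdiffK (P : complexOver M) i y : cdiff P i (cdiff P i.+1 y) = 0.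
Proof. by apply/cdiff_exact; exists y. Qed.

(** By [exact''] the composite of [cdiff P'' 0] and [ceps P''] lands in the image of [ceps P'],
    hence lifts; the sign makes the total augmentation vanish on boundaries. *)
Lemma twist0 : exists2 h, twistP (i := 0) h & forall y, ceps P'' (cdiff P'' 0 y) = - ceps P' (h y).
Proof.
have g1 : graded (ceps P'' \o cdiff P'' 0).
  by apply: comp_graded; [exact: cdiff_graded|exact: ceps_graded].
have [|h gh hE] := graded_lift g1 (@ceps_graded _ P').
  by move=> b; apply/exact''; exists << b >>.
exists (\- h) => [|y]; last by rewrite /= raddfN /= opprK -hE.
split=> [n x|y]; first by rewrite /= gh raddfN.
by apply/exact'; rewrite /= raddfN /= -hE /= cdiffK raddf0 oppr0.
Qed.

Lemma twistS i h : twistP (i := i) h ->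
  exists2 h', twistP (i := i.+1) h' & forall y, h (cdiff P'' i.+1 y) = - cdiff P' i (h' y).
Proof.
move=> [gh hz].
have g1 : graded (h \o cdiff P'' i.+1) by apply: comp_graded => //; exact: cdiff_graded.
have [|h' gh' hE] := graded_lift g1 (@cdiff_graded _ P' i).
  by move=> b; exact: hz.
exists (\- h') => [|y]; last by rewrite /= raddfN /= opprK -hE.
split=> [n x|y]; first by rewrite /= gh' raddfN.
by apply/cdiff_exact; rewrite /= raddfN /= -hE /= cdiffK raddf0 oppr0.
Qed.

Fixpoint twist i : {h | twistP (i := i) h} :=
  match i with
  | 0 => let: exist2 h hP _ := cid2 twist0 in exist _ h hP
  | i'.+1 => let: exist h hP := twist i' in
             let: exist2 h' hP' _ := cid2 (twistS hP) in exist _ h' hP'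
  end.
Local Notation tw i := (sval (twist i)).

Lemma tw0E y : ceps P'' (cdiff P'' 0 y) = - ceps P' (tw 0 y).
Proof. by rewrite /=; case: (cid2 _). Qed.
Lemma twSE i y : tw i (cdiff P'' i.+1 y) = - cdiff P' i (tw i.+1 y).
Proof. by rewrite /=; case: (twist i) => h hP; case: (cid2 _). Qed.
Lemma tw_graded i : graded (tw i). Proof. exact: (svalP (twist i)).1. Qed.

Local Notation PL i := (prL (@cdeg M P' i) (@cdeg M P'' i)).
Local Notation PR i := (prR (@cdeg M P' i) (@cdeg M P'' i)).
Local Notation IL i := (inL (@cdeg M P' i) (@cdeg M P'' i)).
Local Notation IR i := (inR (@cdeg M P' i) (@cdeg M P'' i)).
Local Notation F i := (freemod A (sum_deg (@cdeg M P' i) (@cdeg M P'' i))).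

Definition tot_diff i : {linear F i.+1 -> F i} :=
  (IL i \o ((cdiff P' i \o PL i.+1) \+ (tw i \o PR i.+1))) \+ (IR i \o cdiff P'' i \o PR i.+1).
Definition tot_eps : {linear F 0 -> M} := (ceps P' \o PL 0) \+ (ceps P'' \o PR 0).

Lemma tot_diffE i x : tot_diff i x =
  IL i (cdiff P' i (PL i.+1 x) + tw i (PR i.+1 x)) + IR i (cdiff P'' i (PR i.+1 x)).
Proof. by []. Qed.
Lemma PL_tot i x : PL i (tot_diff i x) = cdiff P' i (PL i.+1 x) + tw i (PR i.+1 x).
Proof. by rewrite tot_diffE linearD inLK inRL addr0. Qed.
Lemma PR_tot i x : PR i (tot_diff i x) = cdiff P'' i (PR i.+1 x).
Proof. by rewrite tot_diffE linearD inLR inRK add0r. Qed.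

Lemma tot_diff_graded i : graded (tot_diff i).
Proof.
move=> n x; rewrite !tot_diffE prL_graded prR_graded !cdiff_graded tw_graded.
by rewrite -raddfD inL_graded inR_graded -raddfD.
Qed.
Lemma tot_eps_graded : graded tot_eps.
Proof. by move=> n x; rewrite /= prL_graded prR_graded !ceps_graded raddfD. Qed.

Lemma sum_eq0 i (x : F i) : PL i x = 0 -> PR i x = 0 -> x = 0.
Proof. by move=> l0 r0; rewrite (sum_decomp x) l0 r0 !linear0 addr0. Qed.

Lemma PL_pair i u v : PL i (IL i u + IR i v) = u.
Proof. by rewrite linearD /= inLK inRL addr0. Qed.
Lemma PR_pair i u v : PR i (IL i u + IR i v) = v.
Proof. by rewrite linearD /= inLR inRK add0r. Qed.

Lemma tot_pair i (x : F i) (u : F' i.+1) (v : F'' i.+1) :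
  PL i x = cdiff P' i u + tw i v -> PR i x = cdiff P'' i v ->
  x = tot_diff i (IL i.+1 u + IR i.+1 v).
Proof.
move=> xl xr; apply/subr0_eq/sum_eq0; rewrite linearB /=.
  by rewrite PL_tot PL_pair PR_pair xl subrr.
by rewrite PR_tot PR_pair xr subrr.
Qed.

Lemma tot_exact i x : tot_diff i x = 0 <-> exists y, x = tot_diff i.+1 y.
Proof.
split=> [x0|[y ->]]; last first.
  apply: sum_eq0; rewrite ?PL_tot ?PR_tot ?PR_tot ?PL_tot ?PR_tot ?cdiffK //.
  by rewrite linearD /= cdiffK add0r twSE addrN.
have [v xr] : exists v, PR i.+1 x = cdiff P'' i.+1 v.
  by apply/cdiff_exact; rewrite -PR_tot x0 linear0.
have [u xl] : exists u, PL i.+1 x - tw i.+1 v = cdiff P' i.+1 u.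
  by apply/cdiff_exact; rewrite linearB /= -[X in _ - X]opprK opprK -twSE -xr -PL_tot x0 linear0.
by exists (IL i.+2 u + IR i.+2 v); apply: tot_pair => //; rewrite -xl subrK.
Qed.

Lemma tot_eps_exact x : tot_eps x = 0 <-> exists y, x = tot_diff 0 y.
Proof.
split=> [x0|[y ->]]; last first.
  by rewrite /tot_eps /= PL_tot PR_tot linearD /= tw0E addrK; apply/exact'; eexists.
have [v xr] : exists v, PR 0 x = cdiff P'' 0 v.
  apply/exact''; exists (- PL 0 x); rewrite linearN /=; apply/eqP.
  by rewrite -addr_eq0 addrC; apply/eqP.
have [u xl] : exists u, PL 0 x - tw 0 v = cdiff P' 0 u.
  by apply/exact'; rewrite linearB /= -tw0E -xr.
by exists (IL 1 u + IR 1 v); apply: tot_pair => //; rewrite -xl subrK.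
Qed.

Lemma tot_eps_surj m : exists x, tot_eps x = m.
Proof.
have [x [z ->]] := surj m; exists (IL 0 z + IR 0 x).
by rewrite /tot_eps /= PL_pair PR_pair addrC.
Qed.

Definition total : complexOver M :=
  @ComplexOver M _ _ tot_diff tot_eps tot_diff_graded tot_eps_graded tot_exact.

Lemma horseshoe_tor i j : complex_tor0 P' i j -> complex_tor0 P'' i j -> tor_vanishes M i j.
Proof.
move=> h' h''; apply: (complex_tor (P := total) tot_eps_surj tot_eps_exact) => x jx cx.
have cr : complex_cycle (PR i x).
  case: i x {h' h'' jx} cx => [|i] x //= cx; rewrite -PR_tot; exact: aug_zero_lin.
have [v jv vP] := h'' (PR i x) (gradedW (@prR_graded _ _ _ _) jx) cr.
have jw : mpart j (PL i x - tw i v) = PL i x - tw i v.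
  by rewrite raddfB /= -prL_graded jx -tw_graded jv.
(* Since the twists anticommute with the differentials, the differential of this element is the left
   component of [tot_diff i x] minus the twist of [PR x - cdiff P'' v]; both have zero
   augmentation. *)
have cl : complex_cycle (PL i x - tw i v).
  case: i x v {h' h'' jx jw cr jv} cx vP => [|i] x v //= cx vP.
  rewrite raddfB /= -[X in _ - X]opprK opprK -[X in _ - X]opprK opprK.
  have -> : cdiff P' i (PL i.+1 x) = PL i (tot_diff i x) - tw i (PR i.+1 x).
    by rewrite PL_tot addrK.
  rewrite -addrA; apply: aug_zeroD; first exact: aug_zero_lin.
  rewrite -opprD -[cdiff P' i _]opprK -twSE -raddfB; apply: aug_zeroN.
  exact: aug_zero_lin.
have [u ju uP] := h' _ jw cl.
exists (IL i.+1 u + IR i.+1 v).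
  by rewrite raddfD /= -inL_graded -inR_graded ju jv.
rewrite (sum_decomp (x - _)) !linearB /= PL_tot PR_tot PL_pair PR_pair -!linearB /=.
rewrite [_ + tw i v]addrC opprD addrA.
by apply: aug_zeroD; apply: aug_zero_lin.
Qed.
End Total.
End Horseshoe.

Lemma mem_congr (T : Type) (Q : {pred T}) (x y : T) : x \in Q -> x = y -> y \in Q.
Proof. by move=> xQ <-. Qed.

(** * Extensions whose quotient is concentrated in one degree *)

Section ShiftedFree.
Variables (k : fieldType) (A : gradedAlgebra k) (I : choiceType) (deg : I -> nat) (s : nat).
Definition shift_deg (b : I) := (deg b + s)%N.

Lemma shift_part n (x : {malg A[I]}) :
  mpart (g := freemod A shift_deg) (n + s) x = mpart (g := freemod A deg) n x.
Proof.
by apply/malgP => b; rewrite [LHS]free_partE [RHS]free_partE /shift_deg leq_add2r subnDr.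
Qed.
Lemma shift_part_lt n (x : {malg A[I]}) : (n < s)%N ->
  mpart (g := freemod A shift_deg) n x = 0.
Proof.
move=> ns; apply/malgP => b; rewrite [LHS]free_partE /shift_deg mcoeff0.
by case: ifP => //; lia.
Qed.
Lemma shift_hom n (x : {malg A[I]}) : mpart (g := freemod A shift_deg) n x = x ->
  x = 0 \/ exists2 m, n = (m + s)%N & mpart (g := freemod A deg) m x = x.
Proof.
case: (leqP s n) => [sn|ns]; last by rewrite shift_part_lt //; left.
by rewrite -(subnK sn) shift_part; right; exists (n - s)%N.
Qed.
End ShiftedFree.

Section Submodule.
Variables (k : fieldType) (A : gradedAlgebra k) (M M' : gradedModule A) (s : nat).
Variables (iota : {linear M' -> M}).
Hypotheses (iota_inj : injective iota) (iota_shift : gshift s iota).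
Variable P : freeResolution M'.

Definition sub_diff i : {linear freemod A (shift_deg (@deg _ _ _ P i.+1) s) ->
  freemod A (shift_deg (@deg _ _ _ P i) s)} := diff P i.
Definition sub_eps : {linear freemod A (shift_deg (@deg _ _ _ P 0) s) -> M} := iota \o eps P.
Lemma sub_diff_graded i : graded (sub_diff i).
Proof.
apply: linear_graded => b; rewrite /shift_deg shift_part.
exact: (proj1 (@fhomE k A _ _ _ _) (@diff_deg _ _ _ P i b)).
Qed.
Lemma sub_eps_graded : graded sub_eps.
Proof. by apply: linear_graded => b; rewrite /shift_deg /= iota_shift eps_deg. Qed.
Definition sub_complex : complexOver M :=
  @ComplexOver _ _ M _ _ sub_diff sub_eps sub_diff_graded sub_eps_graded (@diff_exact _ _ _ P).

Lemma sub_complex_exact x : ceps sub_complex x = 0 <-> exists y, x = cdiff sub_complex 0 y.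
Proof.
rewrite -(eps_exact (f := P)) /= -[X in _ = X](raddf0 iota).
by split=> [/iota_inj|->].
Qed.

(** The re-graded free modules are zero below degree [s], so only degrees [j' + s] have to be
    treated. *)
Lemma sub_complex_tor i j :
  (forall j', j = (j' + s)%N -> forall x, fhom (@deg _ _ _ P i) j' x -> tor_cycle x ->
    exists2 y, fhom (@deg _ _ _ P i.+1) j' y & aug_zero (x - diff P i y)) ->
  complex_tor0 sub_complex i j.
Proof.
move=> h x hx cx; case: (shift_hom hx) => [->|[j' jE jx]].
  exists 0; first exact: raddf0.
  by rewrite linear0 subr0; exact: aug_zero0.
have [||y jy yP] := h j' jE x; first by apply/fhomE.
  by case: i x {h hx jx} cx.
by exists y => //=; rewrite jE shift_part; apply/fhomE.
Qed.
End Submodule.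

Section TrivialQuotient.
Variables (k : fieldType) (A : gradedAlgebra k) (M : gradedModule A).
Variables (Q : submodClosed M) (d : nat).
Hypothesis Qd : forall n x, n <> d -> mpart n x \in Q.

Lemma in_parts (x : M) : (forall n, mpart n x \in Q) -> x \in Q.
Proof. by apply: (mpart_ind (P := fun x => x \in Q)); [exact: rpred0|move=> u v; exact: rpredD]. Qed.

Lemma submodB (x y : M) : x \in Q -> y \in Q -> x - y \in Q.
Proof. by move=> hx hy; rewrite -scaleN1r rpredD // rpredZ. Qed.

(** [M / Q] lives in the single degree [d], so [A_+] kills it and [A] acts through the augmentation:
    the quotient is just a vector space over [k]. *)
Lemma scale_aug (a : A) (m : M) : mpart d m = m -> a *: m - (gaug a)%:A *: m \in Q.
Proof.
move=> dm; apply: in_parts => n; case: (n =P d) => [->|]; last exact: Qd.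
by rewrite -scalerBl (mpart_scale d _ dm) leqnn subnn linearB /= -gpart0E gpartK subrr scale0r rpred0.
Qed.

(** Linear independence over [k] of the classes of [S] in [M / Q]. *)
Definition free_mod (S : M -> Prop) := (forall m, S m -> mpart d m = m) /\
  forall (D : {fset M}) (f : M -> k), (forall m, m \in D -> S m) ->
    \sum_(m <- D) (f m)%:A *: m \in Q -> forall m, m \in D -> f m = 0.

Lemma basis_mod : exists2 S, free_mod S & forall m, mpart d m = m ->
  exists D : {fset M}, exists2 f : M -> k, (forall x, x \in D -> S x) &
    m - \sum_(x <- D) (f x)%:A *: x \in Q.
Proof.
have [|S [fS maxS]] := @classical_sets.Zorn_bigcup M free_mod.
  move=> F FP Ftot; split=> [m [X FX Xm]|D f DF]; first exact: (FP X FX).1.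
  (* A finite part of the union of a chain lies in one member of the chain; the empty part is
     separate because the chain may be empty. *)
  have [E|[X FX DX]] : (D : seq M) = [::] \/ exists2 X, F X & forall m, m \in (D : seq M) -> X m.
    have : forall m, m \in (D : seq M) -> exists2 X, F X & X m by move=> m /DF[X]; exists X.
    elim: (D : seq M) => [|m t IH] ht; first by left.
    have [X FX Xm] := ht m (mem_head _ _); right.
    have [|E|[Y FY Yt]] := IH; first by move=> x xt; apply: ht; rewrite inE xt orbT.
      by exists X => // x; rewrite E inE => /eqP->.
    have [XY|YX] := Ftot X Y FX FY.
      by exists Y => // x; rewrite inE => /orP[/eqP->|]; [exact: XY|exact: Yt].
    by exists X => // x; rewrite inE => /orP[/eqP->//|/Yt]; exact: YX.
  - by move=> _ m; rewrite -[m \in D]/(m \in (D : seq M)) E.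
  - exact: (FP X FX).2 D f DX.
exists S => // m dm; apply: contrapT => mS.
have nS : ~ S m.
  move=> Sm; apply: mS; exists [fset m]%fset, (fun=> 1) => [x|].
    by rewrite in_fset1 => /eqP->.
  by rewrite big_seq_fset1 !scale1r subrr rpred0.
(* An element outside the span can be adjoined: a relation with nonzero coefficient at [m] could be
   solved for [m]. *)
apply: (maxS (fun x => S x \/ x = m)).
  by split=> [x|/(_ m)]; [left|move=> h; apply: nS; apply: h; right].
split=> [x [/(fS.1)|->]//|D f DS].
have Dm x : x \in (D `\ m)%fset -> S x.
  by rewrite in_fsetD1 => /andP[/eqP xm /DS[]].
have [mD|mND] := boolP (m \in D); last first.
  move=> sQ; apply: (fS.2 D f) sQ => x xD; have [//|xm] := DS x xD.
  by move: mND; rewrite -xm xD.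
rewrite (big_fsetD1 m) //= => sQ; have [fm|fm] := eqVneq (f m) 0.
  move: sQ; rewrite fm scale0r scale0r add0r => /(fS.2 _ _ Dm) h x xD.
  by have [->//|xm] := eqVneq x m; apply: h; rewrite in_fsetD1 xm.
case: mS; exists (D `\ m)%fset, (fun x => - (f m)^-1 * f x) => //.
have := rpredZ ((f m)^-1)%:A sQ; rewrite scalerDr scalerA -scalerAl mul1r scalerA mulVf //.
rewrite !scale1r => h; apply: (mem_congr h); congr (_ + _).
rewrite scaler_sumr -sumrN; apply: eq_bigr => x _.
by rewrite scalerA -scalerAl mul1r scalerA mulNr !scaleNr opprK.
Qed.

Variables (S : pred M) (Pr : freeResolution (trivial_module A)).
Hypothesis S_deg : forall m, S m -> mpart d m = m.
Hypothesis S_free : forall (D : {fset M}) (f : M -> k), (forall m, m \in D -> S m) ->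
    \sum_(m <- D) (f m)%:A *: m \in Q -> forall m, m \in D -> f m = 0.
Hypothesis S_span : forall m, mpart d m = m ->
  exists D : {fset M}, exists2 f : M -> k, (forall x, x \in D -> S x) &
    m - \sum_(x <- D) (f x)%:A *: x \in Q.
Local Notation J := ({m : M | S m} : choiceType).
Local Notation G i := (gen Pr i).

(** One copy of the resolution of [k], shifted by [d], for each element of a basis of [M / Q]. *)
Definition quo_gen i : choiceType := (J * G i)%type.
Definition quo_deg i (b : quo_gen i) := (deg b.2 + d)%N.
Local Notation F i := (freemod A (@quo_deg i)).
Local Notation E i := (freemod A (shift_deg (@deg _ _ _ Pr i) d)).

Definition ins i (j : J) : {linear E i -> F i} := linext (fun b => << (j, b) : quo_gen i >> : F i).
Definition prj i (j : J) : {linear F i -> E i} :=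
  linext (fun b : quo_gen i => (if b.1 == j then << b.2 >> else 0) : E i).

Lemma prj_ins i j j' x : prj i j' (ins i j x) = if j == j' then x else 0.
Proof.
move: x; case: eqP => [->|/eqP/negPf jj'].
  apply: (linear_malg_eq (f := prj i j' \o ins i j') (g := idfun)) => b /=.
  by rewrite /ins /prj !linextU eqxx.
apply: (linear_malg_eq (f := prj i j' \o ins i j) (g := \0)) => b /=.
by rewrite /ins /prj !linextU jj'.
Qed.

Lemma ins_graded i j : graded (ins i j).
Proof.
by apply: linear_graded => b; rewrite [ins i j _]linextU; exact: (@freemodU k A _ (@quo_deg i) (j, b)).
Qed.
Lemma prj_graded i j : graded (prj i j).
Proof.
apply: linear_graded => b; rewrite [prj i j _]linextU; case: ifP => _; last exact: raddf0.
exact: (@freemodU k A _ (shift_deg (@deg _ _ _ Pr i) d) b.2).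
Qed.

Lemma quo_decomp i (x : F i) : exists D : {fset J}, x = \sum_(j <- D) ins i j (prj i j x).
Proof.
suff [D h] : exists D : {fset J}, forall D', (D `<=` D')%fset ->
    x = \sum_(j <- D') ins i j (prj i j x) by exists D; exact: h.
move: x; apply: malg_ind => [|x y [D hD] [D' hD']|a b].
- by exists fset0 => D' _; rewrite big1 // => j _; rewrite !raddf0.
- exists (D `|` D')%fset => D''; rewrite fsubUset => /andP[DD D'D].
  rewrite {1}(hD D'') // {1}(hD' D'') // -big_split /=; apply: eq_bigr => j _.
  by rewrite !linearD.
exists [fset b.1]%fset => D'; rewrite fsub1set => bD.
rewrite (big_fsetD1 b.1) //= big_seq big1 ?addr0 => [|j].
  rewrite !linearZ /=; congr (_ *: _).
  by rewrite /prj linextU eqxx [RHS]linextU -surjective_pairing.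
rewrite in_fsetD1 => /andP[/negPf jb _].
by rewrite !linearZ /= /prj linextU eq_sym jb linear0 scaler0.
Qed.

Lemma prj_eq i (x y : F i) : (forall j, prj i j x = prj i j y) -> x = y.
Proof.
move=> xy; apply/subr0_eq; have [D ->] := quo_decomp (x - y).
by rewrite big1 // => j _; rewrite linearB /= xy subrr linear0.
Qed.

Definition quo_diff i : {linear F i.+1 -> F i} :=
  linext (fun b : quo_gen i.+1 => ins i b.1 (diff Pr i << b.2 >>)).
Definition quo_eps : {linear F 0 -> M} :=
  linext (fun b : quo_gen 0 => ((eps Pr << b.2 >> : trivmod A) : k)%:A *: val b.1).

Lemma quo_diff_ins i j x : quo_diff i (ins i.+1 j x) = ins i j (diff Pr i x).
Proof.
move: x; apply: (linear_malg_eq (f := quo_diff i \o ins i.+1 j) (g := ins i j \o diff Pr i)) => b /=.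
by rewrite [ins i.+1 j _]linextU [LHS]linextU.
Qed.

Lemma prj_diff i j x : prj i j (quo_diff i x) = diff Pr i (prj i.+1 j x).
Proof.
move: x; apply: (linear_malg_eq (f := prj i j \o quo_diff i) (g := diff Pr i \o prj i.+1 j)) => b /=.
rewrite [quo_diff _ _]linextU [prj i.+1 j _]linextU prj_ins.
by case: ifP => _ //; rewrite linear0.
Qed.

Lemma quo_diff_graded i : graded (quo_diff i).
Proof.
apply: linear_graded => b; rewrite [quo_diff i _]linextU -ins_graded; congr (ins _ _ _).
rewrite [LHS](@shift_part k A _ (@deg _ _ _ Pr i) d (deg b.2)).
exact: (proj1 (@fhomE k A _ _ _ _) (@diff_deg _ _ _ Pr i b.2)).
Qed.

Lemma quo_eps_graded : graded quo_eps.
Proof.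
apply: linear_graded => b; rewrite [quo_eps _]linextU.
have := eps_deg (f := Pr) b.2.
rewrite (mpart_scale _ _ (S_deg (valP b.1))) /quo_deg leq_addl addnK.
case: (deg b.2) => [|n].
  by move=> _; rewrite linearZ /= gpart1.
by move=> <-; rewrite /mpart /= scale0r raddf0.
Qed.

(** On generators [quo_eps] multiplies basis elements by constants; by [scale_aug] its linear
    extension can be compared with [eps] only modulo [Q]. *)
Lemma quo_eps_ins j t : quo_eps (ins 0 j t) - ((eps Pr t : trivmod A) : k)%:A *: val j \in Q.
Proof.
move: t; apply: malg_ind => [|x y hx hy|a b].
- by rewrite !linear0 scale0r scale0r subr0 rpred0.
- apply: (mem_congr (rpredD hx hy)); rewrite !linearD /=.
  by rewrite !scalerDl opprD !addrA; congr (_ - _); rewrite -!addrA; congr (_ + _); rewrite addrC.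
rewrite !linearZ /= [ins 0 j _]linextU [quo_eps _]linextU /=.
rewrite [a *: (eps Pr _ : trivmod A)]/GRing.scale /= /trivmod_scale.
set c : k := eps Pr _; rewrite -scalerA scalerA.
have h : mpart d (c%:A *: val j) = c%:A *: val j.
  by rewrite (mpart_scale d _ (S_deg (valP j))) leqnn subnn linearZ /= gpart1.
have := scale_aug a h; rewrite !scalerA -!scalerAl !mul1r scalerA => h2.
by apply: (mem_congr h2); rewrite ?scalerN.
Qed.

Lemma quo_eps_sum (D : {fset J}) (t : J -> E 0) :
  quo_eps (\sum_(j <- D) ins 0 j (t j)) - \sum_(j <- D) ((eps Pr (t j) : trivmod A) : k)%:A *: val j \in Q.
Proof.
rewrite linear_sum -sumrB; elim/big_ind: _ => [|x y|j _].
- exact: rpred0.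
- exact: rpredD.
exact: quo_eps_ins.
Qed.

Lemma quo_eps_exact x : quo_eps x \in Q <-> exists y, x = quo_diff 0 y.
Proof.
split=> [xQ|[y ->]]; last first.
  have [D ->] := quo_decomp (quo_diff 0 y).
  have := quo_eps_sum D (fun j => prj 0 j (quo_diff 0 y)).
  rewrite [X in _ - X]big1 ?subr0 // => j _.
  by rewrite prj_diff (proj2 (eps_exact (f := Pr) _)) ?scale0r ?scale0r //; eexists.
have [D xD] := quo_decomp x.
have := quo_eps_sum D (fun j => prj 0 j x); rewrite -xD => h.
have {h} := submodB xQ h; rewrite opprB addrC subrK => h.
pose f (m : M) : k := if insub m is Some j then eps Pr (prj 0 j x) : trivmod A else 0.
have fE (j : J) : f (val j) = eps Pr (prj 0 j x) by rewrite /f valK.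
have e0 j : j \in D -> eps Pr (prj 0 j x) = 0.
  move=> jD; have := @S_free (val @` D)%fset f; rewrite /= => /(_ _ _ (val j)).
  rewrite fE; apply.
  - by move=> m /imfsetP[j' _ ->]; exact: valP j'.
  - rewrite big_imfset /=; last by move=> u v _ _ uv; apply: val_inj.
    by apply: (mem_congr h); apply: eq_bigr => j' _; rewrite fE.
  - by apply/imfsetP; exists j.
have /choice[y yE] j : exists y, j \in D -> prj 0 j x = diff Pr 0 y.
  case: (boolP (j \in D)) => [jD|_]; last by exists 0.
  by have [y yx] := proj1 (eps_exact (f := Pr) _) (e0 j jD); exists y.
exists (\sum_(j <- D) ins 1 j (y j)); rewrite linear_sum {1}xD /=.
by rewrite big_seq [RHS]big_seq; apply: eq_bigr => j jD; rewrite quo_diff_ins -yE.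
Qed.

Lemma quo_exact i x : quo_diff i x = 0 <-> exists y, x = quo_diff i.+1 y.
Proof.
split=> [x0|[y ->]]; last first.
  apply: prj_eq => j; rewrite !prj_diff raddf0.
  by apply/diff_exact; eexists.
have /choice[y yE] j : exists y, prj i.+1 j x = diff Pr i.+1 y.
  by apply/diff_exact; rewrite -prj_diff x0 raddf0.
have [D ->] := quo_decomp x; exists (\sum_(j <- D) ins i.+2 j (y j)).
by rewrite linear_sum; apply: eq_bigr => j _; rewrite yE /= quo_diff_ins.
Qed.

Definition quo_complex : complexOver M :=
  @ComplexOver _ _ M _ _ quo_diff quo_eps quo_diff_graded quo_eps_graded quo_exact.

Lemma quo_gen_mod m : exists x, m - quo_eps x \in Q.
Proof.
pose good m := exists x, m - quo_eps x \in Q; rewrite -/(good m).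
have g0 z : z \in Q -> good z by move=> zQ; exists 0; rewrite linear0 subr0.
have gD u v : good u -> good v -> good (u + v).
  by move=> [x hx] [y hy]; exists (x + y); rewrite linearD opprD addrACA rpredD.
have gB u v : u - v \in Q -> good v -> good u.
  by move=> /g0 h1 h2; rewrite -(subrK v u); exact: gD.
apply: (mpart_ind (P := good)) => [||n]; [exact/g0/rpred0|exact: gD|].
case: (n =P d) => [->|nd]; last exact/g0/Qd.
have [|D [f DS /gB]] := S_span (m := mpart d m); first by rewrite mpartK eqxx.
apply; rewrite big_seq; elim/big_ind: _ => [||x xD]; [exact/g0/rpred0|exact: gD|].
have [t t1] := eps_surj Pr (f x : trivmod A).
exists (ins 0 (Sub x (DS x xD) : J) t); rewrite -opprB -scaleN1r rpredZ //.
have := quo_eps_ins (Sub x (DS x xD) : J) t; rewrite t1 => h.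
exact: (mem_congr h).
Qed.

Lemma quo_complex_tor i j :
  (forall j', j = (j' + d)%N -> forall x, fhom (@deg _ _ _ Pr i) j' x -> tor_cycle x ->
    exists2 y, fhom (@deg _ _ _ Pr i.+1) j' y & aug_zero (x - diff Pr i y)) ->
  complex_tor0 quo_complex i j.
Proof.
move=> h x hx cx.
have hp s : mpart j (prj i s x) = prj i s x by rewrite -prj_graded hx.
have /choice[y hy] s : exists y : E i.+1, mpart j y = y /\ aug_zero (prj i s x - diff Pr i y).
  case: (shift_hom (hp s)) => [->|[j' jE jx]].
    by exists 0; split; [exact: raddf0|rewrite linear0 subr0; exact: aug_zero0].
  have [||y jy yP] := h j' jE (prj i s x); first by apply/fhomE.
    case: i x {h hx hp jx} cx => [|i] x //= cx.
    by rewrite -prj_diff; exact: aug_zero_lin.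
  exists y; split=> //; rewrite jE [LHS]shift_part.
  exact: (proj1 (@fhomE k A _ _ _ _) jy).
have [D xD] := quo_decomp x; exists (\sum_(s <- D) ins i.+1 s (y s)).
  rewrite raddf_sum; apply: eq_bigr => s _ /=.
  by rewrite -ins_graded (hy s).1.
rewrite linear_sum {1}xD /= -sumrB; apply: aug_zero_sum => s _.
by rewrite quo_diff_ins -linearB; apply: aug_zero_lin; exact: (hy s).2.
Qed.
End TrivialQuotient.

(* Long exact sequence for a submodule whose quotient is a sum of copies of k in degree d. *)
Lemma tor_ext (k : fieldType) (A : gradedAlgebra k) (M M' : gradedModule A) s d
    (iota : {linear M' -> M}) : injective iota -> gshift s iota ->
  (forall n x, n <> d -> exists z, mpart n x = iota z) ->
  forall i j, (forall j', j = (j' + s)%N -> tor_vanishes M' i j') ->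
    (forall j', j = (j' + d)%N -> tor_vanishes (trivial_module A) i j') ->
    tor_vanishes M i j.
Proof.
move=> inj sh hq i j h' h''; pose Q : submodClosed M := gsub_pred (im_submod iota).
have QP x : x \in Q <-> exists z, x = iota z.
  by rewrite -[x \in Q]/(`[< exists z, x = iota z >]); split=> [/asboolP|?]; last exact/asboolP.
have Qd n x : n <> d -> mpart n x \in Q by move=> nd; apply/QP/hq.
have [S [Sd Sf] Ss] := basis_mod Q d.
pose S' : pred M := fun m => `[< S m >].
have Sd' m : S' m -> mpart d m = m by move/asboolP/Sd.
have Sf' (D : {fset M}) (f : M -> k) : (forall m, m \in D -> S' m) ->
    \sum_(m <- D) (f m)%:A *: m \in Q -> forall m, m \in D -> f m = 0.
  by move=> h; apply: Sf => m /h/asboolP.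
have Ss' m : mpart d m = m -> exists D : {fset M}, exists2 f : M -> k,
    (forall x, x \in D -> S' x) & m - \sum_(x <- D) (f x)%:A *: x \in Q.
  by move=> /Ss[D [f h1 h2]]; exists D, f => // x /h1 h; apply/asboolP.
(* If [j < s] the requirement is empty and the standard resolution serves; the same holds for [d]
   below. *)
have [P' hP'] : exists P : freeResolution M', forall j', j = (j' + s)%N ->
    forall x, fhom (@deg _ _ _ P i) j' x -> tor_cycle x ->
    exists2 y, fhom (@deg _ _ _ P i.+1) j' y & aug_zero (x - diff P i y).
  case: (pselect (exists j', j = (j' + s)%N)) => [[j' jE]|nj].
    by have [P hP] := h' j' jE; exists P => j''; rewrite jE => /addIn <-.
  by exists (std_resolution M') => j' jE; case: nj; exists j'.
have [P hP] : exists P : freeResolution (trivial_module A), forall j', j = (j' + d)%N ->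
    forall x, fhom (@deg _ _ _ P i) j' x -> tor_cycle x ->
    exists2 y, fhom (@deg _ _ _ P i.+1) j' y & aug_zero (x - diff P i y).
  case: (pselect (exists j', j = (j' + d)%N)) => [[j' jE]|nj].
    by have [P hP] := h'' j' jE; exists P => j''; rewrite jE => /addIn <-.
  by exists (std_resolution (trivial_module A)) => j' jE; case: nj; exists j'.
apply: (horseshoe_tor (P' := sub_complex sh P') (P'' := quo_complex P Sd')).
- exact: sub_complex_exact.
- move=> x; rewrite -(quo_eps_exact Qd Sd' Sf') QP; split=> -[z zE].
    by exists (eps P' z).
  by have [t tz] := eps_surj P' z; exists t; rewrite /= tz.
- move=> m; have [x /QP[z zE]] := quo_gen_mod Qd P Sd' Ss' m.
  have [t tz] := eps_surj P' z; exists x, t.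
  by rewrite /= tz -zE addrC subrK.
- exact: sub_complex_tor.
exact: quo_complex_tor.
Qed.

Section GsubLift.
Variables (k : fieldType) (A : gradedAlgebra k) (L M : gradedModule A) (S : {pred M}).
Variables (S_submod : submod_closed S) (S_part : forall n x, x \in S -> mpart n x \in S).
Variables (f : {linear L -> M}) (fS : forall x, f x \in S).
Definition to_gsub_fun (x : L) : gsub S_submod S_part := in_gsub S_submod S_part (fS x).
Fact to_gsub_linear : linear to_gsub_fun.
Proof. by move=> a x y; apply: val_inj; rewrite /= linearP. Qed.
HB.instance Definition _ := GRing.isLinear.Build A L (gsub S_submod S_part) _ to_gsub_fun to_gsub_linear.
Definition to_gsub : {linear L -> gsub S_submod S_part} := to_gsub_fun.
End GsubLift.

(** * Base change along a free extension of rank two *)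

Section BaseChange.
Variables (k : fieldType) (A B : gradedAlgebra k) (phi : {rmorphism B -> A}) (w : A).
Hypotheses (phi_part : forall n b, gpart n (phi b) = phi (gpart n b)) (w1 : gpart 1 w = w).
Hypothesis decomp : forall a, exists b0 b1, a = phi b0 + w * phi b1.
Hypothesis uniq : forall b0 b1, phi b0 + w * phi b1 = 0 -> b0 = 0 /\ b1 = 0.

Lemma gaug_w : gaug w = 0.
Proof. by rewrite -w1 gaug_gpart. Qed.

Section FreeBase.
Variable I : choiceType.
Definition base (x : {malg B[I]}) : {malg A[I]} := \sum_(b <- msupp x) phi x@_b *: << b >>.
Lemma baseE x b : (base x)@_b = phi x@_b.
Proof.
rewrite /base raddf_sum /=; have [bx|bNx] := boolP (b \in msupp x); last first.
  rewrite (mcoeff_outdom bNx) rmorph0 big_seq big1 // => c cx.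
  by rewrite mcoeffZ mcoeffU; case: eqP bNx cx => [-> /negP//|_ _ _]; rewrite mulr0.
rewrite (big_fsetD1 b) //= mcoeffZ mcoeffUU mulr1 big_seq big1 ?addr0 // => c.
by rewrite in_fsetD1 mcoeffZ mcoeffU => /andP[/negPf-> _]; rewrite mulr0.
Qed.
Lemma baseD x y : base (x + y) = base x + base y.
Proof. by apply/malgP => b; rewrite mcoeffD !baseE mcoeffD rmorphD. Qed.
Lemma base0 : base 0 = 0.
Proof. by apply/malgP => b; rewrite baseE !mcoeff0 rmorph0. Qed.
Lemma baseB x y : base (x - y) = base x - base y.
Proof. by apply/malgP => b; rewrite mcoeffB !baseE mcoeffB rmorphB. Qed.
Lemma baseZ a x : base (a *: x) = phi a *: base x.
Proof. by apply/malgP => b; rewrite mcoeffZ !baseE mcoeffZ rmorphM. Qed.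
Lemma baseU b : base << b >> = << b >>.
Proof. by apply/malgP => c; rewrite baseE !mcoeffU; case: (b == c); rewrite ?rmorph1 ?rmorph0. Qed.
Lemma base_part (deg : I -> nat) n x :
  mpart (g := freemod A deg) n (base x) = base (mpart (g := freemod B deg) n x).
Proof.
apply/malgP => b; rewrite [LHS]free_partE [RHS]baseE [in RHS]free_partE baseE.
by case: ifP => _; rewrite ?rmorph0 ?phi_part.
Qed.

Lemma base_decomp x : exists x0 x1, x = base x0 + w *: base x1.
Proof.
move: x; apply: malg_ind => [|x y [x0 [x1 ->]] [y0 [y1 ->]]|a b].
- by exists 0, 0; rewrite base0 scaler0 addr0.
- by exists (x0 + y0), (x1 + y1); rewrite !baseD scalerDr addrACA.
have [b0 [b1 ->]] := decomp a; exists (b0 *: << b >>), (b1 *: << b >>).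
by rewrite !baseZ baseU scalerA scalerDl.
Qed.
Lemma base_uniq x0 x1 : base x0 + w *: base x1 = 0 -> x0 = 0 /\ x1 = 0.
Proof.
move=> h; suff E b : x0@_b = 0 /\ x1@_b = 0.
  by split; apply/malgP => b; rewrite mcoeff0; case: (E b).
have := congr1 (mcoeff b) h; rewrite mcoeffD mcoeffZ !baseE mcoeff0; exact: uniq.
Qed.
End FreeBase.

Section BaseMap.
Variables (I J : choiceType) (dI : I -> nat) (dJ : J -> nat).
Variable f : {linear {malg B[J]} -> {malg B[I]}}.
Hypothesis f_deg : forall b, fhom dI (dJ b) (f << b >>).
Definition base_map : {linear freemod A dJ -> freemod A dI} :=
  linext (fun b => base (f << b >>) : freemod A dI).
Lemma base_mapE x : base_map (base x) = base (f x).
Proof.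
move: x; apply: malg_ind => [|x y|a b]; rewrite ?linear0 ?base0 ?linear0 //.
  by rewrite !(baseD, linearD) => -> ->.
by rewrite baseZ baseU !linearZ baseZ /base_map linextU.
Qed.
Lemma base_map_pair x0 x1 : base_map (base x0 + w *: base x1) = base (f x0) + w *: base (f x1).
Proof. by rewrite linearD linearZ !base_mapE. Qed.
Lemma base_map_graded : graded base_map.
Proof.
apply: linear_graded => b; rewrite /base_map linextU [LHS]base_part.
by congr base; exact: (proj1 (@fhomE k B _ _ _ _) (f_deg b)).
Qed.
End BaseMap.

(** Every element is uniquely [base x0 + w *: base x1], and [base_map] acts on both parts by the
    original map, so exactness is inherited componentwise. This is the flatness of [A] over [B]. *)
Lemma base_exact (I J L : choiceType) (dI : I -> nat) (dJ : J -> nat) (dL : L -> nat)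
    (f : {linear {malg B[J]} -> {malg B[I]}}) (g : {linear {malg B[L]} -> {malg B[J]}}) :
  (forall x, f x = 0 <-> exists y, x = g y) ->
  forall x, base_map dI dJ f x = 0 <-> exists y, x = base_map dJ dL g y.
Proof.
move=> fg x; split=> [|[y ->]].
  have [x0 [x1 ->]] := base_decomp x; rewrite base_map_pair => /base_uniq[/fg[y0 ->] /fg[y1 ->]].
  by exists (base y0 + w *: base y1); rewrite base_map_pair.
have [y0 [y1 ->]] := base_decomp y; rewrite !base_map_pair.
rewrite (proj2 (fg (g y0))) ?(proj2 (fg (g y1))) ?base0 ?scaler0 ?addr0 //; by eexists.
Qed.

Hypothesis gaug_phi : forall b, gaug (phi b) = gaug b.

Lemma base_aug (I : choiceType) (x0 x1 : {malg B[I]}) :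
  aug_zero (base x0 + w *: base x1) <-> aug_zero x0.
Proof.
by split=> h b; have := h b; rewrite mcoeffD mcoeffZ !baseE gaugD gaugM gaug_w mul0r addr0 gaug_phi.
Qed.

Lemma base_w_part (I : choiceType) (deg : I -> nat) n (x : {malg B[I]}) :
  mpart (g := freemod A deg) n (w *: base x) =
    if n is m.+1 then w *: base (mpart (g := freemod B deg) m x) else 0.
Proof.
apply/malgP => b; rewrite [LHS]free_partE mcoeffZ baseE.
case: n => [|n]; first by rewrite mcoeff0 sub0n (gpart_mul1 _ _ w1) if_same.
rewrite mcoeffZ baseE [in RHS]free_partE; case: (leqP (deg b) n) => bn.
  by rewrite (leqW bn) subSn // (gpart_mul1 _ _ w1) phi_part.
rewrite rmorph0 mulr0; have -> : (n.+1 - deg b = 0)%N by lia.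
by rewrite (gpart_mul1 _ _ w1) if_same.
Qed.

Lemma base_hom (I : choiceType) (deg : I -> nat) j (x0 x1 : {malg B[I]}) :
  mpart (g := freemod A deg) j (base x0 + w *: base x1) = base x0 + w *: base x1 ->
  fhom deg j x0.
Proof.
rewrite raddfD /= base_w_part base_part => h.
have /base_uniq[/eqP] : base (mpart (g := freemod B deg) j x0 - x0) +
    w *: base ((if j is m.+1 then mpart (g := freemod B deg) m x1 else 0) - x1) = 0.
  rewrite !baseB scalerBr addrACA -opprD -h; apply/eqP; rewrite subr_eq0.
  by case: (j) => [|m] //; rewrite base0 scaler0.
by rewrite subr_eq0 => /eqP hx _; apply/fhomE.
Qed.

(** The part [w *: base x1] has coefficients in [A_+], so it is enough to exhibit [x0] as a boundary
    over [B]. *)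
Lemma base_tor (I J : choiceType) (dI : I -> nat) (dJ : J -> nat)
    (g : {linear {malg B[J]} -> {malg B[I]}}) (cyc : {malg B[I]} -> Prop) j :
  (forall x, fhom dI j x -> cyc x -> exists2 y, fhom dJ j y & aug_zero (x - g y)) ->
  forall x0 x1, mpart (g := freemod A dI) j (base x0 + w *: base x1) = base x0 + w *: base x1 ->
  cyc x0 ->
  exists2 y, mpart (g := freemod A dJ) j y = y &
    aug_zero (base x0 + w *: base x1 - base_map dI dJ g y).
Proof.
move=> h x0 x1 /base_hom hx cx; have [y hy yP] := h x0 hx cx; exists (base y).
  by rewrite base_part; congr base; exact: (proj1 (@fhomE k B _ _ _ _) hy).
by rewrite base_mapE addrAC -baseB base_aug.
Qed.

Section BaseModule.
Variables (M : gradedModule B) (N : gradedModule A) (psi : M -> N).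
Hypotheses (psiD : {morph psi : x y / x + y}) (psiZ : forall b x, psi (b *: x) = phi b *: psi x).
Hypothesis psi_part : forall n x, psi (mpart n x) = mpart n (psi x).
Hypothesis psi_decomp : forall y, exists m0 m1, y = psi m0 + w *: psi m1.
Hypothesis psi_uniq : forall m0 m1, psi m0 + w *: psi m1 = 0 -> m0 = 0 /\ m1 = 0.

(** The hypotheses on [psi] express that [N] is [A \otimes_B M]; the resolution of [M], extended to
    [A], then resolves [N]. *)
Lemma tor_base_change i j : tor_vanishes M i j -> tor_vanishes N i j.
Proof.
move=> [P hP].
have psi0 : psi 0 = 0 by apply: (addrI (psi 0)); rewrite -psiD !addr0.
pose e : {linear freemod A (@deg _ _ _ P 0) -> N} := linext (fun b => psi (eps P << b >>)).
have eE x : e (base x) = psi (eps P x).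
  move: x; apply: malg_ind => [|x y|a b]; rewrite ?base0 ?linear0 ?psi0 //.
    by rewrite !(baseD, linearD) psiD => -> ->.
  by rewrite baseZ baseU !linearZ psiZ /e linextU.
have eE2 x0 x1 : e (base x0 + w *: base x1) = psi (eps P x0) + w *: psi (eps P x1).
  by rewrite linearD linearZ !eE.
have ge : graded e.
  by apply: linear_graded => b; rewrite /e linextU -psi_part eps_deg.
pose C := @ComplexOver k A N _ _ (fun i => base_map (@deg _ _ _ P i) (@deg _ _ _ P i.+1) (diff P i)) e
  (fun i => base_map_graded (@diff_deg _ _ _ P i)) ge
  (fun i => base_exact _ _ (@diff_exact _ _ _ P i)).
apply: (complex_tor (P := C)) => [y|x|x jx cx].
- have [m0 [m1 ->]] := psi_decomp y.
  have [x0 <-] := eps_surj P m0; have [x1 <-] := eps_surj P m1.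
  by exists (base x0 + w *: base x1); rewrite /= eE2.
- split=> [|[y ->]] /=.
    have [x0 [x1 ->]] := base_decomp x; rewrite /= eE2 => /psi_uniq.
    move=> [/(eps_exact (f := P))[y0 ->] /(eps_exact (f := P))[y1 ->]].
    by exists (base y0 + w *: base y1); rewrite base_map_pair.
  have [y0 [y1 ->]] := base_decomp y; rewrite base_map_pair eE2.
  have E z : eps P (diff P 0 z) = 0 by apply/(eps_exact (f := P)); eexists.
  by rewrite !E psi0 scaler0 addr0.
have [x0 [x1 xE]] := base_decomp x; rewrite xE in jx cx *.
apply: (base_tor (cyc := @tor_cycle _ _ _ P i)) => //.
case: i x0 x1 {hP jx x xE} cx => [|i] x0 x1 //=.
by rewrite base_map_pair base_aug.
Qed.
End BaseModule.
End BaseChange.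

Section AugmentationExtension.
Variables (k : fieldType) (A B : gradedAlgebra k) (phi : {rmorphism B -> A}) (w : A).
Hypotheses (phi_part : forall n b, gpart n (phi b) = phi (gpart n b)) (w1 : gpart 1 w = w).
Hypothesis decomp : forall a, exists b0 b1, a = phi b0 + w * phi b1.
Hypothesis uniq : forall b0 b1, phi b0 + w * phi b1 = 0 -> b0 = 0 /\ b1 = 0.
Hypothesis gaug_phi : forall b, gaug (phi b) = gaug b.
Local Notation base := (base phi).

(* A is free over B on 1 and w, so inducing a resolution of k from B to A resolves an extension of k by k(-1). *)
Lemma tor_aug_ext i j : tor_vanishes (trivial_module B) i.+2 j ->
  (forall j', j = (j' + 1)%N -> tor_vanishes (trivial_module A) i.+1 j') ->
  tor_vanishes (trivial_module A) i.+2 j.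
Proof.
move=> [P hP] hk.
pose d n := base_map phi (@deg _ _ _ P n) (@deg _ _ _ P n.+1) (diff P n).
have gd n : graded (d n) by apply: base_map_graded => // b; exact: diff_deg.
have dex n x : d n x = 0 <-> exists y, x = d n.+1 y.
  by apply: (base_exact decomp uniq) => z; exact: diff_exact.
pose e : {linear freemod A (@deg _ _ _ P 0) -> trivial_module A} :=
  linext (fun b => (eps P << b >> : k) : trivial_module A).
have ge : graded e.
  apply: linear_graded => b; rewrite /e linextU.
  exact: (eps_deg (f := P) b).
have eE x0 x1 : e (base x0 + w *: base x1) = (eps P x0 : k).
  have w0 : gaug w = 0 by rewrite -w1 gaug_gpart.
  have wz (z : trivial_module A) : w *: z = 0.
    by rewrite /GRing.scale /= /trivmod_scale w0 mul0r.
  rewrite linearD linearZ /= wz addr0.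
  move: x0; apply: malg_ind => [|x y|a b]; rewrite ?base0 ?linear0 //.
    by rewrite !(baseD, linearD) => -> ->.
  rewrite baseZ baseU !linearZ /= /e linextU.
  exact: (congr1 (fun c => c * (eps P << b >> : k)) (gaug_phi a)).
have es y : exists x, e x = y.
  have [x xy] := eps_surj P (y : trivial_module B).
  by exists (base x + w *: base 0); rewrite eE.
apply: (tor_shift (ge := ge)) => //.
have de y : d 0 y \in ker_pred e.
  have [y0 [y1 ->]] := base_decomp decomp y; rewrite /d base_map_pair unfold_in eE.
  by apply/eqP; apply/(eps_exact (f := P)); eexists.
(* An element [base x0 + w *: base x1] of the kernel of [e] is determined modulo the image [N'] of
   [d 0] by [eps P x1], so the quotient is one copy of [k] in degree 1. The module [N'] itself is
   resolved by the tail of the induced complex. *)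
pose N' := immod (gd 0).
pose e' : {linear freemod A (@deg _ _ _ P 1) -> N'} :=
  @to_gsub _ _ _ _ (im_pred (d 0)) (im_submod (d 0)) (im_part (gd 0)) (d 0)
    (fun x => introT (asboolP (exists y, d 0 x = d 0 y)) (ex_intro _ x erefl)).
have ge' : graded e' by move=> n x; apply: val_inj; exact: gd.
have tN' : tor_vanishes N' i.+1 j.
  pose C := @ComplexOver k A N' _ _ (fun n => d n.+1) e' (fun n => gd n.+1) ge'
    (fun n => dex n.+1).
  apply: (complex_tor (P := C)) => [y|x|x jx cx].
  - by have /asboolP[x xE] := gsub_valP y; exists x; apply: val_inj; rewrite xE.
  - by rewrite -(dex 0); split=> [/(congr1 val)//|h]; exact: val_inj.
  have [x0 [x1 xE]] := base_decomp decomp x; rewrite xE in jx cx *.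
  apply: (base_tor _ _ _ _ _ (cyc := @tor_cycle _ _ _ P i.+2)) => //.
  by move: cx; rewrite /= /d base_map_pair base_aug.
have imE (y : N') : gsub_val _ _ y \in ker_pred e.
  by have /asboolP[x ->] := gsub_valP y; exact: de.
pose iota : {linear N' -> kermod ge} :=
  @to_gsub _ _ _ _ (ker_pred e) (ker_submod e) (ker_part ge) (gsub_val _ _) imE.
apply: (@tor_ext _ _ _ _ 0 1 iota).
- by move=> x y xy; apply: val_inj; exact: (congr1 val xy).
- by move=> n x; rewrite addn0; apply: val_inj.
- move=> n x n1; have /eqP := gsub_valP x.
  have [x0 [x1 xE]] := base_decomp decomp (gsub_val _ _ x).
  rewrite [X in e X]xE eE => /(eps_exact (f := P))[y0 y0E].
  suff [z zE] : exists z, mpart (g := freemod A (@deg _ _ _ P 0)) n (gsub_val _ _ x) = d 0 z.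
    by exists (e' z); apply: val_inj; exact: zE.
  rewrite xE raddfD /= y0E; have [y1 y1E] : exists z, mpart (g := freemod A (@deg _ _ _ P 0)) n (w *: base x1) = d 0 z.
    have E : mpart (g := freemod A (@deg _ _ _ P 0)) n (w *: base x1) =
        if n is m.+1 then w *: base (mpart (g := freemod B (@deg _ _ _ P 0)) m x1) else 0.
      exact: base_w_part.
    rewrite E; case: (n) n1 => [|m] m1; first by exists 0; rewrite linear0.
    have : eps P (mpart (g := freemod B (@deg _ _ _ P 0)) m x1) = 0.
      have gP : graded (eps P : freemod B (@deg _ _ _ P 0) -> trivial_module B).
        by apply: linear_graded => b; exact: eps_deg.
      by rewrite gP; case: (m) m1.
    move=> /(eps_exact (f := P))[y1 ->]; exists (base 0 + w *: base y1).
    by rewrite /d base_map_pair linear0 base0 add0r.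
  exists (mpart (g := freemod A (@deg _ _ _ P 1)) n (base y0 + w *: base 0) + y1).
  by rewrite linearD /= -y1E gd /d base_map_pair linear0 base0 scaler0 addr0.
- by move=> j' jE; rewrite addn0 in jE; rewrite -jE.
exact: hk.
Qed.
End AugmentationExtension.

(** * Tor of the zero module and low Tor of the ground field *)

Lemma tor_zero (k : fieldType) (A : gradedAlgebra k) (M : gradedModule A) i j :
  (forall x : M, x = 0) -> tor_vanishes M i j.
Proof.
elim: i M => [|i IH] M M0.
  have g0 : graded (\0 : freemod A (fun _ : void => 0%N) -> M) by move=> n x; rewrite [RHS]M0.
  by apply: (tor0_gen g0) => // y; exists 0; rewrite [y]M0.
have g0 : graded (\0 : freemod A (fun _ : void => 0%N) -> M) by move=> n x; rewrite [RHS]M0.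
apply: (tor_shift (ge := g0)) => [y|]; first by exists 0; rewrite [y]M0.
apply: IH => x; apply: val_inj; apply/malgP => -[].
Qed.

Section Trivial.
Variables (k : fieldType) (A : gradedAlgebra k).
Definition pt_deg (n : nat) (_ : unit) := n.

Definition aug_map : {linear freemod A (pt_deg 0) -> trivial_module A} :=
  linext (fun _ => (1 : k) : trivial_module A).
Lemma aug_mapE x : aug_map x = (gaug x@_tt : k).
Proof.
move: x; apply: malg_ind => [|x y|a []].
- by rewrite linear0 mcoeff0 gaug0.
- by rewrite linearD mcoeffD gaugD => -> ->.
rewrite linearZ /= /aug_map linextU mcoeffZ mcoeffUU mulr1.
exact: (mulr1 (gaug a)).
Qed.
Lemma aug_map_graded : graded aug_map.
Proof. by apply: linear_graded => b; rewrite /aug_map linextU. Qed.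
Lemma aug_map_surj y : exists x, aug_map x = y.
Proof.
exists ((y : k)%:A *: << tt >>); rewrite aug_mapE mcoeffZ mcoeffUU mulr1.
by apply: (@scale1_inj _ A); rewrite -gpart0E linearZ /= gpart1.
Qed.

Lemma tor0_trivial j : j <> 0%N -> tor_vanishes (trivial_module A) 0 j.
Proof. by move=> j0; apply: (tor0_gen aug_map_graded aug_map_surj) => b /esym. Qed.

(** The hypothesis says that degree one generates [A_+] as a left ideal, so the kernel of the
    augmentation is covered by generators of degree 1. *)
Lemma tor1_trivial j : (forall x : A, gaug x = 0 -> exists2 s : seq (A * A),
    (forall p, p \in s -> gpart 1 p.2 = p.2) & x = \sum_(p <- s) p.1 * p.2) ->
  j <> 1%N -> tor_vanishes (trivial_module A) 1 j.
Proof.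
move=> gen1 j1; apply: (tor_shift (ge := aug_map_graded)); first exact: aug_map_surj.
pose I : choiceType := {c : A | gpart 1 c == c}.
have cI (c : I) : val c *: << tt >> \in ker_pred aug_map.
  rewrite unfold_in aug_mapE mcoeffZ mcoeffUU mulr1; apply/eqP.
  by have /eqP <- := valP c; apply: gaug_gpart.
pose e : {linear freemod A (fun _ : I => 1%N) -> kermod aug_map_graded} :=
  linext (fun c => in_gsub (ker_submod aug_map) (ker_part aug_map_graded) (cI c)).
have ge : graded e.
  apply: linear_graded => c; rewrite /e linextU; apply: val_inj => /=.
  have := mpart_scale (M := freemod A (pt_deg 0)) 1 (val c) (freemodU A (pt_deg 0) tt).
  by move=> ->; rewrite /= subn0 (eqP (valP c)).
apply: (tor0_gen ge) => [y|_]; last exact/nesym.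
have /eqP := gsub_valP y; rewrite aug_mapE => /gen1[s sP yE].
have sI p : p \in s -> gpart 1 p.2 == p.2 by move/sP->.
pose x := \sum_(p <- s) p.1 *: (if insub p.2 is Some c then << c : I >> else 0 : freemod A (fun _ : I => 1%N)).
exists x; apply: val_inj; apply/malgP => -[].
rewrite [in RHS]yE /x linear_sum big_seq [in RHS]big_seq.
rewrite (raddf_sum (gsub_val _ _)) raddf_sum; apply: eq_bigr => p ps /=.
rewrite (insubT (fun c => gpart 1 c == c) (sI p ps)) linearZ /e linextU /=.
by rewrite !mcoeffZ mcoeffUU mulr1.
Qed.
End Trivial.

(** * Milnor K-theory *)

Section Symbols.
Variables (R K : fieldType).
Local Notation A := (milnorK R K).
Implicit Types (x y : K).

(* {x}, with the junk value 0 at x = 0. *)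
Definition sy x : A := if insub x is Some a then symbol R a else 0.

Lemma symbol_sy (a : nonzero K) : symbol R a = sy (val a).
Proof. by rewrite /sy valK. Qed.
Lemma sy_nz x (x0 : x != 0) : sy x = symbol R (nz x0).
Proof. by rewrite symbol_sy. Qed.
Lemma sy0 : sy 0 = 0.
Proof. by rewrite /sy insubF // eqxx. Qed.
Lemma syM x y : x != 0 -> y != 0 -> sy (x * y) = sy x + sy y.
Proof.
move=> x0 y0; have xy0 : x * y != 0 by rewrite mulf_neq0.
by rewrite (sy_nz x0) (sy_nz y0) (sy_nz xy0); apply: symbolM.
Qed.
Lemma sy1 : sy 1 = 0.
Proof. by apply: (addrI (sy 1)); rewrite -syM ?oner_neq0 // mulr1 addr0. Qed.
Lemma syV x : sy x^-1 = - sy x.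
Proof.
have [->|x0] := eqVneq x 0; first by rewrite invr0 sy0 oppr0.
by apply/eqP; rewrite -addr_eq0 -syM ?invr_eq0 // mulVf // sy1.
Qed.
Lemma syX x n : x != 0 -> sy (x ^+ n) = sy x *+ n.
Proof.
by move=> x0; elim: n => [|n IH]; rewrite ?sy1 // exprS mulrS syM ?IH // expf_neq0.
Qed.
Lemma sy_steinberg x : sy x * sy (1 - x) = 0.
Proof.
have [->|x0] := eqVneq x 0; first by rewrite sy0 mul0r.
have [->|x1] := eqVneq x 1; first by rewrite sy1 mul0r.
have x1' : 1 - x != 0 by rewrite subr_eq0 eq_sym.
by rewrite (sy_nz x0) (sy_nz x1') symbol_steinberg //= addrC subrK.
Qed.
Lemma sy_steinbergD x y : x + y = 1 -> sy x * sy y = 0.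
Proof. by move=> xy; have := sy_steinberg x; rewrite -xy addrAC subrr add0r. Qed.
Lemma sy_mulN x : sy x * sy (- x) = 0.
Proof.
have [->|x0] := eqVneq x 0; first by rewrite sy0 mul0r.
have Nx0 : - x != 0 by rewrite oppr_eq0.
by rewrite (sy_nz x0) (sy_nz Nx0) symbolN.
Qed.
Lemma syC x y : sy x * sy y = - (sy y * sy x).
Proof.
have [->|x0] := eqVneq x 0; first by rewrite sy0 mul0r mulr0 oppr0.
have [->|y0] := eqVneq y 0; first by rewrite sy0 mul0r mulr0 oppr0.
by rewrite (sy_nz x0) (sy_nz y0) symbolC.
Qed.
Lemma syN1 : sy (- 1) = - sy (- 1).
Proof. by rewrite -syV invrN invr1. Qed.
Lemma syN x : x != 0 -> sy (- x) = sy (- 1) + sy x.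
Proof. by move=> x0; rewrite -syM ?mulN1r // oppr_eq0 oner_eq0. Qed.
(** Expand [{x, -x} = 0] by [{-x} = {-1} + {x}]; the sign is absorbed by [{-1} = - {-1}]. *)
Lemma sy_sq x : sy x * sy x = sy x * sy (- 1).
Proof.
have [->|x0] := eqVneq x 0; first by rewrite sy0 !mul0r.
apply/eqP; rewrite -subr_eq0 -mulrBr [X in _ - X]syN1 opprK addrC -syN //.
by rewrite sy_mulN.
Qed.
Lemma sy_hom x : homogeneous 1 (sy x).
Proof.
rewrite /homogeneous; have [->|x0] := eqVneq x 0; first by rewrite sy0 linear0.
have := gpart_symbols R 1 [:: nz x0]; rewrite big_seq1 /= => h.
by rewrite (sy_nz x0).
Qed.

Lemma milnor_sy_ind (P : A -> Prop) :
  P 1 -> (forall u v, P u -> P v -> P (u + v)) -> (forall c u, P u -> P (c *: u)) ->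
  (forall a u, a != 0 -> P u -> P (sy a * u)) -> forall u, P u.
Proof.
move=> P1 PD PZ Ps; apply: milnor_ind => //; first by rewrite -(scale0r 1); apply: PZ.
elim=> [|a s IH]; first by rewrite big_nil.
by rewrite big_cons symbol_sy; apply: Ps => //; exact: valP a.
Qed.

Lemma milnor_gen1 (x : A) : gaug x = 0 -> exists2 s : seq (A * A),
  (forall p, p \in s -> gpart 1 p.2 = p.2) & x = \sum_(p <- s) p.1 * p.2.
Proof.
(* The constant term is carried along, so that the claim makes sense for every [x] and induction
   applies. *)
suff [s sP xE] : exists2 s : seq (A * A),
    (forall p, p \in s -> gpart 1 p.2 = p.2) & x = (gaug x)%:A + \sum_(p <- s) p.1 * p.2.
  by move=> x0; exists s; rewrite // {1}xE x0 scale0r add0r.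
elim/milnor_sy_ind: x => [|x y [s sP xE] [t tP yE]|c x [s sP xE]|a x a0 [s sP xE]].
- by exists [::]; rewrite // big_nil addr0 gaug1 scale1r.
- exists (s ++ t) => [p|]; first by rewrite mem_cat => /orP[/sP|/tP].
  by rewrite big_cat /= gaugD scalerDl addrACA -xE -yE.
- exists [seq (c *: p.1, p.2) | p <- s] => [p /mapP[q /sP qP ->]//|].
  have -> : gaug (c *: x) = c * gaug x.
    by apply: (@scale1_inj _ A); rewrite -scalerA -!gpart0E linearZ.
  rewrite big_map {1}xE scalerDr scalerA scaler_sumr; congr (_ + _).
  by apply: eq_bigr => p _ /=; rewrite scalerAl.
(* The constant term of [x] becomes a multiple of the new generator [sy a]. *)
exists ((gaug x *: 1, sy a) :: [seq (sy a * p.1, p.2) | p <- s]) => [p|].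
  by rewrite inE => /orP[/eqP->|/mapP[q /sP qP ->]]//; exact: sy_hom.
rewrite big_cons big_map gaugM -(sy_hom a) gaug_gpart // mul0r scale0r add0r /=.
rewrite sy_hom {1}xE mulrDr -scalerAr mulr1 -scalerAl mul1r mulr_sumr; congr (_ + _).
by apply: eq_bigr => p _; rewrite mulrA.
Qed.
End Symbols.

(** * Universal property and functoriality of the Milnor ring *)

Section Universal.
Variables (R K : fieldType) (S : nzRingType) (rho : {rmorphism R -> S}) (f : K -> S).
Hypothesis rho_central : forall a x, GRing.comm (rho a) x.
Hypothesis fM : forall x y, x != 0 -> y != 0 -> f (x * y) = f x + f y.
Hypothesis f_steinberg : forall x, x != 0 -> x != 1 -> f x * f (1 - x) = 0.
Local Notation A := (milnorK R K).

Definition word_map (w : {fmonom nonzero K}) : S := \prod_(a <- fmonom_val w) f (val a).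
Fact word_map_monoid : mmorphism word_map.
Proof.
split=> [u v|]; last by rewrite /word_map fm1 big_nil.
by rewrite /word_map /mmul /= fmmulE /= big_cat.
Qed.
HB.instance Definition _ := isMultiplicative.Build _ S word_map word_map_monoid.
Local Notation mw := (mmap rho word_map).

Lemma mwM u v : mw (u * v) = mw u * mw v.
Proof. by apply: (commr_mmap_is_multiplicative (f := rho) _).1 => *; apply: rho_central. Qed.
Lemma mw_sym a : mw (Defs.fsym R a) = f (val a).
Proof. by rewrite mmapU /= rmorph1 mul1r /word_map fmuE big_seq1. Qed.
Lemma mw_span t : milnor_span t -> mw t = 0.
Proof.
elim=> [|u r v x rr _ IH]; first exact: mmap0.
rewrite mmapD IH addr0 !mwM; suff -> : mw r = 0 by rewrite mulr0 mul0r.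
case: rr => [a b c cE|a b ab].
  by rewrite !mmapB !mw_sym cE fM ?(valP a) ?(valP b) // -addrA -opprD subrr.
rewrite mwM !mw_sym.
have -> : val b = 1 - val a by rewrite -ab addrC addKr.
apply: f_steinberg; first exact: valP a.
by apply/eqP => a1; have /eqP := valP b; apply; apply: (addrI (val a)); rewrite ab addr0.
Qed.

Definition milnor_map_fun (x : A) : S := mw (generic_quotient.repr (x : milnor R K)).
Lemma milnor_map_mpi t : milnor_map_fun (Defs.mpi t) = mw t.
Proof.
apply/subr0_eq; rewrite -mmapB; apply: mw_span; apply/mpiP; exact: mpi_repr.
Qed.
Fact milnor_map_zmod : zmod_morphism milnor_map_fun.
Proof.
move=> x y; have [u ->] := mpi_surj x; have [v ->] := mpi_surj y.
by rewrite -mpiB !milnor_map_mpi mmapB.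
Qed.
HB.instance Definition _ := GRing.isZmodMorphism.Build A S milnor_map_fun milnor_map_zmod.
Fact milnor_map_monoid : monoid_morphism milnor_map_fun.
Proof.
split; first by rewrite (milnor_map_mpi 1) mmap1.
move=> x y; have [u ->] := mpi_surj x; have [v ->] := mpi_surj y.
by rewrite -mpi_mul !milnor_map_mpi mwM.
Qed.
HB.instance Definition _ := GRing.isMonoidMorphism.Build A S milnor_map_fun milnor_map_monoid.
(** The target may be noncommutative as long as the coefficients are central: below it will be a
    ring of matrices over another Milnor ring. *)
Definition milnor_map : {rmorphism A -> S} := milnor_map_fun.
Lemma milnor_map_sy x : x != 0 -> milnor_map (sy R x) = f x.
Proof. by move=> x0; rewrite (sy_nz R x0) -[LHS]/(milnor_map_fun _) milnor_map_mpi mw_sym. Qed.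
Lemma milnor_mapZ a x : milnor_map (a *: x) = rho a * milnor_map x.
Proof.
have [t ->] := mpi_surj x.
by rewrite -mpi_scale -[LHS]/(milnor_map_fun _) milnor_map_mpi mmapZ -milnor_map_mpi.
Qed.
End Universal.

Section Functor.
Variables (R F K : fieldType) (i : {rmorphism F -> K}).
Local Notation fi := (fun x => sy R (i x)).
Fact in_alg_central (a : R) (x : milnorK R K) : GRing.comm (in_alg (milnorK R K) a) x.
Proof. by rewrite /GRing.comm /= -scalerAl -scalerAr mul1r mulr1. Qed.
Fact functor_fM x y : x != 0 -> y != 0 -> fi (x * y) = fi x + fi y.
Proof. by move=> x0 y0 /=; rewrite rmorphM syM // fmorph_eq0. Qed.
Fact functor_steinberg x : x != 0 -> x != 1 -> fi x * fi (1 - x) = 0.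
Proof. by move=> _ _ /=; rewrite rmorphB rmorph1 sy_steinberg. Qed.
Definition milnor_functor : {rmorphism milnorK R F -> milnorK R K} :=
  milnor_map in_alg_central functor_fM functor_steinberg.
Lemma milnor_functor_sy x : milnor_functor (sy R x) = sy R (i x).
Proof.
have [->|x0] := eqVneq x 0; last exact: milnor_map_sy.
by rewrite rmorph0 !sy0 rmorph0.
Qed.
End Functor.

Lemma milnor_hom_graded (R F K : fieldType) (g : {rmorphism milnorK R F -> milnorK R K}) :
  (forall a x, g (a *: x) = a *: g x) -> (forall x, x != 0 -> gpart 1 (g (sy R x)) = g (sy R x)) ->
  forall n x, gpart n (g x) = g (gpart n x).
Proof.
move=> gZ g1 n x; elim/milnor_sy_ind: x n => [n|x y hx hy n|a x hx n|a x a0 hx n].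
- have := gpartK n 0 (1 : milnorK R F); have := gpartK n 0 (1 : milnorK R K).
  by rewrite !gpart1 rmorph1 => -> ->; case: eqP; rewrite ?rmorph0 ?rmorph1.
- by rewrite rmorphD !linearD /= rmorphD hx hy.
- by rewrite gZ !linearZ /= gZ hx.
rewrite rmorphM (gpart_mul1 _ _ (g1 a a0)) (gpart_mul1 _ _ (sy_hom R a)).
by case: n => [|n]; rewrite ?rmorph0 // rmorphM hx.
Qed.

Lemma hom_gaug R F K (g : {rmorphism milnorK R F -> milnorK R K}) :
  (forall a x, g (a *: x) = a *: g x) -> (forall n x, gpart n (g x) = g (gpart n x)) ->
  forall x, gaug (g x) = gaug x.
Proof.
move=> gZ gp x; apply: (@scale1_inj _ (milnorK R K)).
by rewrite -gpart0E gp gpart0E gZ rmorph1.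
Qed.

(** * Coefficients modulo a prime *)

Section ModL.
Variables (l : nat) (l_pr : prime l) (K : fieldType).
Local Notation A := (milnorK 'F_l K).
Local Notation sy := (@sy 'F_l K).

Lemma milnor_mulrl (x : A) : x *+ l = 0.
Proof. by rewrite -mulr_natr -scaler_nat -scalerAr mulr1 (pchar_Fp_0 l_pr) scale0r. Qed.
Lemma milnor_scaleE (a : 'F_l) (x : A) : a *: x = x *+ a.
Proof. by rewrite -{1}[a]natr_Zp scaler_nat. Qed.
Lemma syXl x : sy (x ^+ l) = 0.
Proof.
have [->|x0] := eqVneq x 0; last by rewrite syX // milnor_mulrl.
by rewrite expr0n gtn_eqF ?prime_gt0 // sy0.
Qed.
Lemma sy_mulXl x y : y != 0 -> sy (x * y ^+ l) = sy x.
Proof.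
have [->|x0] := eqVneq x 0; first by rewrite mul0r.
by move=> y0; rewrite syM ?expf_neq0 // syXl addr0.
Qed.

(** Scalars of ['F_l] are integers, so a linear combination of symbols is the symbol of a product of
    powers. *)
Lemma deg1_sy (c : A) : homogeneous 1 c -> exists2 a, a != 0 & c = sy a.
Proof.
move=> <-; elim/milnor_sy_ind: c => [|x y [a a0 xE] [b b0 yE]|a x [b b0 xE]|a x a0 _].
- exists 1; first exact: oner_neq0.
  by have := gpartK 1 0 (1 : A); rewrite gpart1 sy1.
- by exists (a * b); rewrite ?mulf_neq0 // linearD /= xE yE syM.
- exists (b ^+ a); first exact: expf_neq0.
  by rewrite linearZ /= xE milnor_scaleE syX.
rewrite (gpart_mul1 _ _ (sy_hom _ _)) gpart0E -scalerAr mulr1 milnor_scaleE -syX //.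
by exists (a ^+ gaug x) => //; exact: expf_neq0.
Qed.

Lemma mulrl2 (x : A) : odd l -> x = - x -> x = 0.
Proof.
move=> ol /eqP; rewrite -addr_eq0 -mulr2n => /eqP x2.
have lE : l = (1 + 2 * l./2)%N by rewrite mul2n -{1}(odd_double_half l) ol.
have : x *+ (1 + 2 * l./2) = 0 by rewrite -lE milnor_mulrl.
by rewrite mulrnDr mulrnA x2 mul0rn addr0.
Qed.

Lemma sy_sq_odd x : odd l -> sy x * sy x = 0.
Proof. by move=> ol; apply: mulrl2 => //; exact: syC. Qed.
End ModL.

(** * Tor of ideals generated in degree one *)

Section PrincipalIdeals.
Variables (R K : fieldType).
Local Notation A := (milnorK R K).
Implicit Types c : A.

Lemma deg1_anticomm c : homogeneous 1 c -> forall a, sy R a * c = - (c * sy R a).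
Proof.
move=> hc a; have [->|a0] := eqVneq a 0; first by rewrite sy0 mul0r mulr0 oppr0.
by rewrite (sy_nz R a0) symbol_deg1.
Qed.

Lemma mul_deg1_l c : homogeneous 1 c -> forall x, exists y, c * x = y * c.
Proof.
move=> hc; apply: milnor_sy_ind => [|x y [u hu] [v hv]|a x [u hu]|a x _ [u hu]].
- by exists 1; rewrite mulr1 mul1r.
- by exists (u + v); rewrite mulrDl mulrDr hu hv.
- by exists (a *: u); rewrite -scalerAl -scalerAr hu.
exists (- (sy R a * u)).
by rewrite mulrA -[c * _]opprK -deg1_anticomm // !mulNr -!mulrA hu.
Qed.

Section Pid.
Variables (c : A) (hc : homogeneous 1 c).
Lemma pidP (x : principal_ideal hc) : exists y, (val x : A) = c * y.
Proof. by have /asboolP := valP x. Qed.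
Definition in_pid (x : A) (xc : exists y, x = c * y) : principal_ideal hc :=
  exist (fun x : A^o => x \in deg1_ideal c) x (introT (asboolP (exists y, x = c * y)) xc).
Lemma in_pidE (x : A) (xc : exists y, x = c * y) : (val (in_pid xc) : A) = x.
Proof. by []. Qed.
Lemma pid_valZ a (x : principal_ideal hc) : (val (a *: x) : A) = a * (val x : A).
Proof.
refine (_ : val (a *: x : principal_ideal hc) = a *: (val x : A^o)).
exact: linearZ.
Qed.
Lemma pid_valD (x y : principal_ideal hc) : (val (x + y) : A) = (val x : A) + (val y : A).
Proof. by []. Qed.
Lemma pid_val_part n (x : principal_ideal hc) : (val (mpart n x) : A) = gpart n (val x : A).
Proof. by []. Qed.
Definition pid_gen := in_pid (ex_intro (fun y => c = c * y) 1 (esym (mulr1 c))).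

Definition cyc_map : {linear freemod A (pt_deg 1) -> principal_ideal hc} := linext (fun _ => pid_gen).
Lemma cyc_mapE x : (val (cyc_map x) : A) = x@_tt * c.
Proof.
move: x; apply: malg_ind => [|x y|a []].
- by rewrite linear0 mcoeff0 mul0r.
- by rewrite linearD mcoeffD mulrDl => <- <-.
by rewrite linearZ /cyc_map linextU mcoeffZ mcoeffUU mulr1.
Qed.
Lemma cyc_map_graded : graded cyc_map.
Proof. by apply: linear_graded => b; rewrite /cyc_map linextU; apply: val_inj; exact: hc. Qed.
Lemma cyc_map_surj y : exists x, cyc_map x = y.
Proof.
have [u yE] := pidP y; have [v uv] := mul_deg1_l hc u; exists (v *: << tt >>).
by apply: val_inj; rewrite cyc_mapE mcoeffZ mcoeffUU mulr1 [RHS]yE.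
Qed.

Lemma tor0_pid j : j <> 1%N -> tor_vanishes (principal_ideal hc) 0 j.
Proof. by move=> j1; apply: (tor0_gen cyc_map_graded cyc_map_surj) => b /esym. Qed.
Lemma pid_part0 (x : principal_ideal hc) : mpart 0 x = 0.
Proof.
apply: val_inj; have [y yE] := pidP x.
have -> : val (mpart 0 x) = gpart 0 (val x : A) by [].
by rewrite yE gpart_mul1.
Qed.
End Pid.

Section PidInto.
Variables (c : A) (hc : homogeneous 1 c) (n : nat).
Definition pid_into_fun (x : principal_ideal hc) : freemod A (pt_deg n) := (val x : A) *: << tt >>.
Fact pid_into_linear : linear pid_into_fun.
Proof. by move=> a x y; rewrite /pid_into_fun /= scalerDl scalerA. Qed.
HB.instance Definition _ := GRing.isLinear.Build A (principal_ideal hc) (freemod A (pt_deg n)) _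
  pid_into_fun pid_into_linear.
Definition pid_into : {linear principal_ideal hc -> freemod A (pt_deg n)} := pid_into_fun.
Lemma pid_intoE x : (pid_into x)@_tt = val x.
Proof. by rewrite mcoeffZ mcoeffUU mulr1. Qed.
Lemma pid_into_part m x : mpart (m + n) (pid_into x) = pid_into (mpart m x).
Proof.
apply/malgP => -[]; rewrite [LHS]free_partE leq_addl addnK [RHS]pid_intoE pid_val_part.
by congr (gpart m _); exact: pid_intoE.
Qed.
End PidInto.

(** The kernel of the cover of [(c)] by a free module of rank one is the annihilator of [c], shifted
    by one. It contains the shifted ideal [(c')], with a quotient concentrated in degree [d], and
    [tor_ext] applies. *)
Lemma pid_tor c c' (hc : homogeneous 1 c) (hc' : homogeneous 1 c') d i j : c' * c = 0 ->
  (forall n z, n.+1 <> d -> gpart n z * c = 0 -> exists y, gpart n z = c' * y) ->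
  (forall j', j = j'.+1 -> tor_vanishes (principal_ideal hc') i j') ->
  (forall j', j = (j' + d)%N -> tor_vanishes (trivial_module A) i j') ->
  tor_vanishes (principal_ideal hc) i.+1 j.
Proof.
move=> cc ann h1 h2; apply: (tor_shift (ge := cyc_map_graded hc)); first exact: cyc_map_surj.
have kerE x : x \in ker_pred (cyc_map hc) <-> x@_tt * c = 0.
  rewrite unfold_in -cyc_mapE; split=> [/eqP->//|h].
  by apply/eqP; apply: val_inj; rewrite h.
have f_ker (x : principal_ideal hc') : pid_into hc' 1 x \in ker_pred (cyc_map hc).
  apply/kerE; rewrite pid_intoE; have [y ->] := pidP x.
  by have [z zE] := mul_deg1 hc y; rewrite -mulrA zE mulrA cc mul0r.
pose iota : {linear principal_ideal hc' -> kermod (cyc_map_graded hc)} :=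
  to_gsub (ker_submod (cyc_map hc)) (ker_part (cyc_map_graded hc)) f_ker.
apply: (@tor_ext _ _ _ _ 1 d iota) => //.
- move=> x y xy; apply: val_inj; rewrite -!(pid_intoE 1).
  by rewrite -[pid_into _ _ x]/(val (iota x)) xy.
- by move=> n x; apply: val_inj; exact: pid_into_part.
- move=> n x nd; have := gsub_valP x; set z := gsub_val _ _ x.
  case: n nd => [|n] nd zk.
    exists 0; rewrite raddf0; apply: val_inj; apply/malgP => -[].
    by transitivity ((mpart (g := freemod A (pt_deg 1)) 0 z)@_tt); rewrite // [LHS]free_partE mcoeff0.
  have [||y yE] := ann n (z@_tt); first by [].
    have := proj1 (kerE _) (ker_part (cyc_map_graded hc) n.+1 zk).
    by rewrite [X in X * _](free_partE (pt_deg 1) n.+1 z tt) subn1.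
  exists (in_pid hc' (ex_intro _ y yE)); apply: val_inj; apply/malgP => -[].
  transitivity ((mpart (g := freemod A (pt_deg 1)) n.+1 z)@_tt); first by [].
  by rewrite [LHS]free_partE subn1; apply/esym; exact: pid_intoE.
by move=> j'; rewrite addn1; exact: h1.
Qed.

(** The same shift for [k]: the augmentation ideal is an extension of copies of [k] in degree 1 by
    [(c)]. *)
Lemma aug_pid_tor c (hc : homogeneous 1 c) i j :
  (forall n z, n <> 1%N -> gaug z = 0 -> exists y, gpart n z = c * y) ->
  tor_vanishes (principal_ideal hc) i j ->
  (forall j', j = j'.+1 -> tor_vanishes (trivial_module A) i j') ->
  tor_vanishes (trivial_module A) i.+1 j.
Proof.
move=> gen1 h1 h2; apply: (tor_shift (ge := @aug_map_graded _ A)); first exact: aug_map_surj.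
have kerE x : x \in ker_pred (aug_map A) <-> gaug x@_tt = 0.
  by rewrite unfold_in aug_mapE; split=> [/eqP|/eqP].
have f_ker (x : principal_ideal hc) : pid_into hc 0 x \in ker_pred (aug_map A).
  apply/kerE; rewrite pid_intoE; have [y ->] := pidP x.
  by rewrite gaugM -hc gaug_gpart // mul0r.
pose iota : {linear principal_ideal hc -> kermod (@aug_map_graded _ A)} :=
  to_gsub (ker_submod (aug_map A)) (ker_part (@aug_map_graded _ A)) f_ker.
apply: (@tor_ext _ _ _ _ 0 1 iota) => //.
- move=> x y xy; apply: val_inj; rewrite -!(pid_intoE 0).
  by rewrite -[pid_into _ _ x]/(val (iota x)) xy.
- by move=> n x; apply: val_inj; exact: pid_into_part.
- move=> n x nd; have := gsub_valP x; set z := gsub_val _ _ x => /kerE z0.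
  have [y yE] := gen1 n _ nd z0.
  exists (in_pid hc (ex_intro _ y yE)); apply: val_inj; apply/malgP => -[].
  transitivity ((mpart (g := freemod A (pt_deg 0)) n z)@_tt); first by [].
  by rewrite [LHS]free_partE /= subn0; apply/esym; exact: pid_intoE.
- by move=> j'; rewrite addn0 => <-.
by move=> j'; rewrite addn1; exact: h2.
Qed.

Lemma pid0_tor (hc : homogeneous (A := A) 1 0) i j : tor_vanishes (principal_ideal hc) i j.
Proof.
apply: tor_zero => x; apply: val_inj; have [y ->] := pidP x.
by rewrite mul0r.
Qed.

Lemma koszul_pid (ka : koszul_algebra A) c (hc : homogeneous 1 c) :
  (forall i j, j <> i.+1 -> tor_vanishes (principal_ideal hc) i j) -> koszul_module (principal_ideal hc).
Proof. by move=> h; split=> // x; exact: pid_part0. Qed.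
End PrincipalIdeals.

(** * A Koszulity criterion, and second Milnor groups of dimension at most one *)

Section Criterion.
Variables (R K : fieldType).
Local Notation A := (milnorK R K).

Definition spans_above1 (y : A) := forall n z, (1 < n)%N -> exists u, gpart n z = y * u.

(** Induction on [i], simultaneously for [k] and for all ideals. [A_+ / (x)] is concentrated in
    degree 1, and the shifted annihilator of [c] modulo the shifted [(y)] in degree 2, so each shift
    keeps the distance of [j] from the respective diagonal. *)
Lemma koszul_criterion :
  (exists2 x : A, homogeneous 1 x & spans_above1 x) ->
  (forall c : A, homogeneous 1 c -> c <> 0 -> exists2 y, homogeneous 1 y & y * c = 0 /\
     forall n z, (1 < n)%N -> gpart n z * c = 0 -> exists u, gpart n z = y * u) ->
  koszul_algebra A /\ forall (c : A) (hc : homogeneous 1 c), koszul_module (principal_ideal hc).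
Proof.
move=> [x hx xP] annP.
suff T i : (forall j, j <> i -> tor_vanishes (trivial_module A) i j) /\
    forall c (hc : homogeneous (A := A) 1 c) j, j <> i.+1 -> tor_vanishes (principal_ideal hc) i j.
  have ka : koszul_algebra A by move=> i j /nesym ij; apply: (T i).1.
  by split=> // c hc; apply: koszul_pid => // i j ij; apply: (T i).2.
elim: i => [|i [IHk IHc]].
  split=> [j j0|c hc j j1]; [exact: tor0_trivial|exact: tor0_pid].
split=> [j ji|c hc j ji].
  apply: (aug_pid_tor (hc := hx)) => [[|[|n]] // z _ z0||j' jE].
  - by exists 0; rewrite gpart0E z0 scale0r mulr0.
  - exact: xP.
  - by apply: IHc => E; apply: ji.
  by apply: IHk => E; apply: ji; rewrite jE E.
have [c0|c0] := pselect (c = 0); first by move: hc; rewrite c0 => hc; exact: pid0_tor.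
have [y hy [yc yP]] := annP c hc c0.
apply: (pid_tor hc (hc' := hy) (d := 2)) => // [[|[|n]] // z _ h|j' jE|j' jE].
(* In degree 0 the annihilator of [c] is zero, because [c] is not. *)
- exists 0; rewrite mulr0 gpart0E; suff -> : gaug z = 0 by rewrite scale0r.
  move: h; rewrite gpart0E -scalerAl mul1r => /eqP; rewrite scaler_eq0.
  by case/orP => /eqP.
- exact: yP h.
- by apply: IHc => E; apply: ji; rewrite jE E.
by apply: IHk => E; apply: ji; rewrite jE E addn2.
Qed.
End Criterion.

Section OneDimensional.
Variables (l : nat) (l_pr : prime l) (K : fieldType).
Local Notation A := (milnorK 'F_l K).
Local Notation sy := (@sy 'F_l K).

Lemma koszul_symbols0 : (forall a b, sy a * sy b = 0) ->
  koszul_algebra A /\ forall (c : A) (hc : homogeneous 1 c), koszul_module (principal_ideal hc).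
Proof.
move=> s0; have A0 n (z : A) : (1 < n)%N -> gpart n z = 0.
  elim/milnor_sy_ind: z n => [n n1|x y hx hy n n1|a x hx n n1|a x _ hx [//|n] n1].
  - by rewrite -(@gpart1 _ A) gpartK gtn_eqF // (ltn_trans _ n1).
  - by rewrite linearD /= hx // hy // addr0.
  - by rewrite linearZ /= hx // scaler0.
  rewrite (gpart_mul1 _ _ (sy_hom _ _)); case: n n1 => [//|[_|n _]]; last by rewrite hx // mulr0.
  have [|b _ ->] := deg1_sy (c := gpart 1 x); last exact: s0.
  by rewrite /homogeneous gpartK.
apply: koszul_criterion => [|c _ _]; exists 0; rewrite ?mul0r; try exact: linear0.
  by move=> n z n1; exists 0; rewrite mul0r A0.
by split=> // n z n1 _; exists 0; rewrite mul0r A0.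
Qed.

Hypothesis dim1 : forall a b c d, sy a * sy b <> 0 -> exists m, sy c * sy d = sy a * sy b *+ m.

Section Form.
Hypothesis nondeg : forall x, (exists a b, sy a * sy b <> 0) ->
  exists2 y, sy y * sy x = 0 & exists b, sy y * sy b <> 0.

Lemma koszul_onedim :
  koszul_algebra A /\ forall (c : A) (hc : homogeneous 1 c), koszul_module (principal_ideal hc).
Proof.
have [s0|/existsNP[a0 /existsNP[b0 ab0]]] := pselect (forall a b, sy a * sy b = 0).
  exact: koszul_symbols0.
have ex : exists a b, sy a * sy b <> 0 by exists a0, b0.
(* [A_3 = 0]: take [y] killing [a] with [{y, d}] nonzero; then [{b, c}] is a multiple of
   [{y, d}]. *)
have triple a b c : sy a * (sy b * sy c) = 0.
  have [y ya [d yd]] := nondeg a ex; have [m ->] := dim1 b c yd.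
  by rewrite mulrnAr mulrA syC ya oppr0 mul0r mul0rn.
(* As soon as [{y, b}] is nonzero, every element of [A_2] is some [{y, e}]. So [(y)] is everything
   in degrees above 1, and such ideals serve for both conditions of the criterion. *)
have span y b : y != 0 -> sy y * sy b <> 0 -> forall z : A,
    (exists2 e, e != 0 & gpart 2 z = sy y * sy e) /\ forall n, (2 < n)%N -> gpart n z = 0.
  move=> y0 yb; have b0' : b != 0 by apply/eqP => b00; apply: yb; rewrite b00 sy0 mulr0.
  elim/milnor_sy_ind => [|x z [[e e0 xE] x3] [[f f0 zE] z3]|c x [[e e0 xE] x3]|a x _ [[e e0 xE] x3]].
  - have E n : (0 < n)%N -> gpart n (1 : A) = 0.
      by move=> n0; rewrite -(@gpart1 _ A) gpartK gtn_eqF.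
    split=> [|n n2]; last by rewrite E // (ltn_trans _ n2).
    by exists 1; rewrite ?oner_neq0 // sy1 mulr0 E.
  - split=> [|n n2]; last by rewrite linearD /= x3 // z3 // addr0.
    by exists (e * f); rewrite ?mulf_neq0 // linearD /= xE zE syM // mulrDr.
  - split=> [|n n2]; last by rewrite linearZ /= x3 // scaler0.
    exists (e ^+ c); first exact: expf_neq0.
    by rewrite linearZ /= xE milnor_scaleE syX // mulrnAr.
  split=> [|[//|[//|[//|n]]] _]; rewrite (gpart_mul1 _ _ (sy_hom _ _)).
    have [|d _ ->] := deg1_sy (c := gpart 1 x); first by rewrite /homogeneous gpartK.
    have [m ->] := dim1 a d yb; exists (b ^+ m); first exact: expf_neq0.
    by rewrite syX // mulrnAr.
  case: n => [|n]; first by rewrite xE triple.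
  by rewrite x3 // mulr0.
have good y b : y != 0 -> sy y * sy b <> 0 -> spans_above1 (sy y).
  move=> y0 yb [//|[//|n]] z _; have [[e _ h2] h3] := span y b y0 yb z.
  case: n => [|n]; first by exists (sy e).
  by exists 0; rewrite mulr0 h3.
have ne0 y b : sy y * sy b <> 0 -> y != 0.
  by move=> yb; apply/eqP => y0; apply: yb; rewrite y0 sy0 mul0r.
apply: koszul_criterion; first by exists (sy a0); [exact: sy_hom|exact: good (ne0 _ _ ab0) ab0].
move=> c /deg1_sy[a _ ->] _; have [y ya [b yb]] := nondeg a ex.
exists (sy y); first exact: sy_hom.
by split=> // n z n1 _; exact: good (ne0 _ _ yb) yb n z n1.
Qed.
End Form.

(** If [a] kills all symbols, it is killed by the entry [c] of a nonzero symbol; if [{a, a} = 0],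
    [a] itself works. There remains [l = 2] with [{a, a}] nonzero, and [{a, a} = {a, -1}] reduces
    this case to a question about -1. *)
Lemma nondeg_of_neg1 :
  (l = 2%N -> sy (- 1) * sy (- 1) <> 0 -> exists2 e, sy e * sy (- 1) = 0 & exists b, sy e * sy b <> 0) ->
  forall x, (exists a b, sy a * sy b <> 0) -> exists2 y, sy y * sy x = 0 & exists b, sy y * sy b <> 0.
Proof.
move=> H4 a [c [d cd]].
have [[b ab]|ab] := pselect (exists b, sy a * sy b <> 0); last first.
  have ac : sy a * sy c = 0 by apply: contrapT => h; apply: ab; exists c.
  by exists c; [rewrite syC ac oppr0|exists d].
have [aa|aa] := pselect (sy a * sy a = 0); first by exists a => //; exists b.
have ol : ~~ odd l by apply/negP => ol; apply: aa; exact: sy_sq_odd.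
have l2 : l = 2%N by case: (even_prime l_pr) ol => // ->.
have a0 : a != 0 by apply/eqP => a0; apply: aa; rewrite a0 sy0 mul0r.
(* [A_2] is the line over ['F_2] spanned by [{a, a}], so it has a single nonzero element. *)
have val2 e : sy e * sy a <> 0 -> sy e * sy a = sy a * sy a.
  move=> ea; have [m mE] := dim1 e a aa.
  move: ea; rewrite mE -(odd_double_half m) mulrnDr -mul2n mulrnA.
  have -> : sy a * sy a *+ 2 = 0.
    by rewrite -[RHS](milnor_mulrl l_pr (sy a * sy a)); congr (_ *+ _).
  by rewrite mul0rn addr0; case: (odd m).
have aN : sy a * sy (- 1) = sy a * sy a by rewrite sy_sq.
have Na : sy (- 1) * sy a = sy a * sy a.
  by apply: val2; rewrite syC aN => /eqP; rewrite oppr_eq0 => /eqP.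
have [e eN [b' eb]] : exists2 e, sy e * sy (- 1) = 0 & exists b, sy e * sy b <> 0.
  have [NN|NN] := pselect (sy (- 1) * sy (- 1) = 0); last exact: H4.
  by exists (- 1) => //; exists a; rewrite Na.
have [ea|/val2 ea] := pselect (sy e * sy a = 0); first by exists e => //; exists b'.
have e0 : e != 0 by apply/eqP => e0; apply: eb; rewrite e0 sy0 mul0r.
(* [e] kills -1 but not [a]. Both [{e, a}] and [{a, a}] are the nonzero element, so [e / a] kills
   [a]; it does not kill -1, as [{a, -1}] is nonzero. *)
have ae : sy (e / a) = sy e - sy a by rewrite syM ?invr_eq0 // syV.
exists (e / a); first by rewrite ae mulrBl ea subrr.
exists (- 1); rewrite ae mulrBl eN aN sub0r => /eqP.
by rewrite oppr_eq0 => /eqP.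
Qed.
End OneDimensional.

(** * Algebraic extensions of the real numbers *)

Section Imaginary.
Variables (R : realType) (K : fieldType) (iota : {rmorphism R -> K}).
Hypothesis iota_alg : forall x, algebraicOver iota x.
Variables (j : K) (j2 : j ^+ 2 = -1).
Definition from_complex (z : complex R) : K := iota (complex.Re z) + j * iota (complex.Im z).
Fact from_complex_zmod : zmod_morphism from_complex.
Proof. by move=> [a b] [c d]; rewrite /from_complex /= !rmorphB; ring. Qed.
HB.instance Definition _ := GRing.isZmodMorphism.Build (complex R) K from_complex from_complex_zmod.
Fact from_complex_monoid : monoid_morphism from_complex.
Proof.
split=> [|[a b] [c d]]; first by rewrite /from_complex /= rmorph1 rmorph0 mulr0 addr0.
rewrite /from_complex /= rmorphB rmorphD !rmorphM.
have -> : iota b * iota d = - j ^+ 2 * (iota b * iota d) by rewrite j2 opprK mul1r.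
by ring.
Qed.
HB.instance Definition _ := GRing.isMonoidMorphism.Build (complex R) K from_complex from_complex_monoid.

(** [p] splits over the complex numbers, so all its roots in [K] are images of complex numbers. *)
Lemma from_complex_surj x : exists z, x = from_complex z.
Proof.
have [p p0 px] := iota_alg x.
have [s pE] := closed_field_poly_normal (map_poly (real_complex R) p).
have E : map_poly iota p = map_poly from_complex (map_poly (real_complex R) p).
  rewrite -map_poly_comp; apply: eq_map_poly => a /=.
  by rewrite /from_complex /= rmorph0 mulr0 addr0.
move: px; rewrite E pE map_polyZ /= rootZ; last first.
  by rewrite fmorph_eq0 lead_coef_eq0 map_poly_eq0.
rewrite rmorph_prod /= => h.
have {h} : root (\prod_(z <- [seq from_complex z | z <- s]) ('X - z%:P)) x.
  rewrite big_map; move: h; congr (is_true (root _ x)); apply: eq_bigr => z _.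
  by rewrite rmorphB /= map_polyX map_polyC.
by rewrite root_prod_XsubC => /mapP[z _ ->]; exists z.
Qed.

Lemma imaginary_power l (x : K) : (0 < l)%N -> exists y, x = y ^+ l.
Proof.
move=> l0; have [z ->] := from_complex_surj x.
have s1 : size ('X^l - z%:P) != 1%N by rewrite size_XnsubC //; case: (l) l0.
have [y] := closed_rootP _ s1; rewrite /root !hornerE subr_eq0 => /eqP <-.
by exists (from_complex y); rewrite rmorphXn.
Qed.
End Imaginary.

Section RealCase.
Import Order.TTheory Num.Theory.
Variables (R : realType) (K : fieldType) (iota : {rmorphism R -> K}).
Hypothesis iota_alg : forall x, algebraicOver iota x.

(** A nonconstant real polynomial has a real linear factor or a factor [(X - a)^2 + b^2] with [b]
    nonzero; a root [x] of the latter gives the square root [(x - a) / b] of -1. *)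
Lemma real_or_i (x : K) : (exists r, x = iota r) \/ exists j : K, j ^+ 2 = -1.
Proof.
have [p p0 px] := iota_alg x.
have [n] := ubnP (size p); elim: n p p0 px => // n IH p p0 px; rewrite ltnS => pn.
have p1 : size p != 1%N.
  apply/negP => /size_poly1P[c c0 pE]; move: px; rewrite pE map_polyC rootC fmorph_eq0.
  by rewrite (negPf c0).
have p1' : size (map_poly (real_complex R) p) != 1%N by rewrite size_map_poly.
have [[a b] z] := closed_rootP _ p1'.
(* A factor not vanishing at [x] is divided out, and the induction continues with the quotient. *)
have red (q : {poly R}) : (1 < size q)%N -> q %| p -> ~~ root (map_poly iota q) x ->
    (exists r, x = iota r) \/ exists j : K, j ^+ 2 = -1.
  move=> q1 qp qx; have pE := divpK qp.
  have d0 : p %/ q != 0 by apply/eqP => d0; move: p0; rewrite -pE d0 mul0r eqxx.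
  have q0 : q != 0 by rewrite -size_poly_gt0 (ltn_trans _ q1).
  apply: (IH (p %/ q)) => //.
    by move: px; rewrite -{1}pE rmorphM rootM (negPf qx) orbF.
  have := congr1 (fun u : {poly R} => size u) pE; rewrite /= size_mul // => sE.
  by apply: leq_trans pn; rewrite -sE -subn1 ltn_subRL [(1 + _)%N]addnC ltn_add2l.
have [b0|b0] := eqVneq b 0.
  have pa : root p a.
    rewrite b0 in z; move: z; rewrite /root -[Complex a 0]/(real_complex R a) horner_map.
    by rewrite fmorph_eq0.
  have [xa|xa] := boolP (root (map_poly iota ('X - a%:P)) x).
    left; exists a; apply/eqP; move: xa.
    by rewrite rmorphB /= map_polyX map_polyC root_XsubC.
  by apply: red xa; rewrite ?size_XsubC // dvdp_XsubCl.
pose q : {poly R} := ('X - a%:P) ^+ 2 + (b ^+ 2)%:P.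
have sq : size q = 3%N.
  by rewrite /q size_polyDl size_exp_XsubC // size_polyC; case: (_ == _).
have q0 : q != 0 by rewrite -size_poly_gt0 sq.
have qC : (map_poly (real_complex R) q).[Complex a b] = 0.
  rewrite /q rmorphD rmorphXn /= rmorphB /= map_polyX !map_polyC /= !hornerE.
  by apply/eqP; rewrite eq_complex /=; apply/andP; split; apply/eqP => /=; ring.
have qp : q %| p.
  (* The remainder has degree at most 1 and vanishes at the nonreal number [a + b i], hence is
     zero. *)
  have rC : (map_poly (real_complex R) (p %% q)).[Complex a b] = 0.
    have := congr1 (fun u => (map_poly (real_complex R) u).[Complex a b]) (divp_eq p q).
    by rewrite /= rmorphD rmorphM /= hornerD hornerM qC mulr0 add0r (eqP z).
  have sr : (size (p %% q)%R < 3)%N by rewrite -sq ltn_modp.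
  suff r0 : p %% q = 0 by apply/modp_eq0P.
  move: rC; set r := p %% q in sr *.
  have -> : r = (r`_0)%:P + (r`_1)%:P * 'X.
    apply/polyP => i; rewrite coefD coefC coefCM coefX.
    case: i => [|[|i]]; rewrite ?mulr0 ?addr0 ?mulr1 ?add0r //.
    by rewrite nth_default //; rewrite ltnS in sr; apply: leq_trans sr _.
  rewrite rmorphD rmorphM /= !map_polyC map_polyX /= !hornerE => /eqP.
  rewrite eq_complex /= => /andP[/eqP h1 /eqP h2].
  have r1 : r`_1 = 0.
    move: h2; rewrite !mul0r addr0 add0r => /eqP; rewrite mulf_eq0 (negPf b0) orbF.
    by move/eqP.
  by move: h1; rewrite r1 !mul0r subr0 addr0 => ->; rewrite ?(polyC0, mul0r, addr0).
have [xq|xq] := boolP (root (map_poly iota q) x); last by apply: red xq; rewrite ?sq.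
right; exists ((x - iota a) / iota b).
have ib0 : iota b != 0 by rewrite fmorph_eq0.
move: xq; rewrite /q rmorphD rmorphXn /= rmorphB /= map_polyX !map_polyC /= /root !hornerE.
rewrite addr_eq0 => /eqP; rewrite rmorphXn => h.
by rewrite expr_div_n h mulNr divff // expf_neq0.
Qed.

Lemma real_root (l : nat) (r : R) : (0 < l)%N -> 0 <= r -> exists s, r = s ^+ l.
Proof.
move=> l0 r0; pose p : {poly R} := 'X^l - r%:P.
have r1 : 0 <= r + 1 by rewrite addr_ge0.
(* The right end works because [(r + 1)^l >= r + 1 >= r]. *)
have [|s _] := @poly_ivt R p 0 (r + 1) r1; last first.
  by rewrite /root /p !hornerE subr_eq0 => /eqP <-; exists s.
rewrite /p !hornerE expr0n gtn_eqF // sub0r oppr_le0 r0 /= subr_ge0.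
have h1 : 1 <= r + 1 by rewrite lerDr.
rewrite -(prednK l0) exprS; apply: le_trans (_ : r + 1 <= _); first by rewrite lerDl.
by rewrite ler_peMr // exprn_ege1.
Qed.

Local Notation sy2 := (@sy 'F_2 K).
Section Split.
Hypothesis iota_surj : forall x, exists r, x = iota r.

Definition negative (a : K) := `[< exists2 r, r < 0 & a = iota r >].
Lemma negativeE r : negative (iota r) = (r < 0).
Proof.
apply/asboolP/idP => [[s s0 /fmorph_inj ->]//|r0]; by exists r.
Qed.
(** The map that this induces from the Milnor ring to polynomials shows that no power of [{-1}]
    vanishes. *)
Definition sign_class (a : K) : {poly 'F_2} := if negative a then 'X else 0.
Fact sign_classM x y : x != 0 -> y != 0 -> sign_class (x * y) = sign_class x + sign_class y.
Proof.
have [r ->] := iota_surj x; have [s ->] := iota_surj y; rewrite !fmorph_eq0 => r0 s0.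
have XX : 'X + 'X = 0 :> {poly 'F_2}.
  by rewrite -mulr2n -mulr_natr -polyC_natr (_ : 2%:R = 0 :> 'F_2) ?mulr0 //; apply/eqP.
rewrite /sign_class -rmorphM !negativeE.
case: (ltgtP r 0) r0 => // hr _; case: (ltgtP s 0) s0 => // hs _.
- by rewrite XX nmulr_rlt0 // ltNge (ltW hs).
- by rewrite nmulr_rlt0 // hs addr0.
- by rewrite pmulr_rlt0 // hs add0r.
- by rewrite pmulr_rlt0 // ltNge (ltW hs) addr0.
Qed.
Fact sign_class_steinberg x : x != 0 -> x != 1 -> sign_class x * sign_class (1 - x) = 0.
Proof.
move=> _ _; have [r ->] := iota_surj x.
rewrite /sign_class -(rmorph1 iota) -rmorphB !negativeE; case: (ltP r 0) => r0; last by rewrite mul0r.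
by rewrite ltNge subr_ge0 (le_trans (ltW r0)) ?ler01 ?mulr0.
Qed.
Fact polyC_central (a : 'F_2) (x : {poly 'F_2}) : GRing.comm (polyC a) x.
Proof. exact: mulrC. Qed.
Definition sign_map := milnor_map polyC_central sign_classM sign_class_steinberg.

Lemma koszul_sign : koszul_algebra (milnorK 'F_2 K) /\
  forall (c : milnorK 'F_2 K) (hc : homogeneous 1 c), koszul_module (principal_ideal hc).
Proof.
pose e := sy2 (-1).
have N1 : - 1 != 0 :> K by rewrite oppr_eq0 oner_eq0.
have se a : sy2 a = 0 \/ sy2 a = e.
  have [r ->] := iota_surj a; case: (lerP 0 r) => r0.
    by left; have [s ->] := real_root (l := 2) isT r0; rewrite rmorphXn syXl.
  right; have [|s sE] := @real_root 2 (- r) isT; first by rewrite oppr_ge0 ltW.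
  have s0 : s != 0 by apply: contraTneq r0 => s0; rewrite -oppr_gt0 sE s0 expr0n ltxx.
  rewrite -[r]opprK sE -mulN1r rmorphM rmorphXn rmorphN1 sy_mulXl //.
  by rewrite fmorph_eq0.
have form (z : milnorK 'F_2 K) n : exists c, gpart n z = c *: e ^+ n.
  elim/milnor_sy_ind: z n => [n|x y hx hy n|a x hx n|a x _ hx n].
  - case: n => [|n]; first by exists 1; rewrite gpart1 scale1r.
    by exists 0; rewrite -(@gpart1 _ (milnorK 'F_2 K)) gpartK scale0r.
  - by have [c cE] := hx n; have [d dE] := hy n; exists (c + d); rewrite linearD /= cE dE scalerDl.
  - by have [c cE] := hx n; exists (a * c); rewrite linearZ /= cE scalerA.
  rewrite (gpart_mul1 _ _ (sy_hom _ _)); case: n => [|n]; first by exists 0; rewrite scale0r.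
  have [c ->] := hx n; case: (se a) => ->; first by exists 0; rewrite mul0r scale0r.
  by exists c; rewrite -scalerAr exprS.
apply: koszul_criterion => [|c /deg1_sy[a _ ->] c0]; first exists e; first exact: sy_hom.
  move=> [|n] // z _; have [c ->] := form z n.+1; exists (c *: e ^+ n).
  by rewrite -scalerAr exprS.
have {c0} -> : sy2 a = e by case: (se a).
(* The annihilator of [e] is zero, since [sign_map] sends [e ^+ n.+1] to the corresponding power of
   ['X]. *)
exists 0; first exact: linear0; split=> [|n z _]; first exact: mul0r.
have [d ->] := form z n; rewrite -scalerAl -exprSr => /(congr1 sign_map).
rewrite milnor_mapZ rmorph0 rmorphXn /= (milnor_map_sy polyC_central sign_classM sign_class_steinberg N1).
have -> : sign_class (-1) = 'X by rewrite /sign_class -(rmorphN1 iota) negativeE ltrN10.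
move=> /(congr1 (fun p : {poly 'F_2} => p`_n.+1)); rewrite coefCM coefXn eqxx mulr1 coef0 => ->.
by exists 0; rewrite mul0r scale0r.
Qed.
End Split.

Lemma koszul_real l : prime l -> koszul_algebra (milnorK 'F_l K) /\
  forall (c : milnorK 'F_l K) (hc : homogeneous 1 c), koszul_module (principal_ideal hc).
Proof.
move=> lp; have l0 := prime_gt0 lp.
have pw : (forall x : K, exists y, x = y ^+ l) -> forall a b : K, sy 'F_l a * sy 'F_l b = 0.
  by move=> h a b; have [c ->] := h a; rewrite syXl // mul0r.
have [[j jj]|nj] := pselect (exists j : K, j ^+ 2 = -1).
  by apply/koszul_symbols0/pw => x; exact: (imaginary_power iota_alg jj _ l0).
have surj x : exists r, x = iota r by case: (real_or_i x).
have [->|lo] := even_prime lp; first exact: koszul_sign.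
apply/koszul_symbols0/pw => x; have [r ->] := surj x.
have [r0|r0] := lerP 0 r.
  by have [s ->] := real_root l0 r0; exists (iota s); rewrite rmorphXn.
have [|s sE] := @real_root l (- r) l0; first by rewrite oppr_ge0 ltW.
by exists (iota (- s)); rewrite -rmorphXn exprNn -signr_odd lo expr1 mulN1r -sE opprK.
Qed.
End RealCase.

(** * Henselian fields *)

Section ValuationTheory.
Import Order.TTheory Num.Theory.
Variables (K : fieldType) (v : discreteValuation K).
Implicit Types (x y : K) (n : int).

(** The value of [v] at 0 is arbitrary; here 0 is counted as a member of every power of the maximal
    ideal. *)
Definition vge n x := (x == 0) || (n <= v x).

Lemma vge0 n : vge n 0. Proof. by rewrite /vge eqxx. Qed.
Lemma vgeE n x : x != 0 -> vge n x = (n <= v x).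
Proof. by rewrite /vge => /negPf->. Qed.
Lemma vge_le n (m : int) x : m <= n -> vge n x -> vge m x.
Proof. by rewrite /vge => mn; case: (x == 0) => //=; exact: le_trans. Qed.
Lemma vgeD n x y : vge n x -> vge n y -> vge n (x + y).
Proof.
have [->|x0] := eqVneq x 0; first by rewrite add0r.
have [->|y0] := eqVneq y 0; first by rewrite addr0.
have [->|xy0] := eqVneq (x + y) 0; first by rewrite vge0.
rewrite !vgeE // => vx vy; apply: le_trans (dvalD v x0 y0 xy0).
by rewrite le_min vx.
Qed.
Lemma vgeM n (m : int) x y : vge n x -> vge m y -> vge (n + m) (x * y).
Proof.
have [->|x0] := eqVneq x 0; first by rewrite mul0r => _ _; exact: vge0.
have [->|y0] := eqVneq y 0; first by rewrite mulr0 => _ _; exact: vge0.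
by rewrite !vgeE ?mulf_neq0 // dvalM // => vx vy; apply: lerD.
Qed.
Lemma vge1 : vge 0 1. Proof. by rewrite /vge dval1 lexx orbT. Qed.
Lemma vgeN n x : vge n (- x) = vge n x.
Proof.
rewrite /vge oppr_eq0; case: eqVneq => //= x0.
by rewrite -mulN1r dvalM ?oppr_eq0 ?oner_neq0 // dvalN1 add0r.
Qed.
Lemma vgeB n x y : vge n x -> vge n y -> vge n (x - y).
Proof. by move=> hx hy; apply: vgeD; rewrite ?vgeN. Qed.
Lemma vgeX n x m : vge n x -> vge (n *+ m) (x ^+ m).
Proof.
move=> hx; elim: m => [|m IH]; first exact: vge1.
by rewrite exprS mulrS; apply: vgeM.
Qed.
Lemma vgeX0 x m : vge 0 x -> vge 0 (x ^+ m).
Proof. by move/(vgeX m); rewrite mul0rn. Qed.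
Lemma vge_nat m : vge 0 m%:R.
Proof. by elim: m => [|m IH]; rewrite ?vge0 // -addn1 natrD; apply: vgeD => //; exact: vge1. Qed.
Lemma vge_natmul n x m : vge n x -> vge n (x *+ m).
Proof. by move=> hx; rewrite -mulr_natr -[n]addr0; apply: vgeM => //; exact: vge_nat. Qed.
Lemma vge_sum n (I : Type) (s : seq I) (P : pred I) (F : I -> K) :
  (forall i, P i -> vge n (F i)) -> vge n (\sum_(i <- s | P i) F i).
Proof. by move=> h; elim/big_ind: _ => //; [exact: vge0|exact: vgeD]. Qed.

Lemma dvalV x : x != 0 -> v x^-1 = - v x.
Proof.
move=> x0; apply/eqP; rewrite -addr_eq0 -dvalM ?invr_eq0 // mulVf // dval1.
by [].
Qed.
Lemma dvalN x : x != 0 -> v (- x) = v x.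
Proof. by move=> x0; rewrite -mulN1r dvalM ?oppr_eq0 ?oner_neq0 // dvalN1 add0r. Qed.
Lemma dvalX x (m : nat) : x != 0 -> v (x ^+ m) = v x *+ m.
Proof.
move=> x0; elim: m => [|m IH]; first by rewrite dval1.
by rewrite exprS dvalM ?expf_neq0 // IH mulrS.
Qed.
Lemma dvalXz x n : x != 0 -> v (x ^ n) = v x *~ n.
Proof.
move=> x0; case: n => n; first by rewrite -exprnP dvalX.
by rewrite NegzE -exprnN dvalV ?expf_neq0 // dvalX // mulrNz.
Qed.
Lemma dval_lt_add x y : x != 0 -> vge (v x + 1) y -> x + y != 0 /\ v (x + y) = v x.
Proof.
move=> x0 hy; have [y0|y0] := eqVneq y 0; first by rewrite y0 addr0.
rewrite vgeE // in hy.
have xy0 : x + y != 0.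
  by apply: contraTneq hy => /eqP; rewrite addr_eq0 => /eqP->; rewrite dvalN //; lia.
split=> //; apply/eqP; rewrite eq_le; apply/andP; split.
  have : vge (v (x + y)) (x + y) by rewrite vgeE.
  move=> h; rewrite leNgt; apply/negP => lt.
  have : vge (v x + 1) ((x + y) - y).
    by apply: vgeB; rewrite ?vgeE //; lia.
  by rewrite addrK vgeE //; lia.
have := dvalD v x0 y0 xy0; rewrite ge_min => /orP[//|h].
by apply: le_trans h; apply: le_trans hy; rewrite lerDl.
Qed.

Definition unif : K := sval (cid2 (dval_surj v)).
Lemma unifP : unif != 0 /\ v unif = 1.
Proof. by rewrite /unif; case: cid2. Qed.
End ValuationTheory.

Section Residue.
Import Order.TTheory Num.Theory.
Variables (K : fieldType) (v : discreteValuation K).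
Variables (k : fieldType) (res : {rmorphism valuationRing v -> k}) (res_map : is_residue_map res).

(** Extending the residue map by 0 outside the valuation ring keeps membership proofs out of the
    terms. *)
Definition resK (x : K) : k := if insub x is Some y then res y else 0.
Lemma resKE (y : valuationRing v) : resK (val y) = res y.
Proof. by rewrite /resK valK. Qed.
Lemma ringP x : vge v 0 x -> exists y : valuationRing v, x = val y.
Proof. by move=> hx; exists (Sub x hx : valuationRing v). Qed.
Lemma resKD x y : vge v 0 x -> vge v 0 y -> resK (x + y) = resK x + resK y.
Proof.
move=> /ringP[a ->] /ringP[b ->]; have := resKE (a + b); rewrite rmorphD /= => ->.
by rewrite !resKE rmorphD.
Qed.
Lemma resKM x y : vge v 0 x -> vge v 0 y -> resK (x * y) = resK x * resK y.
Proof.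
move=> /ringP[a ->] /ringP[b ->]; have := resKE (a * b); rewrite rmorphM /= => ->.
by rewrite !resKE rmorphM.
Qed.
Lemma resK1 : resK 1 = 1.
Proof. by have := resKE 1; rewrite !rmorph1. Qed.
Lemma resKN x : vge v 0 x -> resK (- x) = - resK x.
Proof.
move=> /ringP[a ->]; have := resKE (- a); rewrite rmorphN /= => ->.
by rewrite resKE rmorphN.
Qed.
Lemma resK_surj a : exists2 x, vge v 0 x & resK x = a.
Proof. by have [y <-] := res_map.1 a; exists (val y); [exact: valP y|rewrite resKE]. Qed.
Lemma resK_eq0 x : vge v 0 x -> resK x = 0 <-> vge v 1 x.
Proof.
move=> /ringP[a ->]; rewrite resKE res_map.2 /vge; split=> [[->|h]|/orP[/eqP->|h]].
- by rewrite eqxx.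
- by apply/orP; right; lia.
- by left.
by right; lia.
Qed.
Lemma resK_eq x y : vge v 0 x -> vge v 0 y -> resK x = resK y <-> vge v 1 (x - y).
Proof.
move=> hx hy; rewrite -resK_eq0 ?resKD ?vgeN ?resKN //; last by apply: vgeB.
by split=> [->|/eqP]; [rewrite subrr|rewrite subr_eq0 => /eqP].
Qed.
Lemma resK_neq0 x : x != 0 -> v x = 0 -> resK x != 0.
Proof.
by move=> x0 vx; apply/eqP => /resK_eq0; rewrite !vgeE // vx => /(_ isT).
Qed.
End Residue.

(** * The Milnor ring when 1-units are l-th powers *)

Section TwoByTwo.
Variable B : nzRingType.
Definition mx2 (a b c d : B) : 'M[B]_2 :=
  \matrix_(i, j) if i == 0 then (if j == 0 then a else b) else (if j == 0 then c else d).
Lemma mx2M a b c d a' b' c' d' : mx2 a b c d * mx2 a' b' c' d' =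
  mx2 (a * a' + b * c') (a * b' + b * d') (c * a' + d * c') (c * b' + d * d').
Proof.
apply/matrixP => i j; rewrite !mxE !big_ord_recl big_ord0 /= !mxE /= addr0.
by case: i j => [[|[|i]] // hi] [[|[|j]] // hj].
Qed.
Lemma mx2D a b c d a' b' c' d' : mx2 a b c d + mx2 a' b' c' d' =
  mx2 (a + a') (b + b') (c + c') (d + d').
Proof. by apply/matrixP => i j; rewrite !mxE; case: (i == 0); case: (j == 0). Qed.
Lemma mx2_0 : mx2 0 0 0 0 = 0.
Proof. by apply/matrixP => i j; rewrite !mxE !if_same. Qed.
Lemma scalar_mx2 (x : B) : x%:M = mx2 x 0 0 x.
Proof.
apply/matrixP => i j; rewrite !mxE.
by case: i j => [[|[|i]] // hi] [[|[|j]] // hj] /=; rewrite ?mulr1n ?mulr0n.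
Qed.
Lemma mx2_col (M : 'M[B]_2) : M = mx2 (M 0 0) (M 0 1) (M 1 0) (M 1 1).
Proof.
apply/matrixP => i j; rewrite !mxE.
case: i j => [[|[|i]] // hi] [[|[|j]] // hj] /=; by congr (M _ _); apply: val_inj.
Qed.
End TwoByTwo.

Section TameStructure.
Import Order.TTheory Num.Theory.
Variables (l : nat) (l_pr : prime l) (K : fieldType) (v : discreteValuation K).
Variables (k : fieldType) (res : {rmorphism valuationRing v -> k}) (res_map : is_residue_map res).
Hypothesis units1 : forall u, vge v 0 u -> resK res u = 1 -> exists y, u = y ^+ l.
Local Notation A := (milnorK 'F_l K).
Local Notation B := (milnorK 'F_l k).
Local Notation syK := (@sy 'F_l K).
Local Notation syk := (@sy 'F_l k).
Local Notation resK := (resK res).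

Definition lift (a : k) : K := sval (cid2 (resK_surj res_map a)).
Lemma lift_ge0 a : vge v 0 (lift a).
Proof. by rewrite /lift; case: cid2. Qed.
Lemma liftK a : resK (lift a) = a.
Proof. by rewrite /lift; case: cid2. Qed.
Lemma resK_neq0E x : vge v 0 x -> resK x != 0 -> x != 0 /\ v x = 0.
Proof.
move=> hx rx; have x0 : x != 0.
  by apply: contraNneq rx => ->; apply/eqP/(resK_eq0 res_map (vge0 v 0)); exact: vge0.
split=> //; move: hx; rewrite vgeE // => hx; apply/eqP; rewrite eq_le hx andbT leNgt.
apply: contraNN rx => vx; apply/eqP/(resK_eq0 res_map); rewrite vgeE //.
Qed.
Lemma lift_unit a : a != 0 -> lift a != 0 /\ v (lift a) = 0.
Proof. by move=> a0; apply: resK_neq0E; rewrite ?liftK //; exact: lift_ge0. Qed.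

Lemma sy_unit1 u : vge v 0 u -> resK u = 1 -> syK u = 0.
Proof. by move=> hu /(units1 hu)[y ->]; rewrite syXl. Qed.

Lemma sy_res x y : x != 0 -> y != 0 -> v x = 0 -> v y = 0 -> resK x = resK y -> syK x = syK y.
Proof.
move=> x0 y0 vx vy xy.
have gx : vge v 0 x by rewrite vgeE // vx.
have gy : vge v 0 y^-1 by rewrite vgeE ?invr_eq0 // dvalV // vy.
have gy' : vge v 0 y by rewrite vgeE // vy.
apply/subr0_eq; rewrite -syV -syM ?invr_eq0 //; apply: sy_unit1.
  by rewrite -[0]addr0; apply: vgeM.
by rewrite (resKM res gx gy) xy -(resKM res gy' gy) divff // resK1.
Qed.

Definition base_sy (a : k) := syK (lift a).
Lemma base_syE x : vge v 0 x -> resK x != 0 -> base_sy (resK x) = syK x.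
Proof.
move=> hx rx; have [x0 vx] := resK_neq0E hx rx; have [y0 vy] := lift_unit rx.
by apply: sy_res => //; rewrite liftK.
Qed.
Fact base_syM x y : x != 0 -> y != 0 -> base_sy (x * y) = base_sy x + base_sy y.
Proof.
move=> x0 y0; have [? ?] := lift_unit x0; have [? ?] := lift_unit y0.
rewrite -syM //; have E : resK (lift x * lift y) = x * y.
  by rewrite resKM ?lift_ge0 // !liftK.
rewrite -E base_syE //; last by rewrite E mulf_neq0.
by rewrite -[0]addr0; apply: vgeM; exact: lift_ge0.
Qed.
Fact base_sy_steinberg x : x != 0 -> x != 1 -> base_sy x * base_sy (1 - x) = 0.
Proof.
move=> x0 x1; have g : vge v 0 (1 - lift x) by apply: vgeB; [exact: vge1|exact: lift_ge0].
have E : resK (1 - lift x) = 1 - x.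
  by rewrite resKD ?vgeN ?lift_ge0 ?vge1 // resKN ?lift_ge0 // resK1 liftK.
rewrite -E base_syE //; first exact: sy_steinberg.
by rewrite E subr_eq0 eq_sym.
Qed.

(* The section of the tame specialization B -> A; it exists because 1-units are l-th powers. *)
Definition unram : {rmorphism B -> A} :=
  milnor_map (@in_alg_central 'F_l K) base_syM base_sy_steinberg.
Lemma unram_sy a : a != 0 -> unram (syk a) = base_sy a.
Proof. exact: milnor_map_sy. Qed.
Lemma unramZ a x : unram (a *: x) = a *: unram x.
Proof. by rewrite [LHS]milnor_mapZ /= -scalerAl mul1r. Qed.
Lemma unram_graded n b : gpart n (unram b) = unram (gpart n b).
Proof.
by apply: milnor_hom_graded => [a x|x x0]; rewrite ?unramZ // unram_sy // sy_hom.
Qed.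
Lemma unram_gaug b : gaug (unram b) = gaug b.
Proof. by apply: hom_gaug; [exact: unramZ|exact: unram_graded]. Qed.

Variables (W : K) (W0 : W != 0) (vW : v W = 1).
Local Notation w := (syK W).
Local Notation eps := (syk (-1)).

(** The angular component of [x] with respect to the uniformizer [W]. *)
Definition ac (x : K) : k := resK (x * W ^ (- v x)).
Lemma ac_ge0 x : x != 0 -> v (x * W ^ (- v x)) = 0.
Proof. by move=> x0; rewrite dvalM ?expfz_neq0 // dvalXz // vW intz addrN. Qed.
Lemma ac_neq0 x : x != 0 -> ac x != 0.
Proof.
by move=> x0; apply: (resK_neq0 res_map); rewrite ?ac_ge0 // mulf_neq0 ?expfz_neq0.
Qed.
Lemma acM x y : x != 0 -> y != 0 -> ac (x * y) = ac x * ac y.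
Proof.
move=> x0 y0; rewrite -(resKM res); last 2 first.
- by rewrite vgeE ?mulf_neq0 ?expfz_neq0 // ac_ge0.
- by rewrite vgeE ?mulf_neq0 ?expfz_neq0 // ac_ge0.
by rewrite /ac dvalM // opprD expfzDr // mulrACA.
Qed.
Lemma ac_unit x : v x = 0 -> ac x = resK x.
Proof. by rewrite /ac => ->; rewrite oppr0 expr0z mulr1. Qed.

Lemma sy_decomp x : x != 0 -> syK x = unram (syk (ac x)) + w *~ v x.
Proof.
move=> x0; rewrite unram_sy ?ac_neq0 // base_syE.
- have -> : syK x = syK (x * W ^ (- v x) * W ^ (v x)).
    by rewrite -mulrA -expfzDr // addNr expr0z mulr1.
  rewrite syM ?mulf_neq0 ?expfz_neq0 //; congr (_ + _).
  case: (v x) => n; first by rewrite -exprnP syX.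
  by rewrite NegzE -exprnN syV syX // mulrNz.
- by rewrite vgeE ?mulf_neq0 ?expfz_neq0 // ac_ge0.
exact: ac_neq0.
Qed.

Lemma unram_eps : unram eps = syK (-1).
Proof.
have N1 : - 1 != 0 :> k by rewrite oppr_eq0 oner_eq0.
rewrite unram_sy //; have -> : (- 1 : k) = resK (- 1) by rewrite resKN ?vge1 // resK1.
by rewrite base_syE ?vgeN ?vge1 // resKN ?vge1 // resK1.
Qed.

Lemma unram_decomp a : exists b0 b1, a = unram b0 + w * unram b1.
Proof.
elim/milnor_sy_ind: a => [|x y [b0 [b1 ->]] [c0 [c1 ->]]|c x [b0 [b1 ->]]|x y x0 [b0 [b1 ->]]].
- by exists 1, 0; rewrite rmorph1 rmorph0 mulr0 addr0.
- by exists (b0 + c0), (b1 + c1); rewrite !rmorphD mulrDr addrACA.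
- by exists (c *: b0), (c *: b1); rewrite !unramZ scalerDr scalerAr.
set a := syk (ac x); set n := v x.
(* The product of [a + n w] and [b0 + w b1], computed with [a w = - w a] and [w w = w eps]. *)
exists (a * b0), (b0 *~ n + (eps * b1) *~ n - a * b1).
rewrite sy_decomp // -/a -/n mulrDl !mulrDr.
have -> : unram a * (w * unram b1) = - (w * unram (a * b1)).
  rewrite mulrA rmorphM mulrA -mulNr; congr (_ * _).
  by rewrite /a unram_sy ?ac_neq0 // syC.
have -> : w *~ n * (w * unram b1) = w * unram (eps * b1 *~ n).
  by rewrite rmorphMz rmorphM mulrzAl mulrzAr unram_eps !mulrA sy_sq.
have -> : w *~ n * unram b0 = w * unram (b0 *~ n) by rewrite rmorphMz mulrzAr mulrzAl.
rewrite -[unram a * _]rmorphM rmorphB rmorphD mulrBr mulrDr -addrA; congr (_ + _).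
exact: addrC.
Qed.

(** Left multiplication by [{x}] on the pairs [(b0, b1)] that stand for [b0 + w b1], as found in
    [unram_decomp]. Once these matrices are known to satisfy the Milnor relations, they separate
    such pairs. *)
Definition tame_rep (x : K) : 'M[B]_2 :=
  mx2 (syk (ac x)) 0 (v x)%:~R (- syk (ac x) + eps *~ v x).

Lemma eps2 : eps + eps = 0. Proof. by rewrite {1}syN1 addNr. Qed.

Fact tame_repM x y : x != 0 -> y != 0 -> tame_rep (x * y) = tame_rep x + tame_rep y.
Proof.
move=> x0 y0; rewrite /tame_rep mx2D addr0 acM // syM ?ac_neq0 // dvalM //.
by rewrite intrD mulrzDr opprD addrACA.
Qed.

Lemma tame_rep_unit1 x : vge v 0 x -> resK x = 1 -> tame_rep x = 0.
Proof.
move=> hx x1; have [|x0 vx] := resK_neq0E hx; first by rewrite x1 oner_neq0.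
by rewrite /tame_rep ac_unit // x1 sy1 vx mulr0z oppr0 addr0 mx2_0.
Qed.

(** [n (n + 1)] is even; with [n = v x] negative this is what closes the Steinberg relation for the
    matrices. *)
Lemma mulrz_even (z : B) n : z + z = 0 -> z *~ (n * (n + 1)) = 0.
Proof.
move=> zz; have E m : z *~ (m * 2) = 0 by rewrite mulrC mulrzA mulrz_nat mulr2n zz mul0rz.
have [q qE] : exists q : int, n = q * 2 \/ n = q * 2 + 1 by exists (divz n 2); lia.
have [m ->] : exists m : int, n * (n + 1) = m * 2; last exact: E.
by case: qE => ->; [exists (q * (q * 2 + 1))|exists ((q * 2 + 1) * (q + 1))]; ring.
Qed.

(** 1-units act as zero. If [v x < 0], then [1 - x] is [- x] times a 1-unit; if [v x > 0], it is a
    1-unit. If [v x = 0], either [x] is a 1-unit or the relation is that of the residue field. *)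
Fact tame_rep_steinberg x : x != 0 -> x != 1 -> tame_rep x * tame_rep (1 - x) = 0.
Proof.
move=> x0 x1; have y0 : 1 - x != 0 by rewrite subr_eq0 eq_sym.
case: (ltgtP (v x) 0) => vx.
- have E : tame_rep (1 - x) = tame_rep (- x).
    have -> : 1 - x = - x * (1 - x^-1) by rewrite mulrBr mulr1 mulNr divff // opprK addrC.
    have g : vge v 1 (x^-1) by rewrite vgeE ?invr_eq0 // dvalV //; lia.
    have g0 : vge v 0 (x^-1) by apply: vge_le g.
    have r1 : resK (1 - x^-1) = 1.
      by rewrite resKD ?vgeN ?vge1 // resKN // (proj2 (resK_eq0 res_map g0)) // oppr0 addr0 resK1.
    have u0 : 1 - x^-1 != 0 by rewrite subr_eq0 eq_sym invr_eq1.
    rewrite tame_repM ?oppr_eq0 // (@tame_rep_unit1 (1 - x^-1)) ?addr0 //.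
    by apply: vgeB => //; exact: vge1.
  rewrite E /tame_rep mx2M dvalN //.
  have -> : syk (ac (- x)) = eps + syk (ac x).
    have Nx : - x = -1 * x by rewrite mulN1r.
    rewrite Nx acM ?oppr_eq0 ?oner_neq0 // syM ?ac_neq0 ?oppr_eq0 ?oner_neq0 //.
    by rewrite (ac_unit (dvalN1 v)) resKN ?vge1 // resK1.
  set a := syk (ac x); set n := v x.
  have aa : a * a = a * eps by exact: sy_sq.
  have ae : eps * a = - (a * eps) by exact: syC.
  have ae2 : a * eps + a * eps = 0 by rewrite -mulrDr eps2 mulr0.
  have ee : eps * eps = eps * eps by [].
  have a1 : a * (eps + a) = 0 by rewrite mulrDr aa.
  rewrite !mul0r !mulr0 !addr0 !add0r a1.
  have -> : n%:~R * (eps + a) + (- a + eps *~ n) * n%:~R = 0 :> B.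
    rewrite mulrzl mulrDl mulNr !mulrzr mulrzDl addrA addrK -mulrzA -mulrzDr.
    have -> : (n + n * n) = n * (n + 1) by rewrite mulrDr mulr1 addrC.
    exact: mulrz_even eps2.
  have -> : (- a + eps *~ n) * (- (eps + a) + eps *~ n) = 0.
    have e1 : (- a + eps *~ n) * - (eps + a) = (- (eps * eps) - eps * a) *~ n.
      by rewrite mulrN mulrDl mulNr a1 oppr0 add0r mulrzAl mulrDr -mulNrz opprD.
    have e2 : (- a + eps *~ n) * (eps *~ n) = - (a * eps) *~ n + (eps * eps) *~ (n * n).
      by rewrite mulrDl mulNr mulrzAr -mulNrz mulrzAl mulrzAr -mulrzA.
    have aeN : - (a * eps) = a * eps by apply/eqP; rewrite eq_sym -addr_eq0 ae2.
    have eeN : - (eps * eps) = eps * eps by rewrite -mulNr -syN1.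
    rewrite mulrDr e1 e2 ae opprK eeN aeN mulrzDl -!addrA [(a * eps) *~ n + (_ + _)]addrA -mulrzDl ae2 mul0rz add0r.
    rewrite -mulrzDr; have -> : (n + n * n) = n * (n + 1) by rewrite mulrDr mulr1 addrC.
    by apply: mulrz_even; rewrite -mulrDr eps2 mulr0.
  exact: mx2_0.
- have g : vge v 1 x by rewrite vgeE //; lia.
  have g0 : vge v 0 x by apply: vge_le g.
  rewrite (@tame_rep_unit1 (1 - x)) ?mulr0 //; first by apply: vgeB; rewrite ?vge1.
  by rewrite resKD ?vgeN ?vge1 // resKN // (proj2 (resK_eq0 res_map g0)) // oppr0 addr0 resK1.
have g0 : vge v 0 x by rewrite vgeE // vx.
have [r1|r1] := eqVneq (resK x) 1; first by rewrite tame_rep_unit1 // mul0r.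
have g1 : vge v 0 (1 - x) by apply: vgeB; rewrite ?vge1.
have rE : resK (1 - x) = 1 - resK x by rewrite resKD ?vgeN ?vge1 // resKN // resK1.
have [|_ vy] := resK_neq0E g1; first by rewrite rE subr_eq0 eq_sym.
rewrite /tame_rep !ac_unit // vx vy rE !mulr0z !addr0 mx2M !mulr0 !mul0r !addr0 !add0r mulrNN.
by rewrite sy_steinberg mx2_0.
Qed.

Fact scalar_central (a : 'F_l) (M : 'M[B]_2) :
  GRing.comm ((scalar_mx \o in_alg B) a : 'M[B]_2) M.
Proof.
rewrite /GRing.comm /= scalar_mx2 [M]mx2_col !mx2M !mul0r !mulr0 !addr0 !add0r.
by rewrite -!scalerAl !mul1r -!scalerAr !mulr1.
Qed.

Definition tame_map : {rmorphism A -> 'M[B]_2} :=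
  milnor_map scalar_central tame_repM tame_rep_steinberg.

Lemma tame_map_unram b : exists c d, tame_map (unram b) = mx2 b c 0 d.
Proof.
elim/milnor_sy_ind: b => [|x y [c [d xE]] [c' [d' yE]]|a x [c [d xE]]|a x a0 [c [d xE]]].
- exists 0, 1; rewrite !rmorph1; apply/matrixP => i j; rewrite !mxE.
  by case: i j => [[|[|i]] // hi] [[|[|j]] // hj].
- by exists (c + c'), (d + d'); rewrite !rmorphD xE yE mx2D addr0.
- exists (a *: c), (a *: d); rewrite unramZ milnor_mapZ xE.
  by rewrite /= scalar_mx2 mx2M !mul0r !addr0 !add0r mulr0 -!scalerAl !mul1r.
have [u0 vu] := lift_unit a0.
exists (syk a * c), (- (syk a * d)).
rewrite !rmorphM unram_sy // milnor_map_sy // xE /tame_rep ac_unit // liftK vu.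
by rewrite mulr0z addr0 mx2M !mul0r !mulr0 !addr0 !add0r mulNr.
Qed.

(** The first column of the matrix of [unram b0 + w * unram b1] is [(b0, b1)]. *)
Lemma unram_uniq b0 b1 : unram b0 + w * unram b1 = 0 -> b0 = 0 /\ b1 = 0.
Proof.
have [c [d E0]] := tame_map_unram b0; have [c' [d' E1]] := tame_map_unram b1.
move/(congr1 tame_map); rewrite rmorphD rmorphM E0 E1 milnor_map_sy //.
have -> : tame_rep W = mx2 0 0 1 eps.
  by rewrite /tame_rep /ac vW mulfV // resK1 sy1 oppr0 add0r.
rewrite mx2M mx2D rmorph0 !mul0r !mul1r mulr0 !addr0 add0r => /matrixP h.
by have := h 0 0; have := h 1 0; rewrite !mxE.
Qed.

End TameStructure.

(** * Koszulity over a Henselian field *)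

Section HenselianTheorem.
Import Order.TTheory Num.Theory.

Lemma bezout_mulrn (s t : int) (b c : nat) :
  b%:Z * s = 1 + t * c%:Z -> s *+ b + (- t) *+ c = 1.
Proof.
by move=> h; rewrite -(mulr_natr s b) -(mulr_natr (- t) c) !natz mulrC h mulNr addrK.
Qed.

Lemma deg1_gpart_comm (R K : fieldType) (c : milnorK R K) n z : homogeneous 1 c ->
  gpart n z * c = (-1) ^+ n * (c * gpart n z).
Proof.
move=> hc; elim/milnor_sy_ind: z n => [|x y hx hy n|a x hx n|a x _ hx n].
- case=> [|n]; first by rewrite gpart1 mulr1 !mul1r.
  by rewrite -(@gpart1 _ (milnorK R K)) gpartK mul0r !mulr0.
- by rewrite linearD /= mulrDl hx hy -!mulrDr.
- by rewrite linearZ /= -scalerAl hx -!scalerAr.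
rewrite (gpart_mul1 _ _ (sy_hom R a)); case: n => [|n]; first by rewrite mul0r !mulr0.
have sc : sy R a * (-1) ^+ n = (-1) ^+ n * sy R a by exact: GRing.commr_sign.
have E : sy R a * ((-1) ^+ n * (c * gpart n x)) = (-1) ^+ n * (sy R a * (c * gpart n x)).
  by rewrite [LHS]mulrA sc -mulrA.
by rewrite -mulrA hx E [sy R a * (c * _)]mulrA deg1_anticomm // exprSr mulrN1 !mulNr mulrN !mulrA.
Qed.

Variables (l : nat) (l_pr : prime l) (K : fieldType) (v : discreteValuation K).
Variables (k : fieldType) (res : {rmorphism valuationRing v -> k}) (res_map : is_residue_map res).
Hypothesis units1 : forall u, vge v 0 u -> resK res u = 1 -> exists y, u = y ^+ l.
Local Notation A := (milnorK 'F_l K).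
Local Notation B := (milnorK 'F_l k).
Local Notation syK := (@sy 'F_l K).
Local Notation syk := (@sy 'F_l k).
Hypothesis koszulB : koszul_algebra B.
Hypothesis koszulB_ideal : forall (c : B) (hc : homogeneous 1 c), koszul_module (principal_ideal hc).
Local Notation unram := (unram l_pr res_map units1).

Lemma koszul_extension : koszul_algebra A.
Proof.
have [W0 vW] := unifP v.
move=> i j; elim: i j => [|[|i] IH] j ij.
- by apply: tor0_trivial; exact/nesym.
- by apply: tor1_trivial; [exact: milnor_gen1|exact/nesym].
apply: (@tor_aug_ext _ _ _ unram (syK (unif v))).
- exact: unram_graded.
- exact: sy_hom.
- exact: unram_decomp.
- by move=> b0 b1; apply: (unram_uniq W0 vW).
- exact: unram_gaug.
- exact: koszulB.
by move=> j' jE; apply: IH => E; apply: ij; rewrite jE -E addn1.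
Qed.

Section Unramified.
Variables (c : B) (hc : homogeneous 1 c) (hc' : homogeneous (A := A) 1 (unram c)).
Definition ideal_map (x : principal_ideal hc) : principal_ideal hc' :=
  in_pid hc' (ex_intro _ (unram (sval (cid (pidP x))))
    (etrans (congr1 unram (svalP (cid (pidP x)))) (rmorphM unram _ _))).
Lemma ideal_mapE x : (val (ideal_map x) : A) = unram (val x : B). Proof. by []. Qed.

(** The ideal of [unram c] is [(c)] extended from [B] to [A], because [unram c] anticommutes with
    the symbol of the uniformizer. *)
Lemma unram_ideal_tor i j : tor_vanishes (principal_ideal hc) i j -> tor_vanishes (principal_ideal hc') i j.
Proof.
have [W0 vW] := unifP v; set w := syK (unif v).
have wc : unram c * w = - (w * unram c) by rewrite (deg1_anticomm hc') opprK.
apply: (@tor_base_change _ _ _ unram w _ _ _ _ _ _ _ ideal_map).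
- exact: unram_graded.
- exact: sy_hom.
- exact: unram_decomp.
- by move=> b0 b1; apply: (unram_uniq W0 vW).
- exact: unram_gaug.
- by move=> x y; apply: val_inj; rewrite pid_valD !ideal_mapE pid_valD rmorphD.
- by move=> b x; apply: val_inj; rewrite pid_valZ !ideal_mapE pid_valZ rmorphM.
- by move=> n x; apply: val_inj; rewrite pid_val_part !ideal_mapE pid_val_part unram_graded.
- move=> y; have [u yE] := pidP y; have [b0 [b1 uE]] := unram_decomp l_pr res_map units1 W0 vW u.
  exists (in_pid hc (ex_intro _ b0 erefl)), (in_pid hc (ex_intro _ (- b1) (erefl (c * - b1)))).
  apply: val_inj; rewrite pid_valD pid_valZ !ideal_mapE !in_pidE yE uE !rmorphM rmorphN.
  by rewrite mulrDr [unram c * (w * _)]mulrA wc mulrN mulNr mulrN mulrA.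
move=> m0 m1 /(congr1 val); rewrite pid_valD pid_valZ !ideal_mapE => /(unram_uniq W0 vW)[h0 h1].
by split; apply: val_inj.
Qed.
End Unramified.

(** Write [w = {W}], [eps = {-1}] and [z = b0 + w b1]. Then [w z = w (b0 + eps b1)], so [w z = 0]
    forces [b0 = - eps b1] and [z = (w - eps) b1 = {-W} b1]. *)
Lemma uniformizer_ann W : W != 0 -> v W = 1 -> forall n z, gpart n z * syK W = 0 ->
  exists u, gpart n z = syK (- W) * u.
Proof.
move=> W0 vW n z; rewrite (deg1_gpart_comm _ _ (sy_hom _ W)).
move/(congr1 (fun x => (-1) ^+ n * x)); rewrite mulrA -expr2 sqrr_sign mul1r mulr0.
have [b0 [b1 ->]] := unram_decomp l_pr res_map units1 W0 vW (gpart n z).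
rewrite mulrDr mulrA sy_sq -mulrA -(unram_eps l_pr res_map units1) -rmorphM -mulrDr -rmorphD => h.
have [] := @unram_uniq l l_pr K v k res res_map units1 W W0 vW 0 (b0 + syk (-1) * b1).
  by rewrite rmorph0 add0r.
move=> _ /eqP; rewrite addr_eq0 => /eqP ->; exists (unram b1).
rewrite syN // (@syN1 'F_l K) mulrDl mulNr -(unram_eps l_pr res_map units1).
by rewrite (rmorphN unram) (rmorphM unram).
Qed.

Lemma koszul_extension_ideal (c : A) (hc : homogeneous 1 c) : koszul_module (principal_ideal hc).
Proof.
apply: koszul_pid; first exact: koszul_extension.
have [P0 vP] := unifP v.
(* [W] and [-W] alternate, both being uniformizers. The annihilators agree in all degrees, so [d] is
   free; [d = j.+1] leaves no condition on Tor of [k]. *)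
have ram W (hW : homogeneous (A := A) 1 (syK W)) i j : W != 0 -> v W = 1 -> j <> i.+1 ->
    tor_vanishes (principal_ideal hW) i j.
  elim: i W hW j => [|i IH] W hW j W0 vW ji; first exact: tor0_pid.
  apply: (pid_tor hW (hc' := sy_hom _ (- W)) (d := j.+1)) => [|n z _|j' jE|j' jE].
  - by rewrite syC sy_mulN oppr0.
  - exact: uniformizer_ann.
  - by apply: IH; rewrite ?oppr_eq0 ?dvalN // => E; apply: ji; rewrite jE E.
  by exfalso; lia.
move=> i j ij; have [x x0 cE] := deg1_sy hc; set n := v x.
have xE := sy_decomp l_pr res_map units1 P0 vP x0.
have chl : l \in [pchar 'F_l] by exact: pchar_Fp.
(* If [l] divides [v x], the symbol of [x] comes from the residue field. *)
have [n0|n0] := eqVneq (n%:~R : 'F_l) 0.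
  have {xE} cU : c = unram (syk (ac res (unif v) x)).
    by rewrite cE xE -/n -scaler_int n0 scale0r addr0.
  have [_ _ hB] := koszulB_ideal (sy_hom 'F_l (ac res (unif v) x)).
  by move: hc; rewrite cU => hc'; apply: (unram_ideal_tor _ (hc := sy_hom _ _)); exact: hB.
set a : 'F_l := n%:~R in n0.
have [m mE] : exists m : nat, m%:R = a^-1 :> 'F_l by exists (a^-1 : 'F_l); rewrite natr_Zp.
have [q qE] : exists q : int, m%:Z * n = 1 + q * l%:Z.
  have : (l %| m%:Z * n - 1)%Z.
    by rewrite (dvdz_pcharf chl) intrB intrM -pmulrn mE mulVf // subrr.
  by move=> /dvdzP[q qE]; exists q; rewrite -qE addrC subrK.
(* [m] inverts [v x] modulo [l], so [x ^+ m] has valuation [1 + q l]. The l-th power corrects it to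
   1 without changing the symbol, and [c] is a multiple of [{W}]. *)
pose W := x ^+ m * (unif v ^ (- q)) ^+ l.
have pq0 : unif v ^ (- q) != 0 by rewrite expfz_neq0.
have W0 : W != 0 by rewrite mulf_neq0 ?expf_neq0.
have vW : v W = 1.
  rewrite dvalM ?expf_neq0 // !dvalX // dvalXz // vP intz -/n.
  exact: bezout_mulrn.
have Wc : syK W = a^-1 *: c by rewrite sy_mulXl // syX // -cE -mE scaler_nat.
have cW : c = a *: syK W by rewrite Wc scalerA mulfV // scale1r.
case: i ij => [|i] ij; first exact: tor0_pid.
apply: (pid_tor hc (hc' := sy_hom _ (- W)) (d := j.+1)) => [|n' z _ h|j' jE|j' jE].
- by rewrite cW -scalerAr syC sy_mulN oppr0 scaler0.
- by apply: uniformizer_ann => //; rewrite Wc -scalerAr h scaler0.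
- by apply: ram; rewrite ?oppr_eq0 ?dvalN // => E; apply: ij; rewrite jE E.
by exfalso; lia.
Qed.
End HenselianTheorem.

(** 1 is a root of the reduction of [X^l - x], simple because [l] is invertible in [k]. *)
Lemma hensel_power (K : fieldType) (v : discreteValuation K) (k : fieldType)
    (res : {rmorphism valuationRing v -> k}) (l : nat) :
  henselian res -> prime l -> l \notin [pchar k] ->
  forall u, vge v 0 u -> resK res u = 1 -> exists y, u = y ^+ l.
Proof.
move=> hens lp lk u hu; have [x ->] := ringP hu; rewrite resKE => x1.
have l0 := prime_gt0 lp.
have mE : map_poly res ('X^l - x%:P) = 'X^l - 1.
  by rewrite rmorphB /= map_polyXn map_polyC /= x1.
have [||| y] := hens ('X^l - x%:P) 1.
- exact: monicXnsubC.
- by rewrite mE /root !hornerE expr1n subrr.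
- rewrite mE /root derivB derivXn derivC subr0 hornerMn hornerXn expr1n.
  by apply: contraNN lk => l0'; rewrite inE lp.
rewrite /root !hornerE subr_eq0 => /eqP yx _; exists (val y).
by rewrite -yx rmorphXn.
Qed.

(** * Symbols over local fields *)

Definition complete_val (K : fieldType) (v : discreteValuation K) :=
  forall u : nat -> K, (forall n : nat, vge v n (u n.+1 - u n)) ->
    exists x, forall n : nat, vge v n (x - u n).

(** * Complete fields: unit filtration and l-th powers *)

Section Complete.
Import Order.TTheory Num.Theory.
Variables (K : fieldType) (v : discreteValuation K) (cv : complete_val v).

Lemma vge_inf x : (forall n : nat, vge v n x) -> x = 0.
Proof.
move=> h; apply/eqP/negPn/negP => x0; have := h (absz (v x)).+1.
by rewrite vgeE //; lia.
Qed.

(** Successive approximation with dependent choices. The approximations are families, so that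
    several coordinates converge at once. Only closeness of the limit to good families is returned;
    each use adds its own continuity argument. *)
Lemma complete_iter (good : nat -> (nat -> K) -> Prop) s0 : good 0%N s0 ->
  (forall n s, good n s -> exists2 s', good n.+1 s' & forall j, vge v n (s' j - s j)) ->
  exists s, forall n, exists2 s', good n s' & forall j, vge v n (s j - s' j).
Proof.
move=> g0 step.
pose st n (s : {s | good n s}) : {s' | good n.+1 s'} :=
  let: exist s hs := s in let: exist2 s' hs' _ := cid2 (step n s hs) in exist _ s' hs'.
pose fix F n : {s | good n s} := if n is n'.+1 then st n' (F n') else exist _ s0 g0.
have FE (n : nat) j : vge v n (sval (F n.+1) j - sval (F n) j).
  by rewrite /=; case: (F n) => s hs; rewrite /st; case: cid2.
have /choice[s sP] j : exists x, forall n : nat, vge v n (x - sval (F n) j).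
  by apply: cv => n; exact: FE.
by exists s => n; exists (sval (F n)) => [|j]; [exact: svalP|exact: sP].
Qed.

(** For positive [i] these are the higher unit groups, 1 plus the i-th power of the maximal
    ideal. *)
Definition unit1 (i : nat) (u : K) := vge v i (u - 1).

Lemma unit1_le i j u : (i <= j)%N -> unit1 j u -> unit1 i u.
Proof. by move=> ij; apply: vge_le; lia. Qed.
Lemma unit1_val i u : (0 < i)%N -> unit1 i u -> u != 0 /\ v u = 0.
Proof.
move=> i0 hu; rewrite -[u](subrK 1) addrC -(dval1 v); apply: dval_lt_add; first exact: oner_neq0.
by rewrite dval1; apply: vge_le hu; lia.
Qed.
Lemma unit1_ge0 i u : (0 < i)%N -> unit1 i u -> vge v 0 u.
Proof. by move=> i0 /(unit1_val i0)[u0 vu]; rewrite vgeE // vu. Qed.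
Lemma unit1_1 i : unit1 i 1.
Proof. by rewrite /unit1 subrr vge0. Qed.
Lemma unit1M i u w : unit1 i u -> unit1 i w -> unit1 i (u * w).
Proof.
move=> hu hw; rewrite /unit1.
have -> : u * w - 1 = (u - 1) * (w - 1) + ((u - 1) + (w - 1)) by ring.
apply: vgeD; last exact: vgeD.
by apply: (vge_le _ (vgeM hu hw)); lia.
Qed.
Lemma unit1_div i u w : (0 < i)%N -> unit1 1 w -> vge v i (u - w) -> unit1 i (u / w).
Proof.
move=> i0 hw huw; have [w0 vw] := unit1_val (isT : (0 < 1)%N) hw.
have -> : unit1 i (u / w) = vge v i ((u - w) / w) by rewrite /unit1 mulrBl divff.
by rewrite -[X in vge _ X]addr0; apply: vgeM => //; rewrite vgeE ?invr_eq0 // dvalV // vw.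
Qed.
Lemma unit1X i u n : unit1 i u -> unit1 i (u ^+ n).
Proof. by move=> hu; elim: n => [|n IH]; [exact: unit1_1|rewrite exprS; exact: unit1M]. Qed.

Lemma vge_expB N n x y : vge v 0 x -> vge v 0 y -> vge v N (x - y) -> vge v N (x ^+ n - y ^+ n).
Proof.
move=> hx hy h; rewrite subrXX -[N]addr0; apply: vgeM => //; apply: vge_sum => i _.
by rewrite -[0]addr0; apply: vgeM; exact: vgeX0.
Qed.

Section Powers.
Variables (l : nat) (l_pr : prime l) (e : nat).
Hypothesis le : vge v e (l%:R).

(** The intermediate binomial coefficients are divisible by [l] and come with at least two factors
    [x]. *)
Lemma bin_prime (j : nat) (x : K) : vge v j x ->
  vge v (e + 2 * j)%N ((1 + x) ^+ l - (1 + x *+ l + x ^+ l)).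
Proof.
move=> hx; rewrite exprDn; have l1 := prime_gt1 l_pr.
have -> : l.+1 = (2 + (l.-2 + 1))%N by lia.
rewrite big_split_ord /= !big_ord_recl big_ord0 /= !expr1n !mul1r expr0 bin0 bin1 mulr1n expr1 addr0.
rewrite big_split_ord /= big_ord_recl big_ord0 addr0 /=.
have -> : (2 + (l.-2 + 0))%N = l by lia.
rewrite subnn expr0 mul1r binn mulr1n; set S := \sum_(_ < _) _.
have -> : 1 + x *+ l + (S + x ^+ l) - (1 + x *+ l + x ^+ l) = S by ring.
rewrite {}/S.
apply: vge_sum => m _; rewrite expr1n mul1r; set n := (2 + m)%N.
have n2 : (2 <= n)%N by rewrite leq_addr.
have nl : (n < l)%N by rewrite /n; have := ltn_ord m; lia.
have [q ->] : exists q, 'C(l, n) = (l * q)%N.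
  have /dvdnP[q ->] : (l %| 'C(l, n))%N by apply: prime_dvd_bin; rewrite // nl (ltn_trans _ n2).
  by exists q; rewrite mulnC.
rewrite mulrnA; apply: vge_natmul; rewrite -mulr_natr.
apply: (vge_le _ (vgeM (vgeX n hx) le)); have : (2 * j <= n * j)%N by rewrite leq_mul2r n2 orbT.
by rewrite -mulr_natr natz -PoszM; lia.
Qed.
End Powers.

Section Roots.
Variables (l : nat) (l_pr : prime l) (e : nat).
Hypotheses (l0 : (l%:R : K) != 0) (vl : v l%:R = e).

(** Above level [l e / (l - 1)] the linear term of [(1 + x)^l] dominates: dividing [u - 1] by [l]
    lowers the level by [e], and the resulting approximate root is wrong by a factor one level
    higher. *)
Lemma unit1_root i : (l * e < l.-1 * i)%N -> (0 < i)%N -> forall u, unit1 i u -> exists y, u = y ^+ l.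
Proof.
move=> hi i0 u hu; have l1 := prime_gt1 l_pr.
have le : vge v e l%:R by rewrite vgeE // vl.
have ie : (e < i)%N.
  rewrite ltnNge; apply/negP => ie; have : (l.-1 * i <= l.-1 * e)%N by rewrite leq_mul2l ie orbT.
  have : (l.-1 * e <= l * e)%N by rewrite leq_mul2r leq_pred orbT.
  lia.
have step m u' : (i <= m)%N -> unit1 m u' ->
    exists2 z, unit1 (m - e) z & unit1 m.+1 (u' / z ^+ l).
  move=> im hu'; set a := u' - 1; have hz : vge v (m - e)%N (a / l%:R).
    have -> : ((m - e)%N : int) = (m : int) + - (e : int) by lia.
    by apply: vgeM; rewrite // vgeE ?invr_eq0 // dvalV // vl.
  exists (1 + a / l%:R); first by rewrite /unit1 addrAC subrr add0r.
  have me : (0 < m - e)%N by lia.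
  apply: unit1_div => //.
    by apply: unit1X; rewrite /unit1 addrAC subrr add0r; apply: vge_le hz; lia.
  have E : 1 + (a / l%:R) *+ l = u' by rewrite -mulr_natr divfK // /a addrC subrK.
  have := bin_prime l_pr le hz; rewrite E => h.
  set t := a / l%:R in h hz *; rewrite -vgeN opprB.
  have -> : (1 + t) ^+ l - u' = ((1 + t) ^+ l - (u' + t ^+ l)) + t ^+ l by ring.
  apply: vgeD; first by apply: vge_le h; lia.
  apply: vge_le (vgeX l hz); rewrite -mulr_natr natz -PoszM.
  have : (l.-1 * i <= l.-1 * m)%N by rewrite leq_mul2l im orbT.
  rewrite [((m - e) * l)%N]mulnC mulnBr; have -> : (l * m = l.-1 * m + m)%N by rewrite -[in LHS](prednK (ltnW l1)) mulSn addnC.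
  lia.
pose good n (s : nat -> K) := unit1 1 (s 0%N) /\ unit1 (i + n) (u / s 0%N ^+ l).
have [||s sP] := @complete_iter good (fun=> 1).
- by split; [exact: unit1_1|rewrite expr1n divr1 addn0].
- move=> n s [s1 su]; have [z hz zu] := step _ _ (leq_addr n i) su.
  exists (fun j => if j is 0%N then s 0%N * z else s j) => [|j]; last first.
    case: j => [|j]; last by rewrite subrr vge0.
    rewrite (_ : _ - _ = s 0%N * (z - 1)); last by rewrite mulrBr mulr1.
    rewrite -[n : int]add0r; apply: vgeM; first by apply: (unit1_ge0 _ s1).
    by apply: vge_le hz; lia.
  split; first by apply: unit1M => //; apply: unit1_le hz; lia.
  by rewrite exprMn invfM mulrA addnS.
exists (s 0%N); apply/subr0_eq/vge_inf => n.
have [s' [s1 su] ss] := sP n.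
have [n0|n0] := posnP n.
  rewrite n0; apply: vgeB; first exact: unit1_ge0 hu.
  have -> : s 0%N = (s 0%N - s' 0%N) + s' 0%N by rewrite subrK.
  by apply: vgeX0; apply: vgeD; [apply: vge_le (ss 0%N)|exact: unit1_ge0 s1].
have g' : vge v 0 (s' 0%N) by exact: unit1_ge0 s1.
have g : vge v 0 (s 0%N).
  by rewrite -(subrK (s' 0%N) (s 0%N)); apply: vgeD => //; apply: vge_le (ss 0%N).
have -> : u - s 0%N ^+ l = (u / s' 0%N ^+ l - 1) * s' 0%N ^+ l - (s 0%N ^+ l - s' 0%N ^+ l).
  have [s0 _] := unit1_val (isT : (0 < 1)%N) s1.
  by rewrite mulrBl mul1r divfK ?expf_neq0 //; ring.
apply: vgeB; last exact: vge_expB.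
rewrite -[n : int]addr0; apply: vgeM; last exact: vgeX0.
by apply: vge_le su; lia.
Qed.
End Roots.
End Complete.

(** * Symbols over finite fields *)

Section FiniteField.
Variables (l : nat) (l_pr : prime l) (k : finFieldType).
Local Notation syk := (@sy 'F_l k).

Lemma finField_gen : exists2 g : k, g != 0 & forall a, a != 0 -> exists n : nat, a = g ^+ n.
Proof.
have /cyclicP[g gE] := field_unit_group_cyclic [set: {unit k}]%G.
exists (FinRing.uval g) => [|a a0]; first by rewrite -unitfE; exact: (valP g).
have ua : a \is a GRing.unit by rewrite unitfE.
have : FinRing.unit k ua \in <[g]>%g by rewrite -gE inE.
by move=> /cycleP[n /(congr1 (@FinRing.uval k)) E]; exists n; exact: (etrans E (FinRing.val_unitX _ _)).
Qed.

(** All reduces to [{g, g}] for a generator [g], killed by anticommutativity for odd [l]. If [l = 2]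
    and [g] is not a square, some [x] and [1 - x] are both nonsquares, with symbol [{g}]: otherwise
    [x |-> 1 - x] embeds the nonsquares into the nonzero squares other than 1, while multiplication
    by [g] embeds the nonzero squares into the nonsquares. *)
Lemma finField_symbols0 a b : syk a * syk b = 0.
Proof.
have [a0|a0] := eqVneq a 0; first by rewrite a0 sy0 mul0r.
have [b0|b0] := eqVneq b 0; first by rewrite b0 sy0 mulr0.
have [g g0 gP] := finField_gen.
suff gg : syk g * syk g = 0.
  have [n ->] := gP a a0; have [m ->] := gP b b0.
  by rewrite !syX // mulrnAl mulrnAr gg !mul0rn.
have [l2|lo] := even_prime l_pr; last exact: sy_sq_odd.
have syX2 (x : k) : syk (x ^+ 2) = 0.
  by rewrite -[in X in _ ^+ X]l2 syXl.
pose sq (x : k) := [exists y, x == y ^+ 2].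
have [sg|nsg] := boolP (sq g).
  by have /existsP[y /eqP ->] := sg; rewrite syX2 mul0r.
have odd_class x : x != 0 -> ~~ sq x -> syk x = syk g.
  move=> x0; have [n ->] := gP x x0; rewrite -(odd_double_half n) exprD.
  case: (odd n) => /= [_|/existsP[]]; last first.
    by exists (g ^+ n./2); rewrite expr0 mul1r -exprM muln2.
  by rewrite expr1 -muln2 exprM syM ?expf_neq0 // syX2 addr0.
suff [x x0 [x1 nx ny]] : exists2 x, x != 0 & [/\ 1 - x != 0, ~~ sq x & ~~ sq (1 - x)].
  by rewrite -{1}(odd_class x x0 nx) -(odd_class _ x1 ny) sy_steinberg.
pose N := [set x | ~~ sq x]; pose S := [set x | (x != 0) && sq x].
apply: contrapT => h.
have S1 : 1 \in S by rewrite inE oner_eq0; apply/existsP; exists 1; rewrite expr1n.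
have nz x : ~~ sq x -> x != 0.
  by apply: contraNneq => ->; apply/existsP; exists 0; rewrite expr0n.
have NS : [set 1 - x | x in N] \subset S :\ 1.
  apply/subsetP => y /imsetP[x]; rewrite inE => nx ->; have x0 := nz x nx.
  have x1 : 1 - x != 0.
    by rewrite subr_eq0; apply: contraNneq nx => <-; apply/existsP; exists 1; rewrite expr1n.
  rewrite !inE x1 /= -subr_eq0 addrAC subrr sub0r oppr_eq0 x0 /=.
  by apply: contrapT => /negP ny; apply: h; exists x => //; split.
have SN : [set g * x | x in S] \subset N.
  apply/subsetP => y /imsetP[x]; rewrite !inE => /andP[x0 /existsP[z /eqP xz]] ->.
  apply: contraNN nsg => /existsP[t /eqP gE]; apply/existsP; exists (t / z).
  by rewrite expr_div_n -gE xz mulfK // -xz.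
have := subset_leq_card NS; rewrite card_imset; last by move=> x y /addrI/oppr_inj.
have := subset_leq_card SN; rewrite card_imset; last exact: mulfI.
by move=> h1 h2; have := leq_trans h1 h2; rewrite [X in (X <= _)%N](cardsD1 1) S1 ltnn.
Qed.

Lemma finField_root (p : nat) (a : k) : p \in [pchar k] -> exists b, a = b ^+ p.
Proof.
move=> pk; have inj : injective (fun x : k => x ^+ p).
  move=> x y xy; apply/subr0_eq/eqP; have := pFrobenius_autB_comm pk (mulrC x y).
  by rewrite !pFrobenius_autE xy subrr => /eqP; rewrite expf_eq0 => /andP[].
by exists (invF inj a); rewrite (f_invF inj).
Qed.
End FiniteField.

(** * Symbols lying on a line *)

Section Symbols1.
Variables (l : nat) (l_pr : prime l) (K : fieldType).
Local Notation A := (milnorK 'F_l K).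
Local Notation sy := (@sy 'F_l K).

Definition rank1 := exists s : A, forall c d, exists a : 'F_l, sy c * sy d = a *: s.

Lemma rank1_dim : rank1 -> forall a b c d, sy a * sy b <> 0 -> exists m, sy c * sy d = sy a * sy b *+ m.
Proof.
move=> [s sP] a b c d; have [x ->] := sP a b; have [y ->] := sP c d => xs.
have x0 : x != 0 by apply/eqP => x0; apply: xs; rewrite x0 scale0r.
by exists (y / x : 'F_l); rewrite -milnor_scaleE scalerA divfK.
Qed.

Definition line (s x : A) := exists a : 'F_l, x = a *: s.
Lemma line0 s : line s 0. Proof. by exists 0; rewrite scale0r. Qed.
Lemma lineD s x y : line s x -> line s y -> line s (x + y).
Proof. by move=> [a ->] [b ->]; exists (a + b); rewrite scalerDl. Qed.
Lemma lineZ s a x : line s x -> line s (a *: x).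
Proof. by move=> [b ->]; exists (a * b); rewrite scalerA. Qed.
Lemma lineN s x : line s x -> line s (- x).
Proof. by move=> h; rewrite -scaleN1r; exact: lineZ. Qed.
Lemma linez s x n : line s x -> line s (x *~ n).
Proof. by move=> h; rewrite -scaler_int; exact: lineZ. Qed.

(* The Steinberg relation for (1-a)/(1-ab) + a(1-b)/(1-ab) = 1 puts {1-a, 1-b} into {1-ab, K}. *)
Lemma sy_one_sub s (a b : K) : a != 0 -> 1 - a != 0 -> 1 - b != 0 -> 1 - a * b != 0 ->
  (forall y, y != 0 -> line s (sy (1 - a * b) * sy y)) -> line s (sy (1 - a) * sy (1 - b)).
Proof.
move=> a0 x0 y0 z0 h; set X := 1 - a in x0 *; set Y := 1 - b in y0 *; set Z := 1 - a * b in z0 h *.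
have st : sy (X / Z) * sy (a * Y / Z) = 0.
  apply: sy_steinbergD; rewrite -mulrDl.
  have -> : X + a * Y = Z by rewrite /X /Y /Z mulrBr mulr1 addrA subrK.
  by rewrite divff.
have Xa : sy X * sy a = 0 by rewrite syC sy_steinberg oppr0.
have E : sy X * sy Y = sy X * sy Z + (sy Z * sy a + sy Z * sy Y - sy Z * sy Z).
  move: st; rewrite !syM ?mulf_neq0 ?invr_eq0 // !syV mulrBl !mulrBr !mulrDr Xa add0r => /eqP.
  rewrite subr_eq0 => /eqP => E; rewrite -[LHS](subrK (sy X * sy Z)) E.
  by rewrite addrC.
rewrite E [sy X * _]syC; apply: lineD; first by apply/lineN/h.
by apply: lineD; [apply: lineD; exact: h|apply/lineN/h].
Qed.
End Symbols1.

Lemma int_succ_le (i : nat) (z : int) : (i%:Z <= z)%O -> z != i%:Z -> (i.+1%:Z <= z)%O.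
Proof. by move=> iz zi; have : (i%:Z < z)%O; [rewrite Order.POrderTheory.lt_neqAle eq_sym zi|lia]. Qed.

(** * Local symbols: the tame case, and reduction of the wild case to 1-units *)

Section LocalSymbols.
Import Order.TTheory Num.Theory.
Variables (K : fieldType) (v : discreteValuation K) (cv : complete_val v).
Variables (k : finFieldType) (res : {rmorphism valuationRing v -> k}) (res_map : is_residue_map res).
Variables (l : nat) (l_pr : prime l).
Local Notation A := (milnorK 'F_l K).
Local Notation syk := (@sy 'F_l k).
Local Notation sy := (@sy 'F_l K).
Local Notation resK := (resK res).

Lemma resK_nat n : resK n%:R = n%:R.
Proof.
elim: n => [|n IH]; first by apply/(resK_eq0 res_map); exact: vge0.
by rewrite -addn1 !natrD resKD ?vge_nat ?vge1 // IH resK1.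
Qed.

Lemma unit1E u : unit1 v 1 u <-> vge v 0 u /\ resK u = 1.
Proof.
split=> [hu|[hu u1]].
  have g : vge v 0 u by exact: unit1_ge0 hu.
  by split=> //; rewrite -(resK1 res); apply/(resK_eq res_map g (vge1 v)).
by apply/(resK_eq res_map hu (vge1 v)); rewrite u1 resK1.
Qed.

Section Tame.
Hypothesis lk : l%:R != 0 :> k.

Lemma tame_units1 u : vge v 0 u -> resK u = 1 -> exists y, u = y ^+ l.
Proof.
move=> hu u1; have lv : vge v 0 (l%:R : K) by exact: vge_nat.
have [lK vl] : (l%:R : K) != 0 /\ v l%:R = 0.
  by apply: (resK_neq0E res_map lv); rewrite resK_nat.
have uu : unit1 v 1 u by apply/unit1E.
apply: (@unit1_root K v cv l l_pr 0 lK _ 1%N _ isT u uu); first by rewrite vl.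
by rewrite muln0 muln1; have := prime_gt1 l_pr; lia.
Qed.

Lemma tame_neg1 : sy (- 1) * sy (- 1) = 0.
Proof.
by rewrite -(unram_eps l_pr res_map tame_units1) -rmorphM finField_symbols0 // rmorph0.
Qed.

(** Products of unramified symbols vanish and [w w = w {-1}], so every symbol is [w] times an
    unramified class; those are multiples of the class of a generator of the residue field. *)
Lemma rank1_tame : rank1 l K.
Proof.
have [W0 vW] := unifP v; have [g g0 gP] := finField_gen k.
pose U := unram l_pr res_map tame_units1; pose w := sy (unif v).
have Uw b : U (syk b) * w = - (w * U (syk b)).
  have [->|b0] := eqVneq b 0; first by rewrite sy0 rmorph0 mul0r mulr0 oppr0.
  by rewrite /U unram_sy // syC.
exists (w * U (syk g)) => c d.
have wU b n : b != 0 -> line (w * U (syk g)) ((w * U (syk b)) *~ n).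
  move=> b0; apply: linez; have [m ->] := gP b b0; rewrite syX // rmorphMn mulrnAr.
  by exists m%:R; rewrite scaler_nat.
have [->|c0] := eqVneq c 0; first by rewrite sy0 mul0r; exact: line0.
have [->|d0] := eqVneq d 0; first by rewrite sy0 mulr0; exact: line0.
rewrite (sy_decomp l_pr res_map tame_units1 W0 vW c0) (sy_decomp l_pr res_map tame_units1 W0 vW d0).
rewrite -/U -/w mulrDl !mulrDr -rmorphM finField_symbols0 // rmorph0 add0r.
have a0 := ac_neq0 res_map W0 vW.
apply: lineD; last apply: lineD.
- by rewrite mulrzAr Uw mulNrz; apply: lineN; apply: wU; exact: a0.
- by rewrite mulrzAl; apply: wU; exact: a0.
rewrite mulrzAl mulrzAr -mulrzA sy_sq -(unram_eps l_pr res_map tame_units1).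
by apply: wU; rewrite oppr_eq0 oner_eq0.
Qed.
End Tame.

Section Wild.
Hypothesis lk : l \in [pchar k].

(** The residue field is perfect, so the residue of [x] is an l-th power. *)
Lemma unit_power x : x != 0 -> v x = 0 -> exists b u, [/\ b != 0, v b = 0, unit1 v 1 u & x = b ^+ l * u].
Proof.
move=> x0 vx; have hx : vge v 0 x by rewrite vgeE // vx.
have rx := resK_neq0 res_map x0 vx.
have [b rb] := finField_root (resK x) lk; have [y hy yb] := resK_surj res_map b.
have b0 : b != 0 by apply: contraNneq rx => b0; rewrite rb b0 expr0n gtn_eqF ?prime_gt0.
have [|y0 vy] := resK_neq0E res_map hy; first by rewrite yb.
exists y, (x / y ^+ l); split=> //; last by rewrite mulrC divfK // expf_neq0.
have hyl : vge v 0 (y ^+ l) by exact: vgeX0.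
have rX n : resK (y ^+ n) = resK y ^+ n.
  by elim: n => [|n IH]; rewrite ?resK1 // !exprS resKM ?IH // vgeX0.
have hi : vge v 0 (y ^+ l)^-1 by rewrite vgeE ?invr_eq0 ?expf_neq0 // dvalV ?expf_neq0 // dvalX // vy mul0rn.
apply/unit1E; split; first by rewrite -[0]addr0; apply: vgeM.
rewrite resKM // rb -yb -rX -(resKM res hyl hi) divff ?expf_neq0 //.
by rewrite resK1.
Qed.

Variables (W : K) (W0 : W != 0) (vW : v W = 1).
Local Notation w := (sy W).

Lemma sy_wild y : y != 0 -> exists2 u, unit1 v 1 u & sy y = w *~ v y + sy u.
Proof.
move=> y0; have [||b [u [b0 _ hu E]]] := @unit_power (y * W ^ (- v y)).
- by rewrite mulf_neq0 ?expfz_neq0.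
- by rewrite dvalM ?expfz_neq0 // dvalXz // vW intz addrN.
exists u => //; have [u0 _] := unit1_val (isT : (0 < 1)%N) hu.
have -> : sy y = sy (u * b ^+ l * W ^ (v y)).
  by rewrite [u * _]mulrC -E -mulrA -expfzDr // addNr expr0z mulr1.
rewrite syM ?mulf_neq0 ?expf_neq0 ?expfz_neq0 // sy_mulXl // addrC; congr (_ + _).
case: (v y) => n; first by rewrite -exprnP syX.
by rewrite NegzE -exprnN syV syX // mulrNz.
Qed.

Variable s : A.
Definition in_line i := forall u y, unit1 v i u -> y != 0 -> line s (sy u * sy y).

(** With [u = 1 - a] and [u' = 1 - b], the unit [1 - a b] has level [i + j], at least [i.+1], and
    [sy_one_sub] applies. *)
Lemma line_unit1 i j u u' : in_line i.+1 -> (0 < i)%N -> (0 < j)%N ->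
  unit1 v i u -> unit1 v j u' -> line s (sy u * sy u').
Proof.
move=> IH i0 j0 hu hu'; have [u0 _] := unit1_val i0 hu; have [u0' _] := unit1_val j0 hu'.
pose a := 1 - u; pose b := 1 - u'.
have [a0|a0] := eqVneq a 0.
  by move/eqP: a0; rewrite subr_eq0 => /eqP <-; rewrite sy1 mul0r; exact: line0.
have ua : u = 1 - a by rewrite /a opprB addrC subrK.
have ub : u' = 1 - b by rewrite /b opprB addrC subrK.
have hab : unit1 v i.+1 (1 - a * b).
  have -> : unit1 v i.+1 (1 - a * b) = vge v i.+1 (a * b).
    by rewrite /unit1 addrAC subrr add0r vgeN.
  have ha : vge v i a by rewrite -vgeN opprB.
  have hb : vge v j b by rewrite -vgeN opprB.
  by apply: (vge_le _ (vgeM ha hb)); rewrite -PoszD lez_nat -addn1 leq_add2l.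
rewrite ua ub; apply: sy_one_sub => //; rewrite -?ua -?ub //.
  by have [] := unit1_val (isT : (0 < i.+1)%N) hab.
by move=> y y0; apply: IH.
Qed.

(* If l does not divide i = v a, the relation {1 - a, a} = 0 trades {1 - a, W} for symbols of 1-units. *)
Lemma wild_step i : (0 < i)%N -> in_line i.+1 ->
  (forall u, unit1 v i u -> ~~ (l %| i)%N \/ exists z u', [/\ z != 0, unit1 v i.+1 u' & u = u' * z ^+ l]) ->
  in_line i.
Proof.
move=> i0 IH h u y hu y0; have [li|[z [u' [z0 hu' ->]]]] := h u hu; last first.
  by rewrite sy_mulXl //; exact: IH.
have [u1 hu1 ->] := sy_wild y0; rewrite mulrDr mulrzAr.
apply: lineD; last exact: (line_unit1 IH i0 (isT : (0 < 1)%N)).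
apply: linez; pose a := 1 - u; have [a0|a0] := eqVneq a 0.
  by move/eqP: a0; rewrite subr_eq0 => /eqP <-; rewrite sy1 mul0r; exact: line0.
have ha : vge v i a by rewrite -vgeN opprB.
case: (eqVneq (v a) (i : int)) => [va|va]; last first.
  apply: IH => //; rewrite /unit1 -vgeN opprB vgeE //; rewrite vgeE // in ha.
  exact: int_succ_le.
have Na0 : - a != 0 by rewrite oppr_eq0.
have [u2 hu2 aE] := sy_wild Na0.
have st : sy u * sy a = 0 by rewrite syC; have := sy_steinberg 'F_l a; rewrite {2}/a opprB addrC subrK => ->; rewrite oppr0.
have [u3 hu3 aE3] := sy_wild a0.
have : line s (sy u * w *+ i).
  move: st; rewrite aE3 va mulrDr mulrzAr => /eqP; rewrite addr_eq0 => /eqP.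
  rewrite -pmulrn => ->; apply: lineN.
  exact: (line_unit1 IH i0 (isT : (0 < 1)%N)).
have chl : l \in [pchar 'F_l] by exact: pchar_Fp.
have li0 : (i%:R : 'F_l) != 0 by rewrite -(dvdn_pcharf chl).
rewrite -scaler_nat => /(lineZ (i%:R : 'F_l)^-1); rewrite scalerA mulVf // scale1r.
exact.
Qed.

(** What is left after the terms with a 1-unit is a multiple of [{W, W} = {W, -1}], and [{-1}] is
    itself the symbol of a 1-unit. *)
Lemma wild_line : in_line 1 -> forall c d, line s (sy c * sy d).
Proof.
move=> L1 c d; have [->|c0] := eqVneq c 0; first by rewrite sy0 mul0r; exact: line0.
have [->|d0] := eqVneq d 0; first by rewrite sy0 mulr0; exact: line0.
have [u hu ->] := sy_wild c0; have [u' hu' E] := sy_wild d0.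
have N1 : - 1 != 0 :> K by rewrite oppr_eq0 oner_eq0.
have [e he eE] := sy_wild N1; have Le y : y != 0 -> line s (sy e * sy y) by exact: L1.
rewrite mulrDl; apply: lineD; last exact: L1.
have u0' := (unit1_val (isT : (0 < 1)%N) hu').1.
rewrite mulrzAl; apply: linez; rewrite E mulrDr mulrzAr; apply: lineD; last first.
  by rewrite syC; apply: lineN; exact: L1.
apply: linez; rewrite sy_sq eE (dvalN1 v) mulr0z add0r syC; apply: lineN; exact: L1.
Qed.
End Wild.
End LocalSymbols.

(** * An additive polynomial over a finite field *)

Section ArtinSchreierCokernel.
Variables (l : nat) (l_pr : prime l) (k : finFieldType) (lk : l \in [pchar k]) (c : k).
Let H (b : k) := b ^+ l + c * b.

Lemma as_mapD : {morph H : a b / a + b}.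
Proof.
move=> a b; rewrite /H mulrDr addrACA; congr (_ + _).
by have := pFrobenius_autD_comm lk (mulrC a b); rewrite !pFrobenius_autE.
Qed.
Lemma as_map_muln a n : H (a *+ n) = H a *+ n.
Proof.
elim: n => [|n IH]; last by rewrite !mulrS as_mapD IH.
by rewrite !mulr0n /H mulr0 addr0 expr0n gtn_eqF ?prime_gt0.
Qed.

(** The additive map [H] has fibres of at most [l] elements, which bounds its image from below. If
    [g] is outside the image, its multiples by 0, ..., l - 1 lie in distinct cosets of the image,
    and by counting these cosets fill [k]. *)
Lemma as_coker : exists g, forall a, exists n b, a = g *+ n + H b.
Proof.
have [all_im|/existsNP[g gH]] := pselect (forall a, exists b, a = H b).
  by exists 0 => a; have [b ->] := all_im a; exists 0%N, b; rewrite mulr0n add0r.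
exists g => a.
pose Im := [set H b | b : k].
have fiber y : (#|[set b | H b == y]| <= l)%N.
  pose q : {poly k} := 'X^l + c *: 'X - y%:P.
  have l1 := prime_gt1 l_pr.
  have sq : size q = l.+1.
    rewrite /q -addrA size_polyDl size_polyXn //.
    apply: leq_ltn_trans (size_polyD _ _) _; rewrite size_polyN gtn_max; apply/andP; split.
      by apply: leq_ltn_trans (size_scale_leq _ _) _; rewrite size_polyX ltnS.
    by apply: leq_ltn_trans (size_polyC_leq1 _) _; rewrite ltnS ltnW.
  have q0 : q != 0 by rewrite -size_poly_gt0 sq.
  rewrite cardE -ltnS -sq; apply: max_poly_roots => //; last exact: enum_uniq.
  apply/allP => b; rewrite mem_enum inE => /eqP Hb.
  by rewrite /root /q !hornerE -/(H b) Hb subrr.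
have cardIm : (#|k| <= l * #|Im|)%N.
  rewrite -cardsT -sum1_card (partition_big H (mem Im)) /=; last by move=> b _; exact: imset_f.
  rewrite mulnC -sum_nat_const; apply: leq_sum => y _.
  rewrite sum1_card; apply: leq_trans (fiber y).
  by apply: subset_leq_card; apply/subsetP => b; rewrite unfold_in => /andP[_ h]; rewrite inE.
pose f (x : 'I_l * k) := g *+ x.1 + x.2.
have finj : {in setX [set: 'I_l] Im &, injective f}.
  (* If two of these multiples shared a coset, a multiple of [g] by a number prime to [l] would lie
     in the image, hence so would [g]. *)
  have key (m n : 'I_l) y z : (m < n)%N -> g *+ m + H y = g *+ n + H z -> False.
    move=> mn E; have d0 : (0 < n - m)%N by rewrite subn_gt0.
    have gd : g *+ (n - m) = H (y - z).
      have HN : H (- z) = - H z by apply/eqP; rewrite -addr_eq0 -as_mapD addNr -(mulr0n 0) as_map_muln.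
      by rewrite as_mapD HN mulrnBr ?(ltnW mn) //; apply/eqP; rewrite subr_eq addrAC eq_sym subr_eq addrC E addrC.
    have cop : coprime (n - m) l.
      rewrite coprime_sym prime_coprime // gtnNdvd //.
      by apply: leq_ltn_trans (leq_subr _ _) _; exact: ltn_ord.
    have /(coprimeP _ d0)[[u w] /= uw] := cop.
    apply: gH; exists ((y - z) *+ u); rewrite as_map_muln -gd -mulrnA.
    have uE : ((n - m) * u = 1 + w * l)%N by rewrite mulnC; lia.
    by rewrite uE mulrnDr mulr1n mulrnA -[X in _ + X]mulr_natr (pcharf0 lk) mulr0 addr0.
  move=> [m y'] [n z']; rewrite !inE /= => /imsetP[y _ ->] /imsetP[z _ ->] E.
  case: (ltngtP m n) => [mn|nm|/val_inj mn].
  - by case: (key _ _ _ _ mn E).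
  - by case: (key _ _ _ _ nm (esym E)).
  by move: E; rewrite /f mn /= => /addrI ->.
have : a \in f @: setX [set: 'I_l] Im.
  have /eqP -> : f @: setX [set: 'I_l] Im == [set: k].
    by rewrite eqEcard subsetT card_in_imset // cardsX !cardsT card_ord.
  exact: in_setT.
move=> /imsetP[[n y]]; rewrite !inE /= => /imsetP[b _ ->] ->.
by exists n, b.
Qed.
End ArtinSchreierCokernel.

(** * Wild symbols in characteristic zero *)

Section WildCharZero.
Import Order.TTheory Num.Theory.
Variables (K : fieldType) (v : discreteValuation K) (cv : complete_val v).
Variables (k : finFieldType) (res : {rmorphism valuationRing v -> k}) (res_map : is_residue_map res).
Variables (l : nat) (l_pr : prime l) (lk : l \in [pchar k]).
Local Notation A := (milnorK 'F_l K).
Local Notation sy := (@sy 'F_l K).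
Local Notation resK := (resK res).
Variables (W : K) (W0 : W != 0) (vW : v W = 1).
Local Notation w := (sy W).

(** For positive [i] this induces the isomorphism of the units of level [i] modulo level [i.+1] with
    the residue field. *)
Definition unit_res i (u : K) := resK ((u - 1) / W ^+ i).

Lemma vge_divW (i : nat) x : vge v i x -> vge v 0 (x / W ^+ i).
Proof.
move=> hx; rewrite -[0](subrr (i : int)); apply: vgeM => //.
by rewrite vgeE ?invr_eq0 ?expf_neq0 // dvalV ?expf_neq0 // dvalX // vW natz.
Qed.
Lemma vge_mulW (i : nat) (n : int) x : vge v n x -> vge v (n + i) (x * W ^+ i).
Proof. by move=> hx; apply: vgeM; rewrite // vgeE ?expf_neq0 // dvalX // vW natz. Qed.

Lemma vge_mulW0 (i : nat) x : vge v 0 x -> vge v i (x * W ^+ i).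
Proof. by move/(vge_mulW i); rewrite add0r. Qed.
Lemma vge_mulW1 (i : nat) x : vge v 1 x -> vge v i.+1 (x * W ^+ i).
Proof. by move/(vge_mulW i); rewrite -PoszD. Qed.

Lemma unit_res0 i u : unit1 v i u -> unit_res i u = 0 <-> unit1 v i.+1 u.
Proof.
move=> hu; rewrite /unit_res (resK_eq0 res_map (vge_divW hu)) /unit1.
have Wi : W ^+ i != 0 by rewrite expf_neq0.
split=> h; first by have := vge_mulW i h; rewrite divfK // => h'; apply: vge_le h'; lia.
have -> : (1 : int) = i.+1%:Z + - i%:Z by lia.
apply: vgeM => //.
by rewrite vgeE ?invr_eq0 ?expf_neq0 // dvalV ?expf_neq0 // dvalX // vW natz.
Qed.

Lemma unit_res_eq i u u' : unit1 v i u -> unit1 v i u' ->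
  unit_res i u = unit_res i u' <-> vge v i.+1 (u - u').
Proof.
move=> hu hu'; have Wi : W ^+ i != 0 by rewrite expf_neq0.
rewrite /unit_res (resK_eq res_map (vge_divW hu) (vge_divW hu')).
have -> : (u - 1) / W ^+ i - (u' - 1) / W ^+ i = (u - u') / W ^+ i.
  by rewrite -mulrBl; congr (_ / _); ring.
split=> h; first by have := vge_mulW i h; rewrite divfK // => h'; apply: vge_le h'; lia.
have -> : (1 : int) = i.+1%:Z + - i%:Z by lia.
apply: vgeM => //.
by rewrite vgeE ?invr_eq0 ?expf_neq0 // dvalV ?expf_neq0 // dvalX // vW natz.
Qed.

Lemma unit_resM i u u' : (0 < i)%N -> unit1 v i u -> unit1 v i u' ->
  unit_res i (u * u') = unit_res i u + unit_res i u'.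
Proof.
move=> i0 hu hu'; rewrite /unit_res -(resKD res (vge_divW hu) (vge_divW hu')) -mulrDl.
have E : u * u' - 1 = ((u - 1) + (u' - 1)) + (u - 1) * (u' - 1) by ring.
have h1 : vge v i ((u - 1) + (u' - 1)) by exact: vgeD.
have h2 : vge v i.+1 ((u - 1) * (u' - 1)) by apply: vge_le (vgeM hu hu'); lia.
have h3 : vge v i ((u - 1) * (u' - 1)) by apply: vge_le h2; lia.
rewrite E [in LHS]mulrDl (resKD res (vge_divW h1) (vge_divW h3)).
have /(unit_res0 _) : unit1 v i.+1 (1 + (u - 1) * (u' - 1)) by rewrite /unit1 addrAC subrr add0r.
rewrite /unit_res addrAC subrr add0r => ->; first by rewrite addr0.
by rewrite /unit1 addrAC subrr add0r.
Qed.

Lemma unit_resX i u n : (0 < i)%N -> unit1 v i u -> unit_res i (u ^+ n) = unit_res i u *+ n.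
Proof.
move=> i0 hu; elim: n => [|n IH].
  by rewrite expr0 mulr0n; apply/(unit_res0 (unit1_1 _ _)); exact: unit1_1.
by rewrite exprS unit_resM ?IH ?mulrS //; exact: unit1X.
Qed.

Lemma unit_res_lin i (b : K) : vge v 0 b -> unit1 v i (1 + b * W ^+ i) /\ unit_res i (1 + b * W ^+ i) = resK b.
Proof.
move=> hb; rewrite /unit1 /unit_res addrAC subrr add0r mulfK ?expf_neq0 //; split=> //.
by have := vge_mulW i hb; rewrite add0r.
Qed.

Lemma unit_res_quot i u z : (0 < i)%N -> unit1 v i u -> unit1 v i z -> unit_res i u = unit_res i z ->
  exists2 u', unit1 v i.+1 u' & u = u' * z.
Proof.
move=> i0 hu hz E; have [z0 _] := unit1_val i0 hz.
exists (u / z); last by rewrite divfK.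
by apply: unit1_div => //; [exact: unit1_le hz|apply/(unit_res_eq hu hz)].
Qed.

Section CharZero.
Variable (e : nat).
Hypotheses (l0 : (l%:R : K) != 0) (vl : v l%:R = e).
Let le : vge v e (l%:R : K). Proof. by rewrite vgeE // vl. Qed.

Lemma resKX n x : vge v 0 x -> resK (x ^+ n) = resK x ^+ n.
Proof.
move=> hx; elim: n => [|n IH]; first exact: resK1.
by rewrite !exprS resKM ?IH //; exact: vgeX0.
Qed.

(** If [i = l j] is below the critical level, the term [x^l] dominates in [(1 + x)^l] for [x] of
    level [j]. As the residue field is perfect, every unit of level [i] is then an l-th power up to
    level [i.+1]. *)
Lemma below_critical i u : (0 < i)%N -> (l.-1 * i < l * e)%N -> unit1 v i u ->
  ~~ (l %| i)%N \/ exists z u', [/\ z != 0, unit1 v i.+1 u' & u = u' * z ^+ l].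
Proof.
move=> i0 hi hu; case: (boolP (l %| i)%N) => [/dvdnP[j ij]|]; last by left.
right; have l1 := prime_gt1 l_pr.
have j0 : (0 < j)%N by move: i0; rewrite ij muln_gt0 => /andP[].
have je : (l.-1 * j < e)%N by move: hi; rewrite ij mulnA [(_ * l)%N]mulnC ltn_pmul2l // prime_gt0.
have lj : (j * l = l.-1 * j + j)%N by rewrite mulnC -[in LHS](prednK (ltnW l1)) mulSn addnC.
have ji : (i < e + j)%N by rewrite ij; lia.
have [b rb] := finField_root (unit_res i u) lk; have [y hy yb] := resK_surj res_map b.
pose x := y * W ^+ j; have hx : vge v j x by have := vge_mulW j hy; rewrite add0r.
have [hX rX] := unit_res_lin i (vgeX0 l hy).
have EX : x ^+ l = y ^+ l * W ^+ i by rewrite exprMn -exprM -ij.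
have hz : vge v i.+1 ((1 + x) ^+ l - (1 + y ^+ l * W ^+ i)).
  have h1 := bin_prime l_pr le hx.
  have h2 : vge v i.+1 (x *+ l) by rewrite -mulr_natr; apply: (vge_le _ (vgeM hx le)); rewrite -PoszD lez_nat addnC.
  rewrite (_ : _ - _ = ((1 + x) ^+ l - (1 + x *+ l + x ^+ l)) + x *+ l); last by rewrite EX; ring.
  by apply: vgeD => //; apply: (vge_le _ h1); rewrite lez_nat (leq_trans ji) // leq_add2l leq_pmull.
have uz : unit1 v i ((1 + x) ^+ l).
  rewrite /unit1 (_ : _ - 1 = ((1 + x) ^+ l - (1 + y ^+ l * W ^+ i)) + (1 + y ^+ l * W ^+ i - 1)); last by ring.
  by apply: vgeD => //; apply: (vge_le _ hz); rewrite lez_nat.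
have [|u' hu' uE] := unit_res_quot i0 hu uz.
  by rewrite (proj2 (unit_res_eq uz hX) hz) rX resKX // yb.
exists (1 + x), u'; split=> //.
by have [|//] := unit1_val j0 (_ : unit1 v j (1 + x)); rewrite /unit1 addrAC subrr add0r.
Qed.

Lemma above_critical i u : (0 < i)%N -> (l * e < l.-1 * i)%N -> unit1 v i u -> sy u = 0.
Proof. by move=> i0 hi hu; have [y ->] := unit1_root cv l_pr l0 vl hi i0 hu; rewrite syXl. Qed.

(* Modulo l-th powers, the graded piece of level l * j of the 1-units is the cokernel of a map
   b |-> b ^ l + a * b on the residue field, hence cyclic. *)
Lemma at_critical j : (0 < j)%N -> (l.-1 * j = e)%N -> exists s : A, in_line v s (l * j).
Proof.
move=> j0 je; set c := (l * j)%N; have l1 := prime_gt1 l_pr.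
have c0 : (0 < c)%N by rewrite muln_gt0 j0 prime_gt0.
have ce : (c = e + j)%N by rewrite /c -[in LHS](prednK (ltnW l1)) mulSn je addnC.
have c1 : (c.+1 <= e + 2 * j)%N by rewrite ce; move: j0; clear; lia.
have crit : (l * e < l.-1 * c.+1)%N.
  by rewrite -je mulnCA mulnS -/c -[X in (X < _)%N]add0n ltn_add2r -subn1 subn_gt0.
have cle : c%:Z <= c.+1%:Z by rewrite lez_nat.
(* At the critical level [c = l j = e + j] the terms [x^l] and [l x] have equal weight: for
   [x = x' W^j] and [l = beta W^e], [(1 + x)^l] is [1 + (x'^l + beta x') W^c] up to level [c.+1]. *)
pose beta := l%:R / W ^+ e; have hb : vge v 0 beta by exact: vge_divW.
have [g gP] := as_coker l_pr lk (resK beta).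
have [g' hg rg] := resK_surj res_map g; have [hG rG] := unit_res_lin c hg.
set G := 1 + g' * W ^+ c in hG rG.
have L0 : in_line v (sy G * w) c.+1.
  by move=> u y hu y0; rewrite (above_critical _ crit hu) ?mul0r //; exact: line0.
exists (sy G * w) => u y hu y0.
have [n [b bE]] := gP (unit_res c u); have [x' hx' xb] := resK_surj res_map b.
pose x := x' * W ^+ j; have hx : vge v j x by have := vge_mulW j hx'; rewrite add0r.
have hs : vge v 0 (x' ^+ l + beta * x').
  by apply: vgeD; [exact: vgeX0|rewrite -[0]addr0; exact: vgeM].
have [hX rX] := unit_res_lin c hs.
have E1 : x ^+ l = x' ^+ l * W ^+ c by rewrite exprMn -exprM mulnC.
have E2 : x *+ l = beta * x' * W ^+ c.
  rewrite -mulr_natr /x /beta ce exprD; move: (W ^+ e) (expf_neq0 e W0) (W ^+ j) => p p0 q.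
  by rewrite -[_ / p * x' * _]mulrA [x' * (p * q)]mulrCA [_ / p * _]mulrA divfK // mulrC.
have hz : vge v c.+1 ((1 + x) ^+ l - (1 + (x' ^+ l + beta * x') * W ^+ c)).
  have h1 := bin_prime l_pr le hx.
  rewrite mulrDl -E1 -E2 [x ^+ l + _]addrC addrA.
  by apply: vge_le h1; rewrite lez_nat.
have uz : unit1 v c ((1 + x) ^+ l).
  rewrite /unit1 (_ : _ - 1 = ((1 + x) ^+ l - (1 + (x' ^+ l + beta * x') * W ^+ c)) + (1 + (x' ^+ l + beta * x') * W ^+ c - 1)); last by ring.
  by apply: vgeD => //; apply: vge_le hz.
have hGz : unit1 v c (G ^+ n * (1 + x) ^+ l) by apply: unit1M => //; exact: unit1X.
have [|u' hu' uE] := unit_res_quot c0 hu hGz.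
  rewrite (unit_resM c0 (unit1X n hG) uz) (unit_resX n c0 hG).
  rewrite (proj2 (unit_res_eq uz hX) hz) rX rG bE rg; congr (_ + _).
  have hbx : vge v 0 (beta * x') by rewrite -[0]addr0; exact: vgeM.
  by rewrite (resKD res (vgeX0 l hx') hbx) (resKX l hx') (resKM res hb hx') xb.
have hx1 : unit1 v j (1 + x) by rewrite /unit1 addrAC subrr add0r.
have [x10 _] := unit1_val j0 hx1.
have [G0 _] := unit1_val c0 hG; have [u0 _] := unit1_val (isT : (0 < c.+1)%N) hu'.
have -> : sy u = sy G *+ n.
  by rewrite uE mulrA sy_mulXl // syM ?expf_neq0 // syX // (above_critical _ crit hu') ?add0r.
have [u1 hu1 ->] := sy_wild res_map l_pr lk W0 vW y0.
rewrite mulrDr mulrzAr; apply: lineD; last first.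
  have h := line_unit1 L0 c0 (isT : (0 < 1)%N) hG hu1.
  by rewrite mulrnAl; case: h => a ->; exists (a *+ n); rewrite scalerMnl.
by rewrite mulrnAl; apply: linez; rewrite -scaler_nat; exists n%:R.
Qed.

Lemma descend (s : A) c : in_line v s c -> (0 < c)%N ->
  (forall i, (0 < i)%N -> (i < c)%N -> (l.-1 * i < l * e)%N) -> in_line v s 1.
Proof.
move=> Lc c0 h; suff H n : (n < c)%N -> in_line v s (c - n).
  by have := H c.-1; rewrite prednK // => /(_ (leqnn _)); have -> : (c - c.-1 = 1)%N by lia.
elim: n => [|n IH] nc; first by rewrite subn0.
have d0 : (0 < c - n.+1)%N by rewrite subn_gt0.
apply: (wild_step res_map l_pr lk W0 vW d0).
  by have -> : (c - n.+1).+1 = (c - n)%N; [lia|apply: IH; lia].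
by move=> u; apply: below_critical => //; apply: h; lia.
Qed.

(** The descent starts at the critical level [l e / (l - 1)]. If it is an integer, [at_critical]
    supplies the line; otherwise the first level above it consists of l-th powers and the line is
    zero. *)
Lemma rank1_wild0 : rank1 l K.
Proof.
have l1 := prime_gt1 l_pr.
suff [s Ls] : exists s : A, in_line v s 1 by exists s; exact: (wild_line res_map l_pr lk W0 vW Ls).
have e0 : (0 < e)%N.
  have : vge v 1 (l%:R : K) by apply/(resK_eq0 res_map (vge_nat v l)); rewrite resK_nat // (pcharf0 lk).
  by rewrite vgeE // vl.
case: (boolP (l.-1 %| e)%N) => [/dvdnP[j je]|nd].
  have j0 : (0 < j)%N by move: e0; rewrite je muln_gt0 => /andP[].
  have [|s Ls] := @at_critical j j0; first by rewrite mulnC.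
  exists s; apply: (descend Ls); first by rewrite muln_gt0 j0 prime_gt0.
  by move=> i i0 ic; rewrite je mulnA [(l * j * _)%N]mulnC ltn_pmul2l // -subn1 subn_gt0.
exists 0; pose c := (l * e %/ l.-1).+1.
have L0 : in_line v (0 : A) c.
  move=> u y hu y0; rewrite (above_critical _ _ hu) ?mul0r //; first exact: line0.
  by rewrite [(l.-1 * _)%N]mulnC; apply: ltn_ceil; rewrite -subn1 subn_gt0.
apply: (descend L0) => // i i0; rewrite ltnS => ic.
have : (i * l.-1 <= l * e)%N by apply: leq_trans (leq_trunc_div _ l.-1); rewrite leq_mul2r ic orbT.
(* Equality would make [l - 1] divide [l e], hence [e]. *)
rewrite leq_eqVlt mulnC => /orP[/eqP E|//]; case/negP: nd.
have cop : coprime l.-1 l by rewrite -{2}(prednK (ltnW l1)) coprimenS.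
by rewrite -(Gauss_dvdr _ cop) -E dvdn_mulr.
Qed.
End CharZero.
End WildCharZero.

(** * Wild symbols in characteristic l *)

Section WildCharP.
Import Order.TTheory Num.Theory.
Variables (K : fieldType) (v : discreteValuation K) (cv : complete_val v).
Variables (k : finFieldType) (res : {rmorphism valuationRing v -> k}) (res_map : is_residue_map res).
Variables (l : nat) (l_pr : prime l) (lK : l \in [pchar K]) (lk : l \in [pchar k]).
Local Notation sy := (@sy 'F_l K).
Local Notation resK := (resK res).

Lemma expD_char (x y : K) : (x + y) ^+ l = x ^+ l + y ^+ l.
Proof. by have := pFrobenius_autD_comm lK (mulrC x y); rewrite !pFrobenius_autE. Qed.

Lemma syN1_char : sy (-1) = 0.
Proof.
have -> : -1 = (-1) ^+ l :> K; last exact: syXl.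
have := expD_char 1 (-1); rewrite subrr expr0n gtn_eqF ?prime_gt0 // expr1n => /eqP.
by rewrite eq_sym addrC addr_eq0 => /eqP.
Qed.

Section Uniformizer.
Variables (W : K) (W0 : W != 0) (vW : v W = 1).

(* A 1-unit is x_0^l times a product of factors 1 + x_j^l W^j with 0 < j < l, and each such factor
   has zero symbol with W by the Steinberg relation. *)
Definition pfactor_ (j : nat) (x : K) := (j != 0%N)%:R + x ^+ l * W ^+ j.
Definition pprod (s : nat -> K) := \prod_(j < l) pfactor_ j (s j).
Definition pgood (s : nat -> K) := unit1 v 1 (s 0%N) /\ forall j, vge v 0 (s j).

Lemma pfactor_unit1 s j : pgood s -> unit1 v 1 (pfactor_ j (s j)).
Proof.
move=> [s0 sj]; rewrite /pfactor_; case: j => [|j] /=.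
  by rewrite add0r expr0 mulr1; exact: unit1X.
rewrite /unit1 addrAC subrr add0r.
by apply: vge_le (vge_mulW0 W0 vW j.+1 (vgeX0 l (sj j.+1))).
Qed.

Lemma prod_unit1 (P : pred 'I_l) s : pgood s -> unit1 v 1 (\prod_(j < l | P j) pfactor_ j (s j)).
Proof.
move=> gs; elim/big_ind: _ => [|x y hx hy|j _]; [exact: unit1_1|exact: unit1M|exact: pfactor_unit1].
Qed.

Lemma pprod_cont (n : nat) s s' : pgood s -> pgood s' -> (forall j, vge v n (s j - s' j)) ->
  vge v n (pprod s - pprod s').
Proof.
move=> gs gs' h.
suff [] : [/\ vge v 0 (pprod s), vge v 0 (pprod s') & vge v n (pprod s - pprod s')] by [].
rewrite /pprod; elim/big_rec2: _ => [|j y x _ [hx hy hxy]].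
  by rewrite subrr; split; [exact: vge1|exact: vge1|exact: vge0].
have fs : vge v 0 (pfactor_ j (s j)) by apply: (unit1_ge0 _ (pfactor_unit1 j gs)).
have fs' : vge v 0 (pfactor_ j (s' j)) by apply: (unit1_ge0 _ (pfactor_unit1 j gs')).
split; try by rewrite -[0]addr0; apply: vgeM.
rewrite (_ : _ - _ = pfactor_ j (s j) * (x - y) + (pfactor_ j (s j) - pfactor_ j (s' j)) * y); last first.
  by rewrite mulrBr mulrBl addrA subrK.
apply: vgeD; first by rewrite -[n : int]add0r; apply: vgeM.
rewrite -[n : int]addr0; apply: vgeM => //.
rewrite /pfactor_ opprD addrACA subrr add0r -mulrBl.
have hd : vge v n (s j ^+ l - s' j ^+ l) by apply: vge_expB; [exact: gs.2|exact: gs'.2|].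
by apply: vge_le (vge_mulW W0 vW j hd); rewrite lerDl.
Qed.

(** Write [N = l m + j]. Since the Frobenius is additive, adding [y W^m] to the coordinate [s j]
    adds [y^l W^N] to its factor, and [y^l] reaches every residue. *)
Lemma pprod_improve u N s : (0 < N)%N -> pgood s -> vge v N (u - pprod s) ->
  exists s', [/\ pgood s', vge v N.+1 (u - pprod s') & forall j, vge v (N %/ l)%N (s' j - s j)].
Proof.
move=> N0 gs hN; have l0 := prime_gt0 l_pr.
set m := (N %/ l)%N; have jl : (N %% l < l)%N by rewrite ltn_pmod.
pose j : 'I_l := Ordinal jl.
pose d := (u - pprod s) / W ^+ N; have hd : vge v 0 d by exact: (vge_divW W0 vW).
have [b rb] := finField_root (resK d) lk; have [y hy yb] := resK_surj res_map b.
pose s' i := if i == j :> nat then s i + y * W ^+ m else s i.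
have hm : vge v m (y * W ^+ m) by have := vge_mulW W0 vW m hy; rewrite add0r.
have ds i : vge v m (s' i - s i).
  by rewrite /s'; case: ifP => _; rewrite ?subrr ?vge0 // addrAC subrr add0r.
have NE : N = (l * m + j)%N by rewrite mulnC -divn_eq.
have gs' : pgood s'.
  split=> [|i]; last by rewrite -(subrK (s i) (s' i)); apply: vgeD; [apply: vge_le (ds i)|exact: gs.2].
  rewrite /s'; case: eqP => j0; last exact: gs.1.
  rewrite /unit1 addrAC; apply: vgeD; first exact: gs.1.
  apply: vge_le hm; suff : (0 < m)%N by lia.
  by move: N0; rewrite NE -j0 addn0 muln_gt0 => /andP[].
exists s'; split=> //.
have E : pprod s' = pprod s + y ^+ l * W ^+ N * \prod_(i < l | i != j) pfactor_ i (s i).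
  rewrite /pprod (bigD1 j) //= [in RHS](bigD1 j) //= -mulrDl; congr (_ * _); last first.
    by apply: eq_bigr => i ij; rewrite /s' (negPf (ij : (i : nat) != j)).
  rewrite /s' eqxx /pfactor_ expD_char mulrDl addrA; congr (_ + _).
  by rewrite exprMn -exprM -mulrA -exprD [(m * l)%N]mulnC -NE.
have hP := prod_unit1 (fun i => i != j) gs; set P := \prod_(i < l | _) _ in E hP.
have WN : W ^+ N != 0 by rewrite expf_neq0.
have -> : u - pprod s' = (d - y ^+ l * P) * W ^+ N.
  by rewrite E mulrBl /d divfK //; ring.
have hP0 : vge v 0 P by exact: unit1_ge0 hP.
have hyP : vge v 0 (y ^+ l * P) by rewrite -[0]addr0; apply: vgeM => //; exact: vgeX0.
have h1 : vge v 1 (d - y ^+ l * P).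
  apply/(resK_eq res_map hd hyP); rewrite resKM //; last exact: vgeX0.
  by rewrite resKX // yb -rb ((unit1E res_map P).1 hP).2 mulr1.
exact: vge_mulW1.
Qed.

Lemma unit1_pprod u : unit1 v 1 u -> exists2 s, pgood s & u = pprod s.
Proof.
move=> hu; have l0 := prime_gt0 l_pr.
pose good m s := pgood s /\ vge v (l * m).+1 (u - pprod s).
have [||s sP] := @complete_iter K v cv good (fun j => (j == 0%N)%:R).
- split; first by split=> [|[|j]]; [exact: unit1_1|exact: vge1|exact: vge0].
  rewrite muln0 /pprod big1 // => [[[|j] jl] _]; rewrite /pfactor_ /=.
    by rewrite add0r expr1n mul1r.
  by rewrite expr0n gtn_eqF // mul0r addr0.
- move=> m s [gs hs].
  (* Each of the [l] levels from [l m + 1] on changes coordinates by multiples of [W^m]; treating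
     them together gives the rate of convergence asked by [complete_iter]. *)
  suff inner n : exists s', [/\ pgood s', vge v ((l * m).+1 + n)%N (u - pprod s') & forall j, vge v m (s' j - s j)].
    have [s' [gs' h1 h2]] := inner l; exists s' => //; split=> //.
    by apply: vge_le h1; rewrite mulnS; lia.
  elim: n => [|n [s' [gs' h1 h2]]].
    by exists s; rewrite addn0; split=> // j; rewrite subrr vge0.
  have [//|s'' [gs'' h1' h2']] := @pprod_improve u ((l * m).+1 + n) s' _ gs' h1.
  exists s''; rewrite addnS; split=> // j.
  rewrite -(subrK (s' j) (s'' j)) -addrA; apply: vgeD => //.
  apply: vge_le (h2' j); have : (m <= ((l * m).+1 + n) %/ l)%N by rewrite leq_divRL //; lia.
  lia.
have gs : pgood s.
  split=> [|j].
    have [s' [[s0 _] _] /(_ 0%N) h] := sP 1%N.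
    by rewrite /unit1 -(subrK (s' 0%N) (s 0%N)) -addrA; apply: vgeD.
  have [s' [[_ sj] _] /(_ j) h] := sP 0%N.
  by rewrite -(subrK (s' j) (s j)); apply: vgeD.
exists s => //; apply/subr0_eq/vge_inf => n.
have [s' [gs' h] ds] := sP n.
rewrite (_ : _ - _ = (u - pprod s') - (pprod s - pprod s')); last by ring.
apply: vgeB; last exact: pprod_cont.
apply: vge_le h; have : (n <= l * n)%N by rewrite leq_pmull.
lia.
Qed.

Lemma unit1_unif u : unit1 v 1 u -> sy u * sy W = 0.
Proof.
move=> /unit1_pprod[s gs ->].
suff [] : pprod s != 0 /\ sy (pprod s) * sy W = 0 by [].
rewrite /pprod; elim/big_ind: _ => [|x y [x0 hx] [y0 hy]|j _].
- by rewrite oner_neq0 sy1 mul0r.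
- by rewrite mulf_neq0 // syM // mulrDl hx hy addr0.
have [f0 _] := unit1_val (isT : (0 < 1)%N) (pfactor_unit1 j gs); split=> //.
case: j f0 => [[|j] jl] /=; rewrite /pfactor_ /=.
  by rewrite add0r expr0 mulr1 => _; rewrite syXl // mul0r.
set x := s j.+1 => f0; have [x0|x0] := eqVneq x 0.
  by rewrite x0 expr0n gtn_eqF ?prime_gt0 // mul0r addr0 sy1 mul0r.
(* As [{-1}] and symbols of l-th powers vanish, this is [j.+1] times the symbol with [W], and [j.+1]
   is positive and less than [l]. *)
have st : sy (1 + x ^+ l * W ^+ j.+1) * sy (- (x ^+ l * W ^+ j.+1)) = 0.
  by apply: sy_steinbergD; rewrite addrK.
have xl0 : x ^+ l != 0 by rewrite expf_neq0.
have Wj0 : W ^+ j.+1 != 0 by rewrite expf_neq0.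
move: st; rewrite syN ?mulf_neq0 // syN1_char add0r mulrC sy_mulXl // syX // mulrnAr.
rewrite [W ^+ _ * _]mulrC -scaler_nat => /eqP; rewrite scaler_eq0 => /orP[|/eqP//].
by rewrite -(dvdn_pcharf (pchar_Fp l_pr)) gtnNdvd.
Qed.
End Uniformizer.

(** Every symbol vanishes here: a 1-unit has zero symbol with the two uniformizers [W] and [u1 W],
    hence with the 1-unit [u1]. *)
Lemma rank1_wildp : rank1 l K.
Proof.
have [W0 vW] := unifP v; exists 0; apply: (wild_line res_map l_pr lk W0 vW).
move=> u y hu y0; have [u1 hu1 ->] := sy_wild res_map l_pr lk W0 vW y0.
have [u10 vu1] := unit1_val (isT : (0 < 1)%N) hu1.
have uW := unit1_unif W0 vW hu.
have h : sy u * sy (u1 * unif v) = 0.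
  by apply: unit1_unif; rewrite ?mulf_neq0 ?dvalM // vu1 vW.
move: h; rewrite syM // mulrDr uW addr0 => h.
by exists 0; rewrite mulrDr mulrzAr uW mul0rz h addr0 scaler0.
Qed.
End WildCharP.

(** Stated by representatives and not by a residue field: this form passes easily to finite
    extensions, and the field is built from it afterwards. *)
Definition finite_residue (K : fieldType) (v : discreteValuation K) :=
  exists (T : finType) (g : T -> K), forall y, vge v 0 y -> exists t, vge v 1 (y - g t).

(** * The residue field as a finite field *)

Module ResidueField.
Section Quotient.
Import Order.TTheory Num.Theory.
Local Open Scope quotient_scope.
Variables (K : fieldType) (v : discreteValuation K) (T : finType) (g : T -> K).
Hypothesis gP : forall y, vge v 0 y -> exists t, vge v 1 (y - g t).

Definition max_ideal : {pred valuationRing v} := fun x => vge v 1 (val x).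
Fact max_ideal_idealr : idealr_closed max_ideal.
Proof.
split=> [||a x y]; rewrite !unfold_in /= ?vge0 //.
  by rewrite vgeE ?oner_neq0 // dval1.
move=> hx hy; apply: vgeD => //; rewrite -[1]add0r; apply: vgeM => //.
exact: valP a.
Qed.
HB.instance Definition _ := isIdealr.Build (valuationRing v) max_ideal max_ideal_idealr.

(** The proof argument lets the finiteness of the quotient be declared as an instance on this
    type. *)
Definition residue_field_of (_ : forall y, vge v 0 y -> exists t, vge v 1 (y - g t)) : Type :=
  {ideal_quot max_ideal}.
Local Notation F := (residue_field_of gP).
HB.instance Definition _ := GRing.ComNzRing.copy F {ideal_quot max_ideal}.
Definition residue_pi (x : valuationRing v) : F := \pi_({ideal_quot max_ideal}) x.
Fact residue_pi_zmod : zmod_morphism residue_pi.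
Proof. by move=> x y; rewrite /residue_pi !piE. Qed.
Fact residue_pi_monoid : monoid_morphism residue_pi.
Proof. by split=> [|x y]; rewrite /residue_pi !piE. Qed.
HB.instance Definition _ := GRing.isZmodMorphism.Build (valuationRing v) F residue_pi residue_pi_zmod.
HB.instance Definition _ := GRing.isMonoidMorphism.Build (valuationRing v) F residue_pi residue_pi_monoid.

Lemma residue_pi_surj (a : F) : exists x, residue_pi x = a.
Proof. by exists (generic_quotient.repr (a : {ideal_quot max_ideal})); rewrite /residue_pi reprK. Qed.
Lemma residue_pi_eq x y : residue_pi x = residue_pi y <-> vge v 1 (val x - val y).
Proof.
rewrite /residue_pi; split=> [/eqmodP|h]; first by rewrite /= Quotient.equivE.
by apply/eqmodP; rewrite /= Quotient.equivE.
Qed.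

Definition residue_inv (a : F) : F :=
  if pselect (exists b, b * a = 1) is left h then sval (cid h) else 0.
Fact residue_mulVf (a : F) : a != 0 -> residue_inv a * a = 1.
Proof.
move=> a0; rewrite /residue_inv; case: pselect => [h|[]]; first exact: svalP (cid h).
have [x xa] := residue_pi_surj a; rewrite -xa in a0 *.
have hx : vge v 0 (val x) by exact: valP x.
have nx : ~~ vge v 1 (val x).
  apply/negP => h; case/eqP: a0; rewrite -(rmorph0 residue_pi); apply/residue_pi_eq.
  by rewrite subr0.
have x0 : val x != 0 by apply: contraNneq nx => ->; exact: vge0.
have vx : v (val x) = 0.
  by apply/eqP; rewrite eq_le; move: hx nx; rewrite !vgeE // => -> /=; rewrite -ltNge; lia.
have hi : vge v 0 (val x)^-1 by rewrite vgeE ?invr_eq0 // dvalV // vx.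
exists (residue_pi (Sub (val x)^-1 hi)); rewrite -rmorphM.
have -> : Sub (val x)^-1 hi * x = 1 by apply: val_inj; rewrite /= mulVf.
exact: rmorph1.
Qed.
Fact residue_inv0 : residue_inv 0 = 0.
Proof.
rewrite /residue_inv; case: pselect => // h; have := svalP (cid h).
by rewrite mulr0 => /esym/eqP; rewrite oner_eq0.
Qed.
HB.instance Definition _ := GRing.ComNzRing_isField.Build F residue_mulVf residue_inv0.

Definition residue_code (a : F) : T := sval (cid (gP (valP (sval (cid (residue_pi_surj a)))))).
Definition residue_decode (t : T) : F :=
  if insub (g t) is Some x then residue_pi x else 0.
Fact residue_codeK : cancel residue_code residue_decode.
Proof.
move=> a; rewrite /residue_code /residue_decode.
case: (cid (residue_pi_surj a)) => x /= <-; case: cid => t /= ht.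
have hg : vge v 0 (g t).
  rewrite -[g t](subKr (val x)); apply: vgeB; first exact: valP x.
  by apply: vge_le ht.
rewrite insubT; apply/residue_pi_eq; rewrite /= -vgeN opprB.
exact: ht.
Qed.
HB.instance Definition _ : isCountable F := CanIsCountable residue_codeK.
HB.instance Definition _ : isFinite F := CanIsFinite residue_codeK.
Definition residue_field : finFieldType := F.
Definition residue_map : {rmorphism valuationRing v -> residue_field} := residue_pi.
Lemma residue_mapP : is_residue_map residue_map.
Proof.
split=> [|x]; first exact: residue_pi_surj.
rewrite -[residue_map x]/(residue_pi x) -(rmorph0 residue_pi); split=> [/residue_pi_eq|h].
  by rewrite subr0 /vge => /orP[/eqP->|h]; [left|right; lia].
apply/residue_pi_eq; rewrite subr0 /vge; case: h => [->|h]; rewrite ?eqxx //.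
by apply/orP; right; lia.
Qed.
End Quotient.
End ResidueField.
Import ResidueField.

Lemma residue_field_exists (K : fieldType) (v : discreteValuation K) : finite_residue v ->
  exists (k : finFieldType) (res : {rmorphism valuationRing v -> k}), is_residue_map res.
Proof. by move=> [T [g gP]]; exists (residue_field gP), (residue_map gP); exact: residue_mapP. Qed.

Lemma rank1_local (K : fieldType) (v : discreteValuation K) (l : nat) :
  complete_val v -> finite_residue v -> prime l -> rank1 l K.
Proof.
move=> cv /residue_field_exists[k [res res_map]] lp; have [W0 vW] := unifP v.
have [lk|lk] := eqVneq (l%:R : k) 0; last exact: (rank1_tame cv res_map lp lk).
have lk' : l \in [pchar k] by rewrite inE lp lk eqxx.
have [lK|lK] := eqVneq (l%:R : K) 0.
  have lK' : l \in [pchar K] by rewrite inE lp lK eqxx.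
  exact: (rank1_wildp cv res_map lp lK' lk').
have hl : vge v 0 (l%:R : K) by exact: vge_nat.
have [e eE] : exists e : nat, v l%:R = e.
  by exists (absz (v l%:R)); rewrite gez0_abs //; move: hl; rewrite vgeE.
exact: (rank1_wild0 cv res_map lp lk' W0 vW lK eE).
Qed.

(** * Finite extensions of local fields *)

Module FiniteExtension.
Section NormValuation.
Import Order.TTheory Num.Theory.
Variables (F K : fieldType) (iota : {rmorphism F -> K}) (v : discreteValuation F).
Hypotheses (cv : complete_val v) (fr : finite_residue v).
Variables (n : nat) (e : 'cV[K]_n.+1) (E : 'I_n.+1 -> 'M[F]_n.+1).
Local Notation up := (map_mx iota).
Hypothesis e0 : e 0 0 = 1.
Hypothesis indep : forall u : 'rV[F]_n.+1, up u *m e = 0 -> u = 0.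
Hypothesis E_e : forall j, up (E j) *m e = e j 0 *: e.
Hypothesis E_int : forall j a b, vge v 0 (E j a b).

(* The determinant of A is the norm of y. *)
Definition acts (A : 'M[F]_n.+1) (y : K) := up A *m e = y *: e.

Lemma acts_uniq A A' y : acts A y -> acts A' y -> A = A'.
Proof.
move=> h h'; apply/subr0_eq/row_matrixP => i; rewrite row0; apply: indep.
by rewrite map_row -row_mul map_mxB mulmxBl h h' subrr row0.
Qed.
Lemma acts1 : acts 1 1.
Proof. by rewrite /acts -[1]/(1%:M) map_scalar_mx rmorph1 mul1mx scale1r. Qed.
Lemma actsB A A' y y' : acts A y -> acts A' y' -> acts (A - A') (y - y').
Proof. by move=> h h'; rewrite /acts map_mxB mulmxBl h h' scalerBl. Qed.
Lemma actsD A A' y y' : acts A y -> acts A' y' -> acts (A + A') (y + y').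
Proof. by move=> h h'; rewrite /acts map_mxD mulmxDl h h' scalerDl. Qed.
Lemma actsM A A' y y' : acts A y -> acts A' y' -> acts (A * A') (y * y').
Proof.
move=> h h'; rewrite /acts -[A * A']/(A *m A') map_mxM -mulmxA h' -scalemxAr h scalerA.
by rewrite mulrC.
Qed.
Lemma actsZ A y a : acts A y -> acts (a *: A) (iota a * y).
Proof. by move=> h; rewrite /acts map_mxZ -scalemxAl h scalerA. Qed.
Lemma acts_sum (I : Type) (s : seq I) (P : pred I) (A : I -> 'M[F]_n.+1) (y : I -> K) :
  (forall i, acts (A i) (y i)) -> acts (\sum_(i <- s | P i) A i) (\sum_(i <- s | P i) y i).
Proof.
move=> h; elim/big_rec2: _ => [|i y' A' _ h']; last exact: actsD.
by rewrite /acts map_mx0 mul0mx scale0r.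
Qed.
Lemma acts0 A y : acts A y -> y = 0 -> A = 0.
Proof. by move=> h y0; apply: (acts_uniq h); rewrite y0 /acts map_mx0 mul0mx scale0r. Qed.
Lemma acts_unit A y : acts A y -> y != 0 -> A \is a GRing.unit.
Proof.
move=> h y0; rewrite -[_ \is a _]/(A \in unitmx) -row_free_unit -kermx_eq0; apply/eqP/row_matrixP => i.
rewrite row0; apply: indep; apply: (scalerI y0); rewrite scaler0 scalemxAr -h mulmxA.
have /eqP := mulmx_ker A; rewrite -(map_mx_eq0 iota) map_mxM => /eqP kA.
by rewrite map_row -row_mul kA row0 mul0mx.
Qed.
Lemma actsV A y : acts A y -> y != 0 -> acts A^-1 y^-1.
Proof.
move=> h y0; have uA := acts_unit h y0; apply: (scalerI y0).
rewrite scalerA mulfV // scale1r scalemxAr -h mulmxA -map_mxM.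
by rewrite -[A^-1 *m A]/(A^-1 * A) mulVr // map_mx1 mul1mx.
Qed.

Definition comb (u : nat -> F) : K := \sum_(j < n.+1) iota (u j) * e j 0.
Definition comb_mx (u : nat -> F) : 'M[F]_n.+1 := \sum_(j < n.+1) u j *: E j.
(** As [e 0 0 = 1], the first row of the matrix of [y] lists the coordinates of [y] with respect to
    [e]. Indices are naturals to fit [complete_iter]. *)
Definition coord (A : 'M[F]_n.+1) (j : nat) : F := A 0 (inord j).

Lemma acts_comb u : acts (comb_mx u) (comb u).
Proof. by apply: acts_sum => j; apply: actsZ; exact: E_e. Qed.
Lemma acts_coord A y : acts A y -> y = comb (coord A).
Proof.
move=> h; have := congr1 (fun M : 'cV[K]_n.+1 => M 0 0) h; rewrite /= !mxE e0 mulr1 => <-.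
by apply: eq_bigr => j _; rewrite mxE /coord inord_val.
Qed.
Lemma acts_mx A y : acts A y -> A = comb_mx (coord A).
Proof. by move=> h; apply: (acts_uniq h); rewrite (acts_coord h); exact: acts_comb. Qed.
Lemma coordB A A' j : coord (A - A') j = coord A j - coord A' j.
Proof. by rewrite /coord !mxE. Qed.
Lemma coord_comb u (j : 'I_n.+1) : coord (comb_mx u) j = u j.
Proof.
pose r : 'rV[F]_n.+1 := \row_i (coord (comb_mx u) i - u i).
have : r = 0; last by move/rowP/(_ j); rewrite !mxE => /subr0_eq.
apply: indep; apply/matrixP => a b; rewrite !ord1 !mxE.
under eq_bigr do rewrite !mxE rmorphB mulrBl.
by rewrite sumrB -/(comb _) -/(comb u) -(acts_coord (acts_comb u)) subrr.
Qed.

Lemma vge_prodB m (I : finType) (G H : I -> F) : (forall i, vge v 0 (G i)) -> (forall i, vge v 0 (H i)) ->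
  (forall i, vge v m (G i - H i)) ->
  [/\ vge v 0 (\prod_i G i), vge v 0 (\prod_i H i) & vge v m (\prod_i G i - \prod_i H i)].
Proof.
move=> hG hH hGH; elim/big_rec2: _ => [|i y x _ [hx hy hxy]].
  by rewrite subrr; split; [exact: vge1|exact: vge1|exact: vge0].
split; try by rewrite -[0]addr0; apply: vgeM.
rewrite (_ : _ - _ = G i * (x - y) + (G i - H i) * y); last by rewrite mulrBr mulrBl addrA subrK.
by apply: vgeD; [rewrite -[m]add0r|rewrite -[m]addr0]; apply: vgeM.
Qed.

Lemma vge_det m (A A' : 'M[F]_n.+1) : (forall i j, vge v 0 (A i j)) -> (forall i j, vge v 0 (A' i j)) ->
  (forall i j, vge v m (A i j - A' i j)) -> vge v 0 (\det A) /\ vge v m (\det A - \det A').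
Proof.
move=> hA hA' h; have sg (b : bool) : vge v 0 ((-1) ^+ b : F).
  by apply: vgeX0; rewrite vgeN vge1.
split.
  apply: vge_sum => s _; rewrite -[0]addr0; apply: vgeM => //.
  by elim/big_ind: _ => [|x y hx hy|i _] //; [exact: vge1|rewrite -[0]addr0; exact: vgeM].
rewrite /determinant -sumrB; apply: vge_sum => s _; rewrite -mulrBr -[m]add0r; apply: vgeM => //.
by have [] := @vge_prodB m _ (fun i => A i (s i)) (fun i => A' i (s i)) (fun i => hA _ _) (fun i => hA' _ _) (fun i => h _ _).
Qed.

Lemma comb_mx_int u : (forall j, vge v 0 (u j)) -> forall i j, vge v 0 (comb_mx u i j).
Proof.
move=> hu i j; rewrite summxE; apply: vge_sum => a _; rewrite mxE -[0]addr0.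
by apply: vgeM.
Qed.
Lemma comb_mx_cont m (u u' : nat -> F) : (forall j : 'I_n.+1, vge v m (u j - u' j)) ->
  forall i j, vge v m (comb_mx u i j - comb_mx u' i j).
Proof.
move=> hu i j; rewrite !summxE -sumrB; apply: vge_sum => a _; rewrite !mxE -mulrBl -[m]addr0.
by apply: vgeM.
Qed.

Lemma digits : exists (T : finType) (g : T -> F), (forall t, vge v 0 (g t)) /\
  forall y, vge v 0 y -> exists t, vge v 1 (y - g t).
Proof.
have [T [g gP]] := fr; exists T, (fun t => if vge v 0 (g t) then g t else 0); split=> [t|y hy].
  by case: ifP => // _; exact: vge0.
have [t ht] := gP y hy; exists t; case: ifP => // /negP []; rewrite -[g t](subKr y).
by apply: vgeB => //; apply: vge_le ht.
Qed.

Lemma digits_mod (m : nat) : exists (T : finType) (g : T -> F),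
  forall y, vge v 0 y -> exists t, vge v m (y - g t).
Proof.
have [T [g [_ gP]]] := digits; have [W0 vW] := unifP v.
elim: m => [|m [T' [g' g'P]]].
  by exists unit, (fun=> 0) => y hy; exists tt; rewrite subr0.
exists (T' * T)%type, (fun t => g' t.1 + g t.2 * unif v ^+ m) => y hy.
have [t ht] := g'P y hy; have [t' ht'] := gP _ (vge_divW W0 vW ht).
exists (t, t') => /=.
rewrite (_ : _ - _ = ((y - g' t) / unif v ^+ m - g t') * unif v ^+ m); first exact: vge_mulW1.
by rewrite mulrBl divfK ?expf_neq0 // opprD addrA.
Qed.

Definition primitive (u : nat -> F) := (forall j, vge v 0 (u j)) /\
  exists j : 'I_n.+1, ~~ vge v 1 (u j).

(* Compactness: otherwise a convergent sequence of primitive vectors has a limit of norm 0. *)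
Lemma norm_bound : exists B : nat, forall u, primitive u -> ~~ vge v B.+1 (\det (comb_mx u)).
Proof.
apply: contrapT => hB; have [W0 vW] := unifP v.
have big (B : nat) : exists u, primitive u /\ vge v B (\det (comb_mx u)).
  apply: contrapT => h; apply: hB; exists B => u pu; apply/negP => hu; apply: h; exists u.
  by split=> //; apply: (vge_le _ hu); rewrite lez_nat.
have [T [g [g0 gP]]] := digits.
(* [c] approximates to level [m] primitive vectors whose determinants are arbitrarily small. *)
pose good m (c : nat -> F) := (forall j, vge v 0 (c j)) /\ forall B : nat, exists u,
  [/\ primitive u, forall j : 'I_n.+1, vge v m (u j - c j) & vge v B (\det (comb_mx u))].
have [||s sP] := @complete_iter F v cv good (fun=> 0).
- split=> [j|B]; first exact: vge0.
  by have [u [pu uB]] := big B; exists u; split=> // j; rewrite subr0; exact: pu.1.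
- move=> m c [c0 cP]; pose cf (f : {ffun 'I_n.+1 -> T}) j := c j + g (f (inord j)) * unif v ^+ m.
  have hd f j : vge v m (cf f j - c j).
    by rewrite /cf addrAC subrr add0r; apply: vge_mulW0.
  suff [f hf] : exists f, good m.+1 (cf f) by exists (cf f).
  (* Pigeonhole: finitely many digit vectors refine [c]. If each of them failed beyond some bound,
     the largest of these bounds would contradict [good m c]. *)
  apply: contrapT => nf.
  have /choice[B BP] f : exists B : nat, forall u, ~ [/\ primitive u,
      forall j : 'I_n.+1, vge v m.+1 (u j - cf f j) & vge v B (\det (comb_mx u))].
    apply: contrapT => h; apply: nf; exists f; split=> [j|B].
      by rewrite -(subrK (c j) (cf f j)); apply: vgeD => //; apply: vge_le (hd f j).
    by apply: contrapT => h'; apply: h; exists B => u hu; apply: h'; exists u.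
  have [u [pu uc uB]] := cP (\max_f B f)%N.
  have /choice[t tP] (j : 'I_n.+1) : exists t, vge v 1 ((u j - c j) / unif v ^+ m - g t).
    by apply: gP; exact: (vge_divW W0 vW (uc j)).
  apply: (BP (finfun t) u); split=> [//|j|].
    rewrite /cf ffunE inord_val.
    rewrite (_ : _ - _ = ((u j - c j) / unif v ^+ m - g (t j)) * unif v ^+ m); first exact: vge_mulW1.
    by rewrite mulrBl divfK ?expf_neq0 // opprD addrA.
  by apply: vge_le uB; rewrite lez_nat; exact: leq_bigmax.
have s0 j : vge v 0 (s j).
  by have [c [c0 _] /(_ j) h] := sP 0%N; rewrite -(subrK (c j) (s j)); apply: vgeD.
have near (m : nat) : exists u, [/\ primitive u, forall j : 'I_n.+1, vge v m (u j - s j) & vge v m (\det (comb_mx u))].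
  have [c [_ /(_ m)[u [pu uc um]]] cs] := sP m; exists u; split=> // j.
  by rewrite -[u j](subrK (c j)) -addrA; apply: vgeD; rewrite // -vgeN opprB.
(* The limit is congruent to a primitive vector, hence nonzero and with invertible matrix, although
   its determinant lies in every power of the maximal ideal. *)
have [j0 sj0] : exists j : 'I_n.+1, s j != 0.
  have [u [[_ [j uj]] us _]] := near 1%N; exists j.
  by apply: contraNneq uj => sj; have := us j; rewrite sj subr0.
have y0 : comb s != 0.
  apply/eqP => y0; have := acts0 (acts_comb s) y0 => /(congr1 (fun A => coord A j0)).
  by rewrite /= coord_comb /coord mxE => /eqP; rewrite (negPf sj0).
have := acts_unit (acts_comb s) y0; rewrite -[_ \is a _]/(_ \in unitmx) unitmxE unitfE => /eqP; apply.
apply: (vge_inf (v := v)) => m; have [u [[u0 _] us um]] := near m.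
rewrite -[X in vge v m X](subKr (\det (comb_mx u))); apply: vgeB => //.
by have [] := vge_det (comb_mx_int u0) (comb_mx_int s0) (comb_mx_cont us).
Qed.

(** By [acts_coord] and [acts_comb] this is the [F]-span of [e]; the description by matrices makes
    closure under inverses immediate. *)
Definition span : {pred K} := fun y => `[< exists A, acts A y >].
Fact span_divring : divring_closed span.
Proof.
have V A y : acts A y -> exists A', acts A' y^-1.
  move=> h; have [y0|y0] := eqVneq y 0; last by exists A^-1; apply: actsV.
  by exists A; rewrite y0 invr0 -y0.
split=> [|x y|x y]; rewrite !unfold_in.
- by apply/asboolP; exists 1; exact: acts1.
- by move=> /asboolP[A hA] /asboolP[A' hA']; apply/asboolP; exists (A - A'); exact: actsB.
move=> /asboolP[A hA] /asboolP[A' /V[A'' hA']]; apply/asboolP; exists (A * A'').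
exact: actsM.
Qed.
HB.instance Definition _ := GRing.isDivringClosed.Build K span span_divring.
Definition span_field := {y : K | y \in span}.
HB.instance Definition _ := SubChoice.on span_field.
HB.instance Definition _ := [SubChoice_isSubIntegralDomain of span_field by <:].
HB.instance Definition _ := [SubIntegralDomain_isSubField of span_field by <:].
Local Notation L := span_field.

Fact mat_subproof (y : L) : exists A, acts A (val y).
Proof. exact/asboolP/(valP y). Qed.
Definition mat (y : L) : 'M[F]_n.+1 := sval (cid (mat_subproof y)).
Lemma matP y : acts (mat y) (val y).
Proof. by rewrite /mat; case: cid. Qed.
Lemma matE A y : acts A (val y) -> mat y = A.
Proof. exact/acts_uniq/matP. Qed.
Fact mat_zmod : zmod_morphism mat.
Proof. by move=> x y; apply: matE; apply: actsB; exact: matP. Qed.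
Fact mat_monoid : monoid_morphism mat.
Proof. by split=> [|x y]; apply: matE; [exact: acts1|apply: actsM; exact: matP]. Qed.
HB.instance Definition _ := GRing.isZmodMorphism.Build L 'M[F]_n.+1 mat mat_zmod.
HB.instance Definition _ := GRing.isMonoidMorphism.Build L 'M[F]_n.+1 mat mat_monoid.

Fact span_comb_subproof u : comb u \in span.
Proof. by rewrite unfold_in; apply/asboolP; exists (comb_mx u); exact: acts_comb. Qed.
Definition lcomb u : L := exist _ (comb u) (span_comb_subproof u).
Lemma mat_lcomb u : mat (lcomb u) = comb_mx u.
Proof. exact/matE/acts_comb. Qed.

Fact span_base_subproof a : iota a \in span.
Proof.
rewrite unfold_in; apply/asboolP; exists a%:M.
by rewrite /acts map_scalar_mx mul_scalar_mx.
Qed.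
Definition span_base a : L := exist _ (iota a) (span_base_subproof a).
Fact span_base_zmod : zmod_morphism span_base.
Proof. by move=> a b; apply: val_inj; rewrite /= rmorphB. Qed.
Fact span_base_monoid : monoid_morphism span_base.
Proof. by split=> [|a b]; apply: val_inj; rewrite /= ?rmorph1 ?rmorphM. Qed.
HB.instance Definition _ := GRing.isZmodMorphism.Build F L span_base span_base_zmod.
HB.instance Definition _ := GRing.isMonoidMorphism.Build F L span_base span_base_monoid.

Definition nrm (y : L) : F := \det (mat y).
Lemma nrmM x y : nrm (x * y) = nrm x * nrm y.
Proof. by rewrite /nrm rmorphM -det_mulmx. Qed.
Lemma nrm1 : nrm 1 = 1.
Proof. by rewrite /nrm rmorph1 det1. Qed.
Lemma nrmX x k : nrm (x ^+ k) = nrm x ^+ k.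
Proof. by elim: k => [|k IH]; rewrite ?nrm1 // !exprS nrmM IH. Qed.
Lemma nrm_neq0 y : y != 0 -> nrm y != 0.
Proof.
move=> y0; have : val y != 0 by rewrite -(rmorph0 (val : L -> K)) (inj_eq val_inj).
move/(acts_unit (matP y)); rewrite -[_ \is a _]/(_ \in unitmx) unitmxE unitfE.
by [].
Qed.
Lemma nrm_base a : nrm (span_base a) = a ^+ n.+1.
Proof.
rewrite /nrm (_ : mat _ = a%:M) ?det_scalar //; apply: matE.
by rewrite /acts map_scalar_mx mul_scalar_mx.
Qed.

Lemma vge_coord_nrm (m : int) y : (forall j, vge v m (coord (mat y) j)) -> vge v (m *+ n.+1) (nrm y).
Proof.
move=> h; have [W0 vW] := unifP v; pose c := unif v ^ m; have c0 : c != 0 by rewrite expfz_neq0.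
have vc : v c = m by rewrite dvalXz // vW intz.
have E' : mat y = c *: comb_mx (fun j => c^-1 * coord (mat y) j).
  rewrite [LHS](acts_mx (matP y)) /comb_mx scaler_sumr; apply: eq_bigr => j _.
  by rewrite scalerA mulrA mulfV // mul1r.
rewrite /nrm E' detZ -[_ *+ _]addr0; apply: vgeM; first by rewrite vgeE ?expf_neq0 // dvalX // vc.
have [] // := @vge_det 0 (comb_mx (fun j => c^-1 * coord (mat y) j)) 0; last 1 first.
- move=> i j; rewrite mxE subr0; apply: comb_mx_int => k; rewrite -[0](addNr m).
  by apply: vgeM => //; rewrite vgeE ?invr_eq0 // dvalV // vc.
- apply: comb_mx_int => k; rewrite -[0](addNr m).
  by apply: vgeM => //; rewrite vgeE ?invr_eq0 // dvalV // vc.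
by move=> i j; rewrite mxE vge0.
Qed.

(** Dividing by a power of the uniformizer makes the coordinate vector primitive, and [norm_bound]
    applies. With [vge_coord_nrm], the norm measures the least valuation of a coordinate up to the
    constant [B]. *)
Lemma nrm_coord : exists B : nat, forall y : L, y != 0 -> exists2 m : int,
  (forall j, vge v m (coord (mat y) j)) & v (nrm y) <= m *+ n.+1 + B.
Proof.
have [B BP] := norm_bound; exists B => y y0; have [W0 vW] := unifP v.
have [j0 hj0] : exists j : 'I_n.+1, coord (mat y) j != 0.
  apply: contrapT => h; case/eqP: (nrm_neq0 y0).
  rewrite /nrm (acts_mx (matP y)) /comb_mx big1 ?det0 // => j _.
  have [->|cj] := eqVneq (coord (mat y) j) 0; first by rewrite scale0r.
  by case: h; exists j.
have [j1 hj1 min1] := @Order.TotalTheory.arg_minP _ int _ j0 (fun j : 'I_n.+1 => coord (mat y) j != 0)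
  (fun j => v (coord (mat y) j)) hj0.
set m := v (coord (mat y) j1); pose c := unif v ^ m; have c0 : c != 0 by rewrite expfz_neq0.
have vc : v c = m by rewrite dvalXz // vW intz.
have vci : v c^-1 = - m by rewrite dvalV // vc.
have hm j : vge v m (coord (mat y) j).
  rewrite /vge; case: eqVneq => //= cj; have := min1 (inord j).
  by rewrite /coord inord_val; apply.
exists m => //; pose u j := c^-1 * coord (mat y) j.
have pu : primitive u.
  split=> [j|]; first by rewrite -[0](addNr m); apply: vgeM; rewrite // vgeE ?invr_eq0 // vci.
  exists j1; rewrite /u vgeE ?mulf_neq0 ?invr_eq0 // dvalM ?invr_eq0 // vci addNr.
  by [].
have E' : mat y = c *: comb_mx u.
  rewrite [LHS](acts_mx (matP y)) /comb_mx scaler_sumr; apply: eq_bigr => j _.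
  by rewrite scalerA /u mulrA mulfV // mul1r.
have d0 := nrm_neq0 y0; rewrite /nrm E' detZ in d0 *.
have dd0 : \det (comb_mx u) != 0 by apply: contraNneq d0 => ->; rewrite mulr0.
rewrite dvalM ?expf_neq0 // dvalX // vc lerD2l.
have := BP _ pu; rewrite vgeE // -ltNge => hB.
by rewrite -ltzD1 -PoszD addn1.
Qed.

(** The ultrametric inequality in disguise. The powers of [z] have integral norm, so their
    coordinates have valuation at least [-B], and by the binomial formula so have those of all
    powers of [1 + z]. If the norm of [1 + z] were not integral, the norms of these powers would be
    unbounded. *)
Lemma nrm_one_add z : vge v 0 (nrm z) -> vge v 0 (nrm (1 + z)).
Proof.
have [->|z0] := eqVneq z 0; first by rewrite addr0 nrm1 vge1.
have [->|z1] := eqVneq (1 + z) 0.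
  by rewrite /nrm rmorph0 det0 vge0.
have [B BP] := nrm_coord; move=> hz.
have hX i j : vge v (- B%:Z) (coord (mat (z ^+ i)) j).
  have [m hm] := BP _ (expf_neq0 i z0); rewrite nrmX => h.
  apply: (vge_le _ (hm j)); have : vge v 0 (nrm z ^+ i) by apply: vgeX0.
  rewrite vgeE ?expf_neq0 ?nrm_neq0 // => h'; have := le_trans h' h.
  rewrite -mulr_natr; case: (lerP 0 m) => [m0 _|m0]; first by apply: le_trans m0; lia.
  move=> h2; rewrite lerNl; apply: le_trans (_ : - (m * n.+1) <= _).
    by rewrite -mulNr ler_peMr //; lia.
  by lia.
have hc k j : vge v (- B%:Z) (coord (mat ((1 + z) ^+ k)) j).
  rewrite addrC exprDn; rewrite raddf_sum /= /coord summxE; apply: vge_sum => i _.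
  rewrite expr1n mulr1 raddfMn /= mulmxnE; apply: vge_natmul; exact: hX.
rewrite vgeE ?nrm_neq0 // leNgt; apply/negP => lt.
(* The exponent just exceeds [n.+1 * B], while such coordinates only allow norms of valuation at
   least [- (n.+1 * B)]. *)
have := vge_coord_nrm (hc (n.+1 * B).+1).
rewrite nrmX vgeE ?expf_neq0 ?nrm_neq0 // dvalX ?nrm_neq0 // => h.
have : v (nrm (1 + z)) *+ (n.+1 * B).+1 <= - 1 *+ (n.+1 * B).+1.
  by rewrite lerMn2r; apply/orP; right; lia.
by move/(le_trans h); rewrite !mulNrn lerN2 -[B%:Z *+ _]mulr_natr !natz -PoszM lez_nat mulnC ltnn.
Qed.

(** The valuations of norms form a nonzero subgroup of the integers; dividing by its positive
    generator [d] will normalize the valuation. *)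
Lemma nrm_step : exists2 d : nat, (0 < d)%N & (exists2 y : L, y != 0 & v (nrm y) = d) /\
  forall y : L, y != 0 -> (d %| v (nrm y))%Z.
Proof.
pose P (d : nat) := (0 < d)%N && `[< exists2 y : L, y != 0 & v (nrm y) = d >].
have [W0 vW] := unifP v.
have exP : exists d, P d.
  exists n.+1; apply/asboolP; exists (span_base (unif v)); first by rewrite fmorph_eq0.
  by rewrite nrm_base dvalX // vW natz.
case: (ex_minnP exP) => d /andP[d0 /asboolP[y y0 vy]] dmin; exists d => //; split; first by exists y.
move=> x x0; set q := (v (nrm x) %/ d)%Z; pose x' := x * y ^ (- q).
have x'0 : x' != 0 by rewrite mulf_neq0 ?expfz_neq0.
have nX (i : int) : v (nrm (y ^ i)) = d%:Z * i.
  case: i => i; first by rewrite -exprnP nrmX dvalX ?nrm_neq0 // vy -mulr_natr natz.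
  have yi := expf_neq0 i.+1 y0; have : v (nrm (y ^ Negz i * y ^+ i.+1)) = 0.
    by rewrite NegzE -exprnN mulVf // nrm1 dval1.
  have zi : y ^ Negz i != 0 by rewrite expfz_neq0.
  rewrite nrmM dvalM ?nrm_neq0 // nrmX dvalX ?nrm_neq0 // vy => /eqP.
  by rewrite addr_eq0 => /eqP->; rewrite -mulr_natr natz NegzE mulrN.
have vx' : v (nrm x') = (v (nrm x) %% d)%Z.
  by rewrite nrmM dvalM ?nrm_neq0 ?expfz_neq0 // nX {1}(divz_eq (v (nrm x)) d) -/q; ring.
apply/dvdz_mod0P; have dz : d%:Z != 0 by lia.
have := modz_ge0 (v (nrm x)) dz; have := ltz_mod (v (nrm x)) dz.
case E' : (_ %% _)%Z => [[|r]|//] // lt _; exfalso.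
have := dmin r.+1; rewrite /P /= => h; have : (d <= r.+1)%N.
  by apply: h; apply/asboolP; exists x' => //; rewrite vx' E'.
by move: lt; rewrite ltz_nat /= => lt; rewrite leqNgt lt.
Qed.
Let d : nat := sval (cid2 nrm_step).
Let d0 : (0 < d)%N. Proof. by rewrite /d; case: cid2. Qed.

Definition span_val (y : L) : int := (v (nrm y) %/ d)%Z.
Lemma span_valE y : y != 0 -> v (nrm y) = span_val y * d.
Proof.
by move=> y0; rewrite /span_val /d; case: cid2 => /= d' _ [_ /(_ _ y0) h]; rewrite divzK.
Qed.
Let dI x y : x * d%:Z = y * d%:Z -> x = y.
Proof. by apply: mulIf; rewrite -lt0n; exact: d0. Qed.
Fact span_valM x y : x != 0 -> y != 0 -> span_val (x * y) = span_val x + span_val y.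
Proof.
move=> x0 y0; apply: dI; rewrite mulrDl -!span_valE ?mulf_neq0 // nrmM dvalM //; exact: nrm_neq0.
Qed.
Let dle x y : (x * d%:Z <= y * d%:Z) = (x <= y).
Proof. by rewrite ler_pM2r //; exact: d0. Qed.
Fact span_valD x y : x != 0 -> y != 0 -> x + y != 0 ->
  Num.min (span_val x) (span_val y) <= span_val (x + y).
Proof.
wlog le : x y / span_val x <= span_val y.
  move=> h x0 y0 xy; case/orP: (le_total (span_val x) (span_val y)) => le; first exact: h.
  by rewrite minC addrC; apply: h => //; rewrite addrC.
move=> x0 y0 xy; rewrite min_l //.
have e' : x + y = x * (1 + x^-1 * y) by rewrite mulrDr mulr1 mulrA mulfV // mul1r.
have z0 : 1 + x^-1 * y != 0 by apply: contraNneq xy => z0; rewrite e' z0 mulr0.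
rewrite e' span_valM // lerDl -dle mul0r -span_valE // -(vgeE _ _ (nrm_neq0 z0)).
apply: nrm_one_add; rewrite vgeE ?nrm_neq0 ?mulf_neq0 ?invr_eq0 //.
rewrite span_valE ?mulf_neq0 ?invr_eq0 // mulr_ge0 // span_valM ?invr_eq0 //.
have : span_val 1 = 0 by apply: dI; rewrite -span_valE ?oner_neq0 // nrm1 dval1 mul0r.
by rewrite -(mulfV x0) span_valM ?invr_eq0 // => /eqP; rewrite addrC addr_eq0 => /eqP->; rewrite addrC subr_ge0.
Qed.
Fact span_val_surj : exists2 y : L, y != 0 & span_val y = 1.
Proof.
have [y y0 vy] : exists2 y : L, y != 0 & v (nrm y) = d by rewrite /d; case: cid2 => /= d' _ [].
by exists y => //; apply: dI; rewrite -span_valE // vy mul1r.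
Qed.
Definition span_dval : discreteValuation L := DiscreteValuation span_valM span_valD span_val_surj.
Local Notation w := span_dval.
Lemma vge_span (m : int) y : vge w m y = vge v (m * d) (nrm y).
Proof.
have [->|y0] := eqVneq y 0; first by rewrite vge0 /nrm rmorph0 det0 vge0.
by rewrite !vgeE ?nrm_neq0 // -dle -span_valE.
Qed.

(** With [coord_span] this says that [w] and the coordinates define the same topology; the factor
    [n.+1] undoes the scaling of the norm. *)
Lemma span_coord : exists B : nat, forall (m : int) y, vge w (n.+1%:Z * (m + B)) y -> 0 <= m + B ->
  forall j, vge v m (coord (mat y) j).
Proof.
have [B BP] := nrm_coord; exists B => m y hy mB j.
have [->|y0] := eqVneq y 0; first by rewrite raddf0 /coord mxE vge0.
have [m' hm' le] := BP y y0; apply: (vge_le _ (hm' j)).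
rewrite vge_span vgeE ?nrm_neq0 // in hy; have := le_trans hy le.
have : n.+1%:Z * (m + B) <= n.+1%:Z * (m + B) * d by rewrite ler_peMr ?mulr_ge0.
move=> /le_trans h {}/h; rewrite -mulr_natr natz mulrDr => h.
rewrite -(ler_pM2l (isT : 0 < n.+1%:Z)) [leRHS]mulrC.
by rewrite -(lerD2r B%:Z); apply: le_trans h; rewrite lerD2l ler_peMl.
Qed.
Lemma coord_span (m : nat) y : (forall j, vge v (d * m)%N (coord (mat y) j)) -> vge w m y.
Proof.
move=> h; rewrite vge_span; apply: (vge_le _ (vge_coord_nrm h)).
by rewrite -PoszM -[_ *+ n.+1]mulr_natr natz -PoszM lez_nat mulnC leq_pmulr.
Qed.

Lemma span_complete : complete_val w.
Proof.
move=> u hu; have [B BP] := span_coord.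
have tel a b : (a <= b)%N -> vge w a (u b - u a).
  move=> /subnKC <-; elim: (b - a)%N => [|c IH]; first by rewrite addn0 subrr vge0.
  rewrite (_ : _ - _ = (u (a + c.+1)%N - u (a + c)%N) + (u (a + c)%N - u a)); last by rewrite addrA subrK.
  apply: vgeD => //; rewrite addnS; apply: vge_le (hu _).
  by rewrite lez_nat leq_addr.
(* From index [f s] on, the coordinates are constant to level [s]. *)
pose f s := (n.+1 * (s + B))%N.
have hf s b : (f s <= b)%N -> forall j, vge v s (coord (mat (u b)) j - coord (mat (u (f s))) j).
  by move=> /tel h j; rewrite -coordB -raddfB; apply: BP => //; rewrite -PoszD -PoszM.
have /choice[z zP] (j : nat) : exists z, forall s : nat, vge v s (z - coord (mat (u (f s))) j).
  by apply: cv => s; apply: hf; rewrite leq_mul2l /= addSn.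
exists (lcomb z) => k; pose s := (d * k)%N.
rewrite -[lcomb z](subrK (u (f s))) -addrA; apply: vgeD.
  apply: coord_span => j; rewrite raddfB /= coordB mat_lcomb.
  by have := zP (inord j : 'I_n.+1) s; rewrite -(coord_comb z) /coord inord_val.
by apply: tel; rewrite (leq_trans (leq_pmull k d0)) // (leq_trans (leq_addr B _)) // leq_pmull.
Qed.

Lemma span_finite_residue : finite_residue w.
Proof.
have [B BP] := span_coord; have [W0 vW] := unifP v.
(* The coordinates of an integral element become integral after multiplication by the [B]-th power
   of the uniformizer. They are needed to level [d], hence to level [d + B] after the
   multiplication. *)
have [T [g gP]] := digits_mod (d * 1 + B).
exists {ffun 'I_n.+1 -> T}, (fun f : {ffun 'I_n.+1 -> T} => lcomb (fun j => g (f (inord j)) / unif v ^+ B)) => y hy.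
have hc j : vge v 0 (coord (mat y) j * unif v ^+ B).
  rewrite -(addNr B%:Z); apply: vge_mulW => //; apply: BP; rewrite addNr ?mulr0 //.
have /choice[t tP] (j : 'I_n.+1) := gP _ (hc j).
exists (finfun t); apply: (@coord_span 1) => j.
have cE A : coord A j = coord A (inord j : 'I_n.+1) by rewrite /coord inord_val.
rewrite raddfB /= coordB mat_lcomb !cE coord_comb inord_val ffunE.
rewrite (_ : _ - _ = (coord (mat y) (inord j : 'I_n.+1) * unif v ^+ B - g (t (inord j))) / unif v ^+ B);
  last by rewrite mulrBl mulfK ?expf_neq0.
rewrite (_ : Posz _ = (d * 1 + B)%N%:Z - B%:Z); last by rewrite PoszD addrK.
by apply: vgeM => //; rewrite vgeE ?invr_eq0 ?expf_neq0 // dvalV ?expf_neq0 // dvalX // vW natz.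
Qed.

Lemma finite_extension_local : exists (L : fieldType) (w : discreteValuation L)
    (jF : {rmorphism F -> L}) (jK : {rmorphism L -> K}),
  [/\ complete_val w, finite_residue w, forall a, jK (jF a) = iota a & forall u, exists z, jK z = comb u].
Proof.
exists L, w, span_base, (val : L -> K); split=> [|||u].
- exact: span_complete.
- exact: span_finite_residue.
- by [].
by exists (lcomb u).
Qed.
End NormValuation.
End FiniteExtension.
Import FiniteExtension.

(** * Simple extensions and finitely generated subfields *)

Section SimpleExtension.
Import Order.TTheory Num.Theory.
Variables (F K : fieldType) (iota : {rmorphism F -> K}) (v : discreteValuation F).
Hypotheses (cv : complete_val v) (fr : finite_residue v).

Section Integral.
Variables (y : K) (n : nat) (a : 'I_n.+1 -> F).
Hypothesis a_int : forall j, vge v 0 (a j).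
Hypothesis yE : y ^+ n.+1 = \sum_j iota (a j) * y ^+ j.
Hypothesis indep : forall u : 'I_n.+1 -> F, \sum_j iota (u j) * y ^+ j = 0 -> forall j, u j = 0.

(** The companion matrix of the integral equation of [y]: its powers are the integral matrices of
    multiplication by the powers of [y]. *)
Let C : 'M[F]_n.+1 := \matrix_(i, j) if i == ord_max then a j else ((j : nat) == i.+1)%:R.
Let e : 'cV[K]_n.+1 := \col_i y ^+ i.

Lemma companion_e j : map_mx iota (C ^+ j) *m e = y ^+ j *: e.
Proof.
elim: j => [|j IH]; first by rewrite !expr0 -[1 : 'M_ _]/(1%:M) map_scalar_mx rmorph1 mul1mx scale1r.
rewrite exprSr exprS -[_ * C]/(_ *m C) map_mxM -mulmxA mulrC.
suff -> : map_mx iota C *m e = y *: e by rewrite -scalemxAr IH scalerA mulrC.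
apply/matrixP => i k; rewrite !mxE; under eq_bigr do rewrite !mxE.
have [->|hi] := eqVneq i ord_max; first by rewrite /= -exprS -yE.
have lt : (i.+1 < n.+1)%N.
  by rewrite ltnS ltn_neqAle -ltnS ltn_ord andbT; apply: contraNneq hi => h; apply/eqP/val_inj.
rewrite (bigD1 (Ordinal lt)) //= eqxx rmorph1 mul1r big1 ?addr0 -?exprS // => j' hj.
by rewrite (_ : (_ == _) = false) ?rmorph0 ?mul0r //; apply: contraNF hj => /eqP h; apply/eqP/val_inj.
Qed.
Lemma companion_int j i k : vge v 0 ((C ^+ j) i k).
Proof.
elim: j i k => [|j IH] i k; first by rewrite expr0 mxE; case: eqP => _; [exact: vge1|exact: vge0].
rewrite exprS -[_ * _ ^+ _]/(C *m _) mxE; apply: vge_sum => b _; rewrite -[0]addr0; apply: vgeM => //.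
by rewrite mxE; case: ifP => // _; case: (_ == _); [exact: vge1|exact: vge0].
Qed.

Lemma integral_extension : exists (L : fieldType) (w : discreteValuation L)
    (jF : {rmorphism F -> L}) (jK : {rmorphism L -> K}),
  [/\ complete_val w, finite_residue w, forall a, jK (jF a) = iota a & exists z, jK z = y].
Proof.
have [||j|j i k|L [w [jF [jK [cw fw jE span]]]]] := @finite_extension_local F K iota v cv fr n e (fun j => C ^+ j).
- by rewrite mxE.
- move=> u hu; apply/rowP => j; rewrite mxE; apply: (indep (u := fun j => u 0 j)).
  have h : (map_mx iota u *m e) 0 0 = 0 by rewrite hu mxE.
  by rewrite -[RHS]h mxE; apply: eq_bigr => i _; rewrite !mxE.
- by rewrite companion_e mxE.
- exact: companion_int.
(* For [n = 0] the power basis is just 1 and [y] is the image of the constant [a ord0]; otherwise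
   [y] is the basis vector of index 1. *)
exists L, w, jF, jK; split=> //; case: (posnP n) => [n0|n0].
  have [z zE] := span (fun=> a ord0); exists z; rewrite zE /comb.
  transitivity (y ^+ n.+1); last by rewrite n0 expr1.
  rewrite yE; apply: eq_bigr => j _; rewrite mxE.
  by congr (iota (a _) * _); apply/val_inj => /=; case: j => j; rewrite /= n0; case: j.
have [z zE] := span (fun j => (j == 1%N)%:R); exists z; rewrite zE /comb.
have lt : (1 < n.+1)%N by [].
rewrite (bigD1 (Ordinal lt)) //= rmorph1 mul1r mxE expr1 big1 ?addr0 // => j hj.
by rewrite (_ : (_ == _) = false) ?rmorph0 ?mul0r //; apply: contraNF hj => /eqP h; apply/eqP/val_inj.
Qed.
End Integral.

(** The minimal equation of [x] need not be integral; that of [W x] is, for [W] of large valuation,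
    and [W x] generates the same field. *)
Lemma local_adjoin x : algebraicOver iota x -> exists (L : fieldType) (w : discreteValuation L)
    (jF : {rmorphism F -> L}) (jK : {rmorphism L -> K}),
  [/\ complete_val w, finite_residue w, forall a, jK (jF a) = iota a & exists z, jK z = x].
Proof.
move=> [p0 p00 rp0]; have [W0 vW] := unifP v.
pose P s := `[< exists p : {poly F}, [/\ p != 0, size p = s & root (map_poly iota p) x] >].
have exP : exists s, P s by exists (size p0); apply/asboolP; exists p0.
case: (ex_minnP exP) => s /asboolP[p [pn0 ps rp]] smin.
have [n sn] : exists n, s = n.+2.
  case: s ps {smin} => [|[|n]] ps; last by exists n.
    by move/eqP: ps; rewrite size_poly_eq0 (negPf pn0).
  have /size_poly1P[c c0 pc] : size p == 1%N by apply/eqP.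
  by move: rp; rewrite pc map_polyC /= rootC fmorph_eq0 (negPf c0).
pose c j := - (p`_j / p`_n.+1).
have pl : p`_n.+1 != 0.
  by have := pn0; rewrite -lead_coef_eq0 lead_coefE ps sn.
have xE : x ^+ n.+1 = \sum_(j < n.+1) iota (c j) * x ^+ j.
  move/rootP: rp; rewrite horner_coef size_map_poly ps sn big_ord_recr /= => /eqP.
  rewrite addrC addr_eq0 coef_map /= => /eqP h; apply: (mulfI (_ : iota p`_n.+1 != 0)); first by rewrite fmorph_eq0.
  rewrite h -sumrN mulr_sumr; apply: eq_bigr => j _; rewrite coef_map /=.
  have -> : p`_j = - (c j * p`_n.+1) by rewrite /c mulNr divfK // opprK.
  by rewrite rmorphN rmorphM mulNr opprK mulrA [in LHS](mulrC (iota (c j))) .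
have [t tP] : exists t : nat, forall j : 'I_n.+1, vge v (- t%:Z) (c j).
  exists (\max_(j < n.+1) absz (v (c j)))%N => j; apply/orP; right.
  apply: le_trans (_ : - (absz (v (c j)))%:Z <= _); last by lia.
  by rewrite lerN2 lez_nat (leq_bigmax j).
have [W Wn0 vWt] : exists2 W, W != 0 & v W = t.
  by exists (unif v ^+ t); rewrite ?expf_neq0 // dvalX // vW natz.
have [||u hu j|L [w [jF [jK [cw fw jE [z zE]]]]]] :=
  @integral_extension (iota W * x) n (fun j => c j * W ^+ (n.+1 - j)).
- move=> j; have jn : (j < n.+1)%N by []; rewrite -(subnSK jn) exprSr mulrA mulrAC -[0]addr0; apply: vgeM.
    by rewrite -[0](addNr t%:Z); apply: vgeM => //; rewrite vgeE // vWt.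
  by apply: vgeX0; rewrite vgeE // vWt.
- rewrite exprMn xE mulr_sumr; apply: eq_bigr => j _.
  have jn : (j <= n.+1)%N by exact: ltnW.
  by rewrite exprMn rmorphM rmorphXn -[in iota W ^+ n.+1](subnK jn) exprD; ring.
(* A relation between the powers of [W x] gives a polynomial of smaller degree vanishing at [x],
   against minimality. *)
- pose q : {poly F} := \poly_(i < n.+1) (u (inord i) * W ^+ i).
  have q0 : q = 0.
    apply/eqP/negPn/negP => q0; have := smin (size q); rewrite sn leqNgt ltnS size_poly => h.
    apply: (notF (h _)); apply/asboolP; exists q; split=> //; apply/rootP.
    rewrite (horner_coef_wide (n := n.+1)) ?size_map_poly ?size_poly // -[RHS]hu; apply: eq_bigr => i _.
    by rewrite coef_map coef_poly ltn_ord inord_val /= exprMn rmorphM rmorphXn mulrA.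
  have /(congr1 (fun q : {poly F} => q`_j)) := q0; rewrite /= coef_poly ltn_ord inord_val coef0 => /eqP.
  by rewrite mulf_eq0 expf_eq0 (negPf Wn0) andbF orbF => /eqP.
exists L, w, jF, jK; split=> //; exists (jF W^-1 * z).
by rewrite rmorphM jE zE mulrA -rmorphM mulVf // rmorph1 mul1r.
Qed.
End SimpleExtension.

Section AlgebraicOverLocal.
Import Order.TTheory Num.Theory.
Variables (F K : fieldType) (iota : {rmorphism F -> K}) (v : discreteValuation F).
Hypotheses (cv : complete_val v) (fr : finite_residue v) (alg : forall x, algebraicOver iota x).

Lemma local_subfield (xs : seq K) : exists (L : fieldType) (w : discreteValuation L)
    (jF : {rmorphism F -> L}) (jK : {rmorphism L -> K}),
  [/\ complete_val w, finite_residue w, forall a, jK (jF a) = iota a &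
      forall x, x \in xs -> exists z, jK z = x].
Proof.
elim: xs => [|x xs [L [w [jF [jK [cw fw jE hxs]]]]]]; first by exists F, v, idfun, iota; split.
have [|L' [w' [jF' [jK' [cw' fw' jE' hx]]]]] := @local_adjoin L K jK w cw fw x.
  have [p p0 rp] := alg x; exists (map_poly jF p); first by rewrite map_poly_eq0.
  by rewrite -map_poly_comp (eq_map_poly jE).
exists L', w', (jF' \o jF), jK'; split=> // [a|y]; first by rewrite /= jE'.
rewrite inE => /orP[/eqP->//|/hxs[z <-]]; exists (jF' z); exact: jE'.
Qed.

Variables (l : nat) (l_pr : prime l).
Local Notation syF := (@sy 'F_l F).
Local Notation sy := (@sy 'F_l K).

Lemma algebraic_dim1 a b c d : sy a * sy b <> 0 -> exists m, sy c * sy d = sy a * sy b *+ m.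
Proof.
have [L [w [jF [jK [cw fw _ h]]]]] := local_subfield [:: a; b; c; d].
have [a' <-] := h a (mem_head _ _).
have [b' <-] : exists z, jK z = b by apply: h; rewrite !inE eqxx orbT.
have [c' <-] : exists z, jK z = c by apply: h; rewrite !inE eqxx !orbT.
have [d' <-] : exists z, jK z = d by apply: h; rewrite !inE eqxx !orbT.
have r1 := rank1_dim (rank1_local cw fw l_pr); rewrite -!(milnor_functor_sy 'F_l jK) -!rmorphM => ab.
have [|m ->] := r1 a' b' c' d'; first by move=> ab0; apply: ab; rewrite ab0 rmorph0.
by exists m; rewrite rmorphMn.
Qed.

(** The condition asks for the equality [{e, b} = {-1, -1}] over [F], because an equality survives
    in [K], where the nonvanishing of [{e, b}] could be lost. *)
Lemma koszul_local :
  (l = 2%N -> syF (- 1) * syF (- 1) <> 0 ->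
    exists e b, syF e * syF (- 1) = 0 /\ syF e * syF b = syF (- 1) * syF (- 1)) ->
  koszul_algebra (milnorK 'F_l K) /\
  forall (c : milnorK 'F_l K) (hc : homogeneous 1 c), koszul_module (principal_ideal hc).
Proof.
move=> H4; apply: koszul_onedim => //; first exact: algebraic_dim1.
apply: nondeg_of_neg1 => // [|l2 N1]; first exact: algebraic_dim1.
have fun11 : sy (- 1) = milnor_functor 'F_l iota (syF (- 1)) by rewrite milnor_functor_sy rmorphN1.
have [|e [b [eN1 eb]]] := H4 l2; first by move=> h; apply: N1; rewrite fun11 -rmorphM h rmorph0.
exists (iota e); first by rewrite fun11 -milnor_functor_sy -rmorphM eN1 rmorph0.
by exists (iota b); rewrite -!milnor_functor_sy -rmorphM eb rmorphM -fun11.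
Qed.
End AlgebraicOverLocal.

(** * The fields of p-adic numbers and of Laurent series *)

Section Fractions.
Local Open Scope quotient_scope.
Variable D : idomainType.
Lemma tofrac_inj : injective (@FracField.tofrac D).
Proof. by move=> x y /eqP; rewrite tofrac_eq => /eqP. Qed.
Lemma frac_ratio (q : {fraction D}) :
  exists a, exists2 b, b != 0 & q = FracField.tofrac a / FracField.tofrac b.
Proof.
elim/quotW: q => x; exists (\n_x), (\d_x); first exact: denom_ratioP.
have d0 : FracField.tofrac \d_x != 0 by rewrite tofrac_eq0 denom_ratioP.
apply: (mulIf d0); rewrite divfK //; unlock FracField.tofrac.
rewrite -[LHS]FracField.pi_mul; apply/eqmodP => /=.
rewrite FracField.equivfE /FracField.mulf !numden_Ratio ?mulf_neq0 ?oner_neq0 ?denom_ratioP //.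
by rewrite !mulr1 mulrC.
Qed.
End Fractions.

(** * The fraction field of a complete discrete valuation ring *)

Section CompleteRing.
Import Order.TTheory Num.Theory.
Variables (D : idomainType) (W : D).
Hypothesis W0 : W != 0.
Hypothesis separated : forall x, (forall n : nat, exists d, x = W ^+ n * d) -> x = 0.
Hypothesis complete : forall u : nat -> D, (forall n, exists d, u n.+1 - u n = W ^+ n * d) ->
  exists x, forall n, exists d, x - u n = W ^+ n * d.
Hypothesis local_ring : forall x, (forall d, x <> W * d) -> exists z d, x * z = 1 - W * d.
Hypothesis W_nonunit : W \isn't a GRing.unit.

(** The inverse is the limit of the geometric series. *)
Lemma one_sub_unit d : 1 - W * d \is a GRing.unit.
Proof.
have [n|x hx] := complete (u := fun n => \sum_(i < n) (W * d) ^+ i).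
  by exists (d ^+ n); rewrite big_ord_recr /= addrAC subrr add0r exprMn.
apply/unitrPr; exists x; apply/eqP; rewrite -subr_eq0; apply/eqP/separated => n.
have [e he] := hx n; exists ((1 - W * d) * e - d ^+ n).
have := subrX1 (W * d) n => hn.
have -> : x = \sum_(i < n) (W * d) ^+ i + W ^+ n * e by rewrite -he addrC subrK.
rewrite mulrDr -[1 - W * d]opprB mulNr -hn exprMn; ring.
Qed.

(** Divide by the largest possible power of [W]. By [local_ring] the cofactor is invertible modulo
    [W], hence a unit by [one_sub_unit]. *)
Lemma unit_decomp x : x != 0 -> exists n u, u \is a GRing.unit /\ x = W ^+ n * u.
Proof.
move=> x0; have exn : exists n, ~~ `[< exists d, x = W ^+ n * d >].
  apply: contrapT => h; case/eqP: x0; apply: separated => n; apply: contrapT => h'.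
  by apply: h; exists n; apply/asboolPn.
case: (ex_minnP exn) => -[|k] /asboolPn nk kmin; first by case: nk; exists x; rewrite mul1r.
have [y xy] : exists y, x = W ^+ k * y.
  by apply: contrapT => /asboolPn /kmin; rewrite ltnn.
have [|z [d yz]] := local_ring (x := y).
  by move=> d yd; apply: nk; exists d; rewrite xy yd exprSr mulrA.
exists k, y; split=> //; have := one_sub_unit d; rewrite -yz unitrM.
by case/andP.
Qed.

Local Notation K := {fraction D}.
Local Notation i := (@FracField.tofrac D).
Local Notation w := (i W).
Local Notation U := (fun u : D => u \is a GRing.unit).

Lemma w0 : w != 0. Proof. by rewrite tofrac_eq0. Qed.
Lemma unit_tofrac0 u : U u -> i u != 0.
Proof. by move=> uu; rewrite tofrac_eq0; apply: contraTneq uu => ->; rewrite unitr0. Qed.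

Lemma frac_decomp (q : K) : q != 0 -> exists m : int, exists2 u, U u & q = w ^ m * i u.
Proof.
have [a [b b0 ->]] := frac_ratio q.
rewrite mulf_eq0 invr_eq0 !tofrac_eq0 (negPf b0) orbF => a0.
have [n [u [uu ->]]] := unit_decomp a0; have [n' [u' [uu' ->]]] := unit_decomp b0.
exists (n%:Z - n'%:Z); exists (u / u'); first by rewrite unitrM uu unitrV.
have hV : i u'^-1 = (i u')^-1.
  by apply: (mulfI (unit_tofrac0 uu')); rewrite -rmorphM mulrV // rmorph1 mulfV // unit_tofrac0.
have -> : i (u / u') = i u / i u' by rewrite -hV -rmorphM.
rewrite !(rmorphM, rmorphXn) /= expfzDr ?w0 // -exprnN -exprnP invfM.
by rewrite -!mulrA; congr (_ * _); rewrite mulrC -!mulrA; congr (_ * _); rewrite mulrC.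
Qed.

Lemma frac_decomp_uniq (m m' : int) u u' : U u -> U u' -> w ^ m * i u = w ^ m' * i u' -> m = m'.
Proof.
wlog le : m m' u u' / m <= m'.
  by move=> h hu hu' e; case/orP: (le_total m m') => le; [apply: h e|apply/esym/(h _ _ u' u)].
move=> hu hu' e; have [k mk] : exists k : nat, m' = m + k.
  by exists (absz (m' - m)); lia.
case: k mk => [|k] mk; first by rewrite mk addr0.
case/negP: W_nonunit; move: e; rewrite mk expfzDr ?w0 // -mulrA => /(mulfI (expfz_neq0 _ w0)).
rewrite -exprnP -rmorphXn -rmorphM => /tofrac_inj e.
by move: hu; rewrite e !unitrM exprS unitrM => /andP[/andP[]].
Qed.

Definition frac_val (q : K) : int :=
  if pselect (exists m : int, exists2 u, U u & q = w ^ m * i u) is left h then sval (cid h) else 0.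
Lemma frac_valE q (m : int) u : U u -> q = w ^ m * i u -> frac_val q = m.
Proof.
move=> hu e; rewrite /frac_val; case: pselect => [h|[]]; last by exists m; exists u.
have [u' hu' e'] := svalP (cid h); apply: (frac_decomp_uniq hu' hu); rewrite -e.
exact/esym.
Qed.
Lemma frac_val_ge (m : int) (d : D) : d != 0 -> m <= frac_val (w ^ m * i d).
Proof.
move=> d0; have [n [u [hu e]]] := unit_decomp d0.
rewrite (@frac_valE _ (m + n%:Z) u) ?lerDl //.
by rewrite e rmorphM rmorphXn expfzDr ?w0 // -exprnP mulrA.
Qed.
Fact frac_valM (x y : K) : x != 0 -> y != 0 -> frac_val (x * y) = frac_val x + frac_val y.
Proof.
move=> /frac_decomp[m [u hu ex]] /frac_decomp[m' [u' hu' ey]].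
rewrite (frac_valE hu ex) (frac_valE hu' ey); apply: (@frac_valE _ _ (u * u')).
  by rewrite unitrM hu.
by rewrite ex ey expfzDr ?w0 // rmorphM; ring.
Qed.
Fact frac_valD (x y : K) : x != 0 -> y != 0 -> x + y != 0 ->
  Num.min (frac_val x) (frac_val y) <= frac_val (x + y).
Proof.
wlog le : x y / frac_val x <= frac_val y.
  move=> h x0 y0 xy; case/orP: (le_total (frac_val x) (frac_val y)) => le; first exact: h.
  have yx : y + x != 0 by rewrite [y + x]addrC.
  by rewrite minC [x + y]addrC; exact: h.
move=> /frac_decomp[m [u hu ex]] /frac_decomp[m' [u' hu' ey]].
move: le; rewrite (frac_valE hu ex) (frac_valE hu' ey) => le; rewrite min_l //.
have [k mk] : exists k : nat, m' = m + k%:Z by exists (absz (m' - m)); lia.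
have -> : x + y = w ^ m * i (u + W ^+ k * u').
  by rewrite ex ey mk expfzDr ?w0 // -exprnP rmorphD rmorphM rmorphXn mulrDr mulrA.
by rewrite mulf_eq0 tofrac_eq0 negb_or => /andP[_]; exact: frac_val_ge.
Qed.
Fact frac_val_surj : exists2 x : K, x != 0 & frac_val x = 1.
Proof. by exists w; [exact: w0|apply: (@frac_valE _ 1 1); rewrite ?unitr1 // rmorph1 mulr1]. Qed.
Definition frac_dval : discreteValuation K := DiscreteValuation frac_valM frac_valD frac_val_surj.

Lemma vge_frac (n : nat) (q : K) : vge frac_dval n q <-> exists d, q = i (W ^+ n * d).
Proof.
split=> [|[d ->]]; last first.
  have [->|d0] := eqVneq d 0; first by rewrite mulr0 rmorph0 vge0.
  by apply/orP; right; rewrite rmorphM rmorphXn; exact: frac_val_ge.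
have [->|q0] := eqVneq q 0; first by exists 0; rewrite mulr0 rmorph0.
rewrite vgeE // => le; have [m [u hu e]] := frac_decomp q0.
move: le; rewrite /= (frac_valE hu e) => le.
have [k mk] : exists k : nat, m = n%:Z + k%:Z by exists (absz (m - n%:Z)); lia.
by exists (W ^+ k * u); rewrite e mk expfzDr ?w0 // -!exprnP !(rmorphM, rmorphXn) /= mulrA.
Qed.

(** All differences [u n - u 0] lie in [D], so completeness of [D] applies after subtracting
    [u 0]. *)
Lemma frac_complete : complete_val frac_dval.
Proof.
move=> u hu; have hu' n : vge frac_dval 0%N (u n - u 0%N).
  elim: n => [|n IH]; first by rewrite subrr vge0.
  rewrite -[u n.+1](subrK (u n)) -addrA; apply: vgeD => //; exact: vge_le (hu n).
have /choice[c cP] n : exists c, u n - u 0%N = i c.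
  by have /vge_frac[d ->] := hu' n; exists (W ^+ 0 * d).
have [n|x hx] := complete (u := c).
  have /vge_frac[d hd] := hu n; exists d; apply: tofrac_inj; rewrite -hd rmorphB /= -!cP.
  by rewrite opprB addrA subrK.
exists (u 0%N + i x) => n; have [d hd] := hx n; apply/vge_frac; exists d.
by rewrite -hd rmorphB /= -cP opprB addrCA addrA addrC.
Qed.

Lemma frac_finite_residue (T : finType) (g : T -> D) :
  (forall x, exists t d, x - g t = W * d) -> finite_residue frac_dval.
Proof.
move=> gP; exists T, (i \o g) => y /(vge_frac 0)[d ->]; rewrite mul1r.
have [t [d' e]] := gP d; exists t; apply/(vge_frac 1); exists d'.
by rewrite expr1 -e rmorphB.
Qed.
End CompleteRing.

(** * The symbol {-1, -1} modulo 2 *)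

Section NegOne.
Import Order.TTheory Num.Theory.
Variables (K : fieldType) (v : discreteValuation K) (cv : complete_val v) (fr : finite_residue v).
Local Notation sy := (@sy 'F_2 K).

Lemma odd_neg1 : ~ vge v 1 2%:R -> sy (- 1) * sy (- 1) = 0.
Proof.
move=> h2; have [k [res res_map]] := residue_field_exists fr.
apply: (tame_neg1 cv res_map (l := 2)) => //; rewrite -(resK_nat res_map).
by apply/eqP => /(resK_eq0 res_map (vge_nat v 2)).
Qed.

(* -3 is 5 times a square, and {2,-1}, {3,-2}, {-4,5} are Steinberg symbols, whence {2,-3} = {-1,-1}. *)
Lemma dyadic_neg1 : (2%:R : K) != 0 -> v 2%:R = 1 ->
  exists e b, sy e * sy (- 1) = 0 /\ sy e * sy b = sy (- 1) * sy (- 1).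
Proof.
move=> K2 v2; have l_pr : prime 2 by [].
have tw (x : milnorK 'F_2 K) : x + x = 0.
  by have := milnor_mulrl l_pr x; rewrite mulr2n.
have opp (x : milnorK 'F_2 K) : - x = x by apply/eqP; rewrite eq_sym -addr_eq0 tw.
have v4 : vge v 2 (4%:R : K) by rewrite (_ : 4 = 2 * 2)%N // natrM -[2]/(1 + 1); apply: vgeM; rewrite vgeE // v2.
have v8 : vge v 3 (8%:R : K) by rewrite (_ : 8 = 2 * 4)%N // natrM -[3]/(1 + 2); apply: vgeM; rewrite // vgeE // v2.
have [n5 v5] : (5%:R : K) != 0 /\ v 5%:R = 0.
  apply: (unit1_val (i := 1)) => //; rewrite /unit1 -[1 in X in vge _ _ X]/(1%:R) -natrB //.
  by apply: vge_le v4.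
have n3 : (3%:R : K) != 0.
  have [] // := @unit1_val K v 1 (3%:R : K) isT.
  by rewrite /unit1 -[1 in X in vge _ _ X]/(1%:R) -natrB // vgeE // v2.
have n1 : (-1 : K) != 0 by rewrite oppr_eq0 oner_eq0.
(* [-3/5 = 1 - 8/5] is a unit of level 3, above the critical level 2 for [l = 2] and [e = 1]. *)
have [y ye] : exists y, - 3%:R / 5%:R = y ^+ 2 :> K.
  apply: (@unit1_root K v cv 2 l_pr 1 K2 v2 3) => //; rewrite /unit1.
  have -> : - 3%:R / 5%:R - 1 = - (8%:R / 5%:R) :> K by field.
  by rewrite vgeN -[_%:Z]addr0; apply: vgeM => //; rewrite vgeE ?invr_eq0 // dvalV // v5.
have y0 : y != 0.
  by apply: contra_eq_neq ye => ->; rewrite expr0n mulf_neq0 ?invr_eq0 ?oppr_eq0.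
have s35 : sy (- 1) + sy 3%:R = sy 5%:R.
  have e3 : - 3%:R = 5%:R * y ^+ 2 by rewrite -ye mulrC divfK.
  by rewrite -syM // mulN1r e3 sy_mulXl.
have s21 : sy 2%:R * sy (- 1) = 0 by apply: sy_steinbergD; rewrite (natrD _ 1 1) addrK.
have s23 : sy 3%:R * sy 2%:R = sy 3%:R * sy (- 1).
  have : sy 3%:R * sy (- 2%:R) = 0 by apply: sy_steinbergD; rewrite (natrD _ 1 2) addrK.
  by rewrite syN // mulrDr => /eqP; rewrite addrC addr_eq0 opp => /eqP.
have s51 : sy (- 1) * sy 5%:R = 0.
  have : sy (- 4%:R) * sy 5%:R = 0 by apply: sy_steinbergD; rewrite (natrD _ 1 4) addrC addrK.
  have -> : - 4%:R = - 1 * 2%:R ^+ 2 :> K by ring.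
  by rewrite sy_mulXl.
exists 2%:R, (- 3%:R); split=> //; rewrite syN // mulrDr s21 add0r syC opp s23.
have -> : sy 3%:R = sy (- 1) + sy 5%:R by rewrite -s35 addrA tw add0r.
by rewrite mulrDl [sy 5%:R * _]syC s51 oppr0 addr0.
Qed.
End NegOne.

(** * Power series and Laurent series *)

Module PowerSeriesField.
Section Series.
Import Order.TTheory Num.Theory.
Variable F : fieldType.
Local Notation S := (powerSeries F).
Definition psX : S := PowerSeries (fun n => (n == 1%N)%:R).
Definition psC (c : F) : S := PowerSeries (fun n => if n is 0 then c else 0).

Lemma psX_coef (f : S) n : pscoef (psX * f) n = if n is m.+1 then pscoef f m else 0.
Proof.
case: n => [|n] /=; first by rewrite big_ord1 mul0r.
rewrite big_ord_recl mul0r add0r big_ord_recl /= subn1 mul1r big1 ?addr0 //.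
by move=> i _; rewrite mul0r.
Qed.
Lemma psXn_coef n (f : S) m : pscoef (psX ^+ n * f) m = if (m < n)%N then 0 else pscoef f (m - n).
Proof.
elim: n m => [|n IH] m; first by rewrite mul1r subn0.
by rewrite exprS -mulrA psX_coef; case: m => [|m] //; rewrite IH.
Qed.
Lemma psX_div n (f g : S) : (forall m, (m < n)%N -> pscoef f m = pscoef g m) <->
  exists d, f - g = psX ^+ n * d.
Proof.
split=> [h|[d e] m mn]; last first.
  have : pscoef (f - g) m = 0 by rewrite e psXn_coef mn.
  by move/subr0_eq.
exists (PowerSeries (fun m => pscoef (f - g) (m + n))); apply: psP => m.
rewrite psXn_coef; case: ltnP => mn /=; last by rewrite subnK.
by rewrite h // subrr.
Qed.
Fact psC_zmod : zmod_morphism psC.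
Proof. by move=> c d; apply: psP => -[|n] //=; rewrite subr0. Qed.
Fact psC_monoid : monoid_morphism psC.
Proof.
split=> [|c d]; first by apply: psP => -[|n].
apply: psP => -[|n] /=; first by rewrite big_ord1.
rewrite big_ord_recl /= mulr0 add0r big1 // => i _.
by rewrite mul0r.
Qed.
HB.instance Definition _ := GRing.isZmodMorphism.Build F S psC psC_zmod.
HB.instance Definition _ := GRing.isMonoidMorphism.Build F S psC psC_monoid.

Lemma psX_neq0 : psX != 0.
Proof. by apply/eqP => /(congr1 (fun f => pscoef f 1)) /eqP; rewrite /= oner_eq0. Qed.
Lemma ps_separated (f : S) : (forall n : nat, exists d, f = psX ^+ n * d) -> f = 0.
Proof. by move=> h; apply: psP => n; have [d ->] := h n.+1; rewrite psXn_coef ltnSn. Qed.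
Lemma ps_complete (u : nat -> S) : (forall n, exists d, u n.+1 - u n = psX ^+ n * d) ->
  exists f, forall n, exists d, f - u n = psX ^+ n * d.
Proof.
move=> hu; exists (PowerSeries (fun m => pscoef (u m.+1) m)) => n; apply/psX_div => m /subnKC <- /=.
elim: (n - m.+1)%N => [|i ->]; first by rewrite addn0.
by apply/esym; move: m (hu (m.+1 + i)%N) => m; rewrite addnS => /psX_div; apply; rewrite leq_addr.
Qed.
Lemma ps_local (f : S) : (forall d, f <> psX * d) -> exists g d, f * g = 1 - psX * d.
Proof.
move=> h; have f0 : pscoef f 0 != 0.
  apply/eqP => f0; have [|d] := (psX_div 1 f 0).1; first by case.
  by rewrite subr0; exact: h.
exists (psC (pscoef f 0)^-1).
have [|d e] := (psX_div 1 (f * psC (pscoef f 0)^-1) 1).1; first by case=> //= _; rewrite big_ord1 mulfV.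
by exists (- d); rewrite mulrN opprK -[psX]expr1 -e addrC subrK.
Qed.
Lemma psX_nonunit : psX \isn't a GRing.unit.
Proof.
apply/negP => /unitrPr[f /(congr1 (fun f => pscoef f 0))] /eqP.
by rewrite psX_coef /= eq_sym oner_eq0.
Qed.
End Series.
End PowerSeriesField.
Import PowerSeriesField.

Lemma laurent_local (F : finFieldType) :
  exists v : discreteValuation (laurentSeries F), complete_val v /\ finite_residue v.
Proof.
exists (frac_dval (psX_neq0 F) (@ps_separated F) (@ps_complete F) (@ps_local F) (psX_nonunit F)); split.
  exact: frac_complete.
apply: (frac_finite_residue _ _ _ _ _ (g := @psC F)) => f; exists (pscoef f 0).
by rewrite -[psX F]expr1; apply/psX_div; case.
Qed.

(** -1 is a constant, so the symbol comes from the finite field [F]. *)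
Lemma laurent_neg1 (F : finFieldType) :
  sy 'F_2 (- 1 : laurentSeries F) * sy 'F_2 (- 1) = 0.
Proof.
pose i : {rmorphism F -> laurentSeries F} := @FracField.tofrac (powerSeries F) \o @psC F.
rewrite -(rmorphN1 i) -(milnor_functor_sy 'F_2 i) -rmorphM finField_symbols0 // rmorph0.
by [].
Qed.

(** * The p-adic numbers *)

Section PadicField.
Import Order.TTheory Num.Theory.
Variables (p : nat) (p_pr : prime p).
Local Notation Z := (padic_int p_pr).
Local Notation pN := (padic_nat p_pr).
Local Notation P := (pN p).

Lemma padic_expr n : P ^+ n = pN (p ^ n).
Proof.
elim: n => [|n IH] //; rewrite exprS IH; apply: padicP => m /=.
by rewrite modnMm -expnS.
Qed.
Lemma padic_expr_coef n (d : Z) m : pmod (P ^+ n * d) m = (p ^ n * pmod d m %% p ^ m)%N.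
Proof. by rewrite padic_expr /= modnMml. Qed.
Lemma padic_divP n (x : Z) : pmod x n = 0%N <-> exists d, x = P ^+ n * d.
Proof.
split=> [xn|[d ->]]; last by rewrite padic_expr_coef modnMr.
have q m : exists q, pmod x (m + n) = (p ^ n * q)%N.
  have : (p ^ n %| pmod x (m + n))%N by rewrite /dvdn -pmodE ?leq_addl // xn.
  by case/dvdnP=> q ->; exists q; rewrite mulnC.
have pn0 : (0 < p ^ n)%N by rewrite expn_gt0 prime_gt0.
pose f m := (pmod x (m + n) %/ p ^ n)%N.
have cf m : f m.+1 = f m %[mod p ^ m].
  rewrite /f (@pmodE _ _ x (m + n) (m.+1 + n)) ?leq_add2r //; have [r ->] := q m.+1.
  by rewrite addnC expnD -muln_modr // !mulKn // modn_mod.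
exists (padic_of p_pr cf); apply: padicP => m; rewrite padic_expr_coef /= modnMmr /f.
have [r hr] := q m; rewrite hr mulKn // -hr -pmodE //.
exact: leq_addr.
Qed.
Lemma padic_subP n (x y : Z) : pmod x n = pmod y n <-> exists d, x - y = P ^+ n * d.
Proof.
rewrite -padic_divP; split=> [h|h].
  rewrite [pmod _ _]/= h modnDmr subnKC ?modnn // -pmod_mod ltnW // ltn_mod expn_gt0 prime_gt0 //.
have -> : pmod x n = ((pmod (x - y)%R n + pmod y n) %% p ^ n)%N by rewrite -{1}[x](subrK y).
by rewrite h add0n pmod_mod.
Qed.
Lemma padic_p_neq0 : P != 0.
Proof.
apply/eqP => /(congr1 (fun x => pmod x 2)) /eqP /=; rewrite mod0n modn_small.
  by rewrite eqn0Ngt prime_gt0.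
by rewrite -[X in (X < _)%N]expn1 ltn_exp2l // prime_gt1.
Qed.
Lemma padic_separated (x : Z) : (forall n : nat, exists d, x = P ^+ n * d) -> x = 0.
Proof. by move=> h; apply: padicP => n /=; rewrite mod0n; apply/padic_divP. Qed.
Lemma padic_complete (u : nat -> Z) : (forall n, exists d, u n.+1 - u n = P ^+ n * d) ->
  exists x, forall n, exists d, x - u n = P ^+ n * d.
Proof.
move=> hu; pose f n := pmod (u n) n.
have cf n : f n.+1 = f n %[mod p ^ n].
  by rewrite /f -pmodE // pmod_mod; apply/padic_subP.
by exists (padic_of p_pr cf) => n; apply/padic_subP; rewrite /= /f pmod_mod.
Qed.
Lemma padic_local (x : Z) : (forall d, x <> P * d) -> exists z d, x * z = 1 - P * d.
Proof.
move=> h; have x1 : pmod x 1 <> 0%N.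
  by move/padic_divP => [d]; rewrite expr1; exact: h.
have lt : (pmod x 1 < p)%N by rewrite -[X in (_ < X)%N]expn1 -pmod_mod ltn_mod expn_gt0 prime_gt0.
have cop : coprime (pmod x 1) p.
  by rewrite coprime_sym prime_coprime // gtnNdvd // lt0n; apply/eqP.
have a0 : (0 < pmod x 1)%N by rewrite lt0n; apply/eqP.
have [km kn e _] := egcdnP p a0; rewrite (eqP cop) in e.
have [|d hd] := (padic_subP 1 (x * pN km) 1).1.
  by rewrite /= expn1 modnMmr mulnC e modnMDl.
by exists (pN km), (- d); rewrite mulrN opprK -[P]expr1 -hd addrC subrK.
Qed.
Lemma padic_p_nonunit : P \isn't a GRing.unit.
Proof.
apply/negP => /unitrPr[x] /(congr1 (fun x => pmod x 1)) /eqP.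
by rewrite -[P]expr1 padic_expr_coef /= !expn1 modnMr modn_small // prime_gt1.
Qed.

Definition padic_val : discreteValuation (padic_field p_pr) :=
  frac_dval padic_p_neq0 padic_separated padic_complete padic_local padic_p_nonunit.
Lemma padic_val_complete : complete_val padic_val.
Proof. exact: frac_complete. Qed.
Lemma padic_val_finite : finite_residue padic_val.
Proof.
apply: (frac_finite_residue _ _ _ _ _ (T := 'I_p) (g := fun i => pN i)) => x.
have lt : (pmod x 1 < p)%N by rewrite -[X in (_ < X)%N]expn1 -pmod_mod ltn_mod expn_gt0 prime_gt0.
exists (Ordinal lt); rewrite -[P]expr1; apply/padic_subP => /=.
by rewrite pmod_mod.
Qed.
Lemma padic_natr n : (n%:R : Z) = pN n.
Proof.
elim: n => [|n IH] //; rewrite -addn1 natrD IH; apply: padicP => m /=.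
by rewrite modnDm.
Qed.
Lemma padic_val_p : (p%:R : padic_field p_pr) != 0 /\ padic_val p%:R = 1.
Proof.
have -> : p%:R = FracField.tofrac P by rewrite -padic_natr rmorph_nat.
split; first by rewrite tofrac_eq0 padic_p_neq0.
by apply: (frac_valE padic_p_neq0 padic_p_nonunit (m := 1) (u := 1)); rewrite ?unitr1 // rmorph1 mulr1.
Qed.

Lemma padic_neg1 : let K := padic_field p_pr in
  sy 'F_2 (- 1 : K) * sy 'F_2 (- 1) <> 0 -> exists e b : K,
    sy 'F_2 e * sy 'F_2 (- 1) = 0 /\ sy 'F_2 e * sy 'F_2 b = sy 'F_2 (- 1) * sy 'F_2 (- 1).
Proof.
move=> K N1; have [p0 vp] := padic_val_p; have [p2|podd] := even_prime p_pr.
  have e2 : 2%:R = p%:R :> K by rewrite -[2%N]p2.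
  by apply: (dyadic_neg1 padic_val_complete); rewrite e2.
case: N1; apply: (odd_neg1 padic_val_complete padic_val_finite) => h2.
(* If 2 lay in the maximal ideal together with the odd [p], so would [1 = p - 2 * p./2]. *)
suff : vge padic_val 1 1 by rewrite vgeE ?oner_neq0 // dval1.
have -> : 1 = p%:R - 2%:R * (p./2)%:R :> K.
  by rewrite -natrM mul2n -[p in p%:R]odd_double_half podd natrD addrK.
by apply: vgeB; [rewrite vgeE // vp|rewrite -[1]addr0; apply: vgeM => //; exact: vge_nat].
Qed.
End PadicField.

Theorem theorem2 :
  (forall (K : fieldType) (l : nat),
     [\/ exists R : realType, algebraic_extension R K,
         exists (p : nat) (p_pr : prime p), algebraic_extension (padic_field p_pr) K
       | exists (p : nat) (p_pr : prime p), algebraic_extension (laurentSeries 'F_p) K] ->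
     prime l ->
     forall (c : milnorK 'F_l K) (hc : homogeneous 1 c),
       koszul_module (principal_ideal hc))
  /\
  (forall (K : fieldType) (v : discreteValuation K)
          (k : fieldType) (res : {rmorphism valuationRing v -> k}) (l : nat),
     is_residue_map res -> henselian res ->
     prime l -> l \notin [pchar k] ->
     koszul_algebra (milnorK 'F_l k) ->
     (forall (c : milnorK 'F_l k) (hc : homogeneous 1 c),
        koszul_module (principal_ideal hc)) ->
     koszul_algebra (milnorK 'F_l K) /\
     (forall (c : milnorK 'F_l K) (hc : homogeneous 1 c),
        koszul_module (principal_ideal hc))).
Proof.
split=> [K l ext l_pr c hc|K v k res l res_map hens l_pr lk kA kI]; last first.
  have units1 := hensel_power hens l_pr lk.
  by split=> [|c hc]; [exact: (koszul_extension l_pr res_map units1 kA)|exact: (koszul_extension_ideal l_pr res_map units1 kA kI)].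
case: ext => [[R [iota alg]]|[p [p_pr [iota alg]]]|[p [p_pr [iota alg]]]].
- exact: (koszul_real alg l_pr).2.
- case: (koszul_local (@padic_val_complete p p_pr) (@padic_val_finite p p_pr) alg l_pr) => [l2|_ //].
  by rewrite l2; exact: padic_neg1.
have [v [cv fr]] := laurent_local 'F_p.
(* Over Laurent series [{-1, -1}] already vanishes, so the condition on -1 is empty. *)
case: (koszul_local cv fr alg l_pr) => [l2|_ //].
by rewrite l2 => -[]; exact: (laurent_neg1 'F_p).
Qed.
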